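(* Let $k>t\ge 2$ be fixed integers. For every input graph $G=(V,E)$, the algorithm LocalSearch-$k^-/t$ (described in the context) runs in $O(|V|^4|E|)$ time and outputs a $k^-/t$-star packing $\mathcal{P}$ of $G$ with $$Opt \le \Bigl(1+\frac{1}{t+1+1/k}\Bigr)|V(\mathcal{P})|,$$ where $Opt$ is the maximum number of vertices of $G$ coverable by a $k^-/t$-star packing of $G$. That is, it is an $O(|V|^4|E|)$-time $(1+\frac1{t+1+1/k})$-approximation for the $k^-/t$-star packing problem.
   Context: For an integer $\ell\ge1$, an $\ell$-star is a graph with one vertex (center) of degree $\ell$ adjacent to $\ell$ degree-$1$ vertices (satellites). A $k^-$-star is an $\ell$-star with $1\le\ell\le k$. A $k^-$-star packing of $G$ is a set of vertex-disjoint subgraphs of $G$ each a $k^-$-star; a $k^-/t$-star packing is a $k^-$-star packing containing no $t$-star. $V(\mathcal{P})$ denotes the covered vertex set. The $k^-/t$-star packing problem asks to maximize the number of covered vertices. Algorithm LocalSearch-$k^-/t$: (1) compute a $k^-$-star packing $\mathcal{Q}_0$ of $G$ covering the maximum possible number of vertices. (2) While some Revise operation is applicable, apply it to update $\mathcal{Q}_0$. Each Revise operation replaces a few stars of $\mathcal{Q}_0$ by $k^-$-stars of $G$ covering exactly the same vertex set, and is applicable only if it reduces the number of $t$-stars in $\mathcal{Q}_0$, or keeps the number of $t$-stars and increases the number of other stars. The Revise operations are: Revise-$t$: a $t$-star is revised into a $(t-2)$-star and a $1$-star (not used when $t=2$); Revise-$(t,i)$: a $t$-star and an $i$-star are revised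 into two $k^-$-stars none of which is a $t$-star, or into three $k^-$-stars at most one of which is a $t$-star; Revise-$(t,t,i)$ with $i\in\{1,t-1,t+1\}$: two $t$-stars and an $i$-star are revised into two or three $k^-$-stars none of which is a $t$-star. (3) Remove one satellite from each remaining $t$-star of $\mathcal{Q}_0$ and output the result as $\mathcal{P}$.
   Formalization: For t=2, Revise-(t,t,i) may also produce four k^- -stars, none a t-star: with only two or three, the ratio fails on the path on 8 vertices (8/6). The time bound is taken as O(|V|^4|E|+1), which differs only for edgeless graphs. *)

(* Defs.v *)
From mathcomp Require Import all_boot all_order all_algebra.

Set Implicit Arguments.
Unset Strict Implicit.
Unset Printing Implicit Defensive.

(* A simple graph is a symmetric irreflexive relation [e : rel T] on a finType
   of vertices. *)

Definition edge_set (T : finType) (e : rel T) : {set {set T}} :=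
  [set [set uv.1; uv.2] | uv : T * T & e uv.1 uv.2].

(* A star is given by its center and its set of satellites; its edges are the
   pairs center-satellite.  A 1-star has two such descriptions (either end may
   be called the center), but the disjointness condition on packings makes
   sure that at most one of them is used. *)
Definition star (T : finType) : Type := (T * {set T})%type.

Section Stars.
Context {T : finType}.
Implicit Types (e : rel T) (k t l : nat) (s : star T) (Q : {set star T}).

Definition order s : nat := #|s.2|.
Definition star_vertices s : {set T} := s.1 |: s.2.

Definition is_star e l s : bool :=
  [&& 0 < l, order s == l, s.1 \notin s.2 & [forall x in s.2, e s.1 x]].

Definition is_star_le e k s : bool := is_star e (order s) s && (order s <= k).

Definition star_packing e k Q : bool :=
  [forall s in Q, is_star_le e k s] &&
  [forall s1 in Q, forall s2 in Q,
     (s1 != s2) ==> [disjoint star_vertices s1 & star_vertices s2]].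

Definition star_packing_no e k t Q : bool :=
  star_packing e k Q && [forall s in Q, order s != t].

Definition covered Q : {set T} := \bigcup_(s in Q) star_vertices s.

Definition opt e k t : nat :=
  \max_(Q : {set star T} | star_packing_no e k t Q) #|covered Q|.

(* The multiset of orders of the stars of [Q], to be compared by [perm_eq]. *)
Definition orders Q : seq nat := [seq order s | s <- enum Q].

Definition num_t t Q : nat := #|[set s in Q | order s == t]|.
Definition num_other t Q : nat := #|[set s in Q | order s != t]|.

Definition max_star_packing e k Q : Prop :=
  star_packing e k Q /\
  forall Q', star_packing e k Q' -> #|covered Q'| <= #|covered Q|.

Definition improves t Q Q' : bool :=
  (num_t t Q' < num_t t Q) ||
  (num_t t Q' == num_t t Q) && (num_other t Q < num_other t Q').

Definition revise_t_shape t (old new : {set star T}) : Prop :=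
  [/\ t != 2, perm_eq (orders old) [:: t] & perm_eq (orders new) [:: t - 2; 1]].

Definition revise_ti_shape t i (old new : {set star T}) : Prop :=
  perm_eq (orders old) [:: t; i] /\
  (#|new| = 2 /\ num_t t new = 0 \/ #|new| = 3 /\ num_t t new <= 1).

(* Four stars are allowed when t = 2, for the following reason.  If satellites
   of two t-stars are adjacent to the two ends of a 1-star, respectively, then
   for t >= 3 a single t-star and the 1-star can already be revised, into a
   (t-1)-star and a 2-star; for t = 2 that 2-star is itself a t-star, and only
   both 2-stars together with the 1-star can be revised, into four 1-stars.
   With at most three stars, the path on 8 vertices covered by a 2-star, a
   1-star and a 2-star in this order would be a local optimum, of ratio
   8/6 > 1 + 1/(t + 1 + 1/k). *)
Definition revise_tti_shape t i (old new : {set star T}) : Prop :=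
  [/\ i \in [:: 1; t - 1; t + 1], perm_eq (orders old) [:: t; t; i],
      [\/ #|new| = 2, #|new| = 3 | t = 2 /\ #|new| = 4] & num_t t new = 0].

Definition revise e k t Q Q' : Prop :=
  exists old new : {set star T},
    [/\ old \subset Q,
        star_packing e k new /\ covered new = covered old,
        [\/ revise_t_shape t old new,
            exists i, revise_ti_shape t i old new |
            exists i, revise_tti_shape t i old new],
        Q' = (Q :\: old) :|: new &
        improves t Q Q'].

(* [revise_loop e k t Q Qs R]: from [Q], the loop goes through the successive
   packings [Qs] (the first being [Q], the last being [R]) and exits with [R]. *)
Inductive revise_loop e k t :
    {set star T} -> seq {set star T} -> {set star T} -> Prop :=
| revise_loop_exit Q :
    (forall Q', ~ revise e k t Q Q') -> revise_loop e k t Q [:: Q] Q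
| revise_loop_step Q Q' Qs R :
    revise e k t Q Q' -> revise_loop e k t Q' Qs R ->
    revise_loop e k t Q (Q :: Qs) R.

Definition trim t Q P : Prop :=
  exists f : star T -> T,
    (forall s, s \in Q -> order s = t -> f s \in s.2) /\
    P = [set (if order s == t then (s.1, s.2 :\ f s) else s) | s in Q].

(* A complete run of the (nondeterministic) algorithm: [Qs] lists the
   successive values of the working packing and [P] is the output. *)
Definition local_search e k t (Qs : seq {set star T}) P : Prop :=
  exists Q0 R, [/\ max_star_packing e k Q0, revise_loop e k t Q0 Qs R
                 & trim t R P].

End Stars.

(* The machine model is the random access machine with the uniform cost
   criterion: infinitely many registers holding natural numbers, indirect
   addressing, an output tape, addition and truncated subtraction as the only
   arithmetic (no multiplication, so that unit cost is not abusive), presented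
   with structured control instead of jumps.  Each node of an expression and
   each instruction or loop test costs 1. *)
Inductive expr : Type :=
| Lit of nat
| Reg of expr                (* the content of the register of given address *)
| Add of expr & expr
| Sub of expr & expr.

Inductive prog : Type :=
| Skip
| Store of expr & expr       (* address, value *)
| Emit of expr
| Seq of prog & prog
| If of expr & prog & prog
| While of expr & prog.

Definition memory : Type := nat -> nat.

Fixpoint eval (mu : memory) (a : expr) : nat :=
  match a with
  | Lit n => n
  | Reg b => mu (eval mu b)
  | Add b c => eval mu b + eval mu c
  | Sub b c => eval mu b - eval mu c
  end.

Fixpoint ecost (a : expr) : nat :=
  match a with
  | Lit _ => 1
  | Reg b => (ecost b).+1
  | Add b c | Sub b c => (ecost b + ecost c).+1
  end.

Definition update (mu : memory) (i v : nat) : memory :=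
  fun j => if j == i then v else mu j.

(* [exec p mu mu' out c]: started in memory [mu], the program [p] halts in
   memory [mu'] after [c] steps, having written [out] on the output tape. *)
Inductive exec : prog -> memory -> memory -> seq nat -> nat -> Prop :=
| exec_skip mu : exec Skip mu mu [::] 1
| exec_store mu a b :
    exec (Store a b) mu (update mu (eval mu a) (eval mu b)) [::]
         (ecost a + ecost b).+1
| exec_emit mu a : exec (Emit a) mu mu [:: eval mu a] (ecost a).+1
| exec_seq p q mu mu1 mu2 out1 out2 c1 c2 :
    exec p mu mu1 out1 c1 -> exec q mu1 mu2 out2 c2 ->
    exec (Seq p q) mu mu2 (out1 ++ out2) (c1 + c2)
| exec_if a p q mu mu1 out c :
    exec (if eval mu a != 0 then p else q) mu mu1 out c ->
    exec (If a p q) mu mu1 out (ecost a + c).+1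
| exec_while_exit a p mu :
    eval mu a = 0 -> exec (While a p) mu mu [::] (ecost a).+1
| exec_while_loop a p mu mu1 mu2 out1 out2 c1 c2 :
    eval mu a != 0 -> exec p mu mu1 out1 c1 ->
    exec (While a p) mu1 mu2 out2 c2 ->
    exec (While a p) mu mu2 (out1 ++ out2) (ecost a + c1 + c2).+1.

(* Every edge is listed exactly once, in any order and in any orientation. *)
Definition edge_listing (n : nat) (e : rel 'I_n) (E : seq ('I_n * 'I_n)) : Prop :=
  perm_eq [seq [set uv.1; uv.2] | uv <- E] (enum (edge_set e)).

(* The input graph is stored as |V|, |E|, u_1, v_1, u_2, v_2, ... in registers
   0, 1, 2, ...; all other registers contain 0. *)
Definition input_memory (n : nat) (E : seq ('I_n * 'I_n)) : memory :=
  nth 0 (n :: size E :: flatten [seq [:: val uv.1; val uv.2] | uv <- E]).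

(* A packing is written as the number of its stars followed by the stars, each
   as its center, its number of satellites and the satellites, the orders in
   which stars and satellites are enumerated being free. *)
Definition packing_code (n : nat) (Q : {set star 'I_n}) (w : seq nat) : Prop :=
  exists L : seq ('I_n * seq 'I_n),
    [/\ all (fun l => uniq l.2) L,
        perm_eq [seq (l.1, [set x in l.2]) : star 'I_n | l <- L] (enum Q) &
        w = size L ::
            flatten [seq val l.1 :: size l.2 :: [seq val x | x <- l.2] | l <- L]].

Fixpoint packings_code (n : nat) (Qs : seq {set star 'I_n}) (w : seq nat) : Prop :=
  match Qs with
  | [::] => w = [::]
  | Q :: Qs' => exists w1 w2,
      [/\ packing_code Q w1, packings_code Qs' w2 & w = w1 ++ w2]
  end.

(* [p] implements the algorithm in time O(|V|^4 |E|): on every input graph it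
   carries out a complete run, writing the successive working packings and
   finally the output packing.  The "+ 1" only matters for edgeless graphs,
   where |V|^4 |E| = 0 whereas no computation takes 0 steps. *)
Definition runs_local_search_in_time (k t : nat) (p : prog) : Prop :=
  exists C : nat,
  forall (n : nat) (e : rel 'I_n) (E : seq ('I_n * 'I_n)),
    symmetric e -> irreflexive e -> edge_listing e E ->
    exists (mu : memory) (out : seq nat) (c : nat)
           (Qs : seq {set star 'I_n}) (P : {set star 'I_n}),
      [/\ exec p (input_memory E) mu out c,
          c <= C * (n ^ 4 * #|edge_set e| + 1),
          local_search e k t Qs P &
          packings_code (rcons Qs P) out].

(* Main.v *)
Require Import Defs.
From mathcomp Require Import all_boot all_order all_algebra.
From mathcomp Require Import zify.

Import Order.TTheory GRing.Theory Num.Theory.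

(* Approximation.  Starting from an uncovered vertex w, a neighbour u of w either
   is the center of a star with fewer than k satellites (or a satellite), and w
   can be covered as well, or it is the center of a k-star, any satellite of which
   can be released in favour of w.  If no augmentation is reachable in this way
   from the uncovered vertices, then the set D of the vertices that cannot be
   released has all its neighbours in a set S of centers of k-stars with
   satellites in D, whence the optimality of the packing.  Compared with such a
   packing, any other k-star packing O misses at least as many further vertices
   as there are "bad" vertices: vertices outside D and S that O does not cover
   or joins to S.  Let q be the number of t-stars of a local optimum, and suppose
   that O has no t-star.  Every t-star either owns a bad vertex or, by means of
   the edges of O leaving it, gives a token to another star; since no Revise
   operation applies, that star is not a t-star and a star of order i gets at
   most i tokens.  So q is at most the number of bad vertices plus k/(k+1) times
   the number of vertices in the stars that are not t-stars, which is the ratio.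

   Running time.  Programs are written in a language of bounded loops over the
   vertices and the edges, where O(n^a m^b) steps can be read off the nesting of
   the loops, and then compiled to the RAM.  As k and t are fixed, only finitely
   many patterns of revisions of at most three stars exist, and one is looked for
   by three nested loops over the centers.  Each revision increases the number of
   stars that are not t-stars, so that n rounds suffice. *)

Set Implicit Arguments.
Unset Strict Implicit.
Unset Printing Implicit Defensive.

(** * Star packings as maps *)

(** Let q, b and R be the numbers of t-stars, of bad vertices and of vertices in the other stars of
    the local optimum. A t-star-free packing covers at most (t + 1) q + R - b vertices while the
    output covers t q + R; in the extreme case b = 0, q = k R / (k + 1) the quotient is (k (t + 2) +
    1) / (k (t + 1) + 1), which is the ratio. The main obstacle is t = 2: a 1-star that receives a
    satellite is a t-star again, and in a 2-star on a triangle the center can be exchanged with a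
    satellite, so 2-stars around a 1-star need revisions of their own. Another difficulty is a
    t-star without exit whose optimal star continues into the center of a second t-star: it cannot
    hand its token to a t-star, but all satellites of that second star are then exits, and one of
    them is lent. Packings are encoded as maps so that a revision becomes a script of moves of
    single vertices and its legality a computation on a list of orders. The program uses the same
    encoding, so that its search is complete for the Revise operations as defined and not only for
    those met in the analysis. *)

Section StarMaps.
Variables (T : finType) (e : rel T).
Hypotheses (e_sym : symmetric e) (e_irr : irreflexive e).
Implicit Types (p q : T -> T) (u v w x c z : T) (F : seq T) (Q : {set star T}).

(* A star packing is encoded by the map that sends each vertex to the center of
   its star and fixes the uncovered vertices. *)
Definition sats p v : {set T} := [set w | (p w == v) && (w != v)].
Definition ord p v : nat := #|sats p v|.

Definition star_map p : Prop :=
  (forall v, p (p v) = p v) /\ (forall v, p v != v -> e (p v) v).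

Definition star_map_le k p : Prop := star_map p /\ forall v, ord p v <= k.

Definition starof p v : star T := (v, sats p v).
Definition packing_of p : {set star T} :=
  [set starof p v | v in [pred v | 0 < ord p v]].

Lemma in_sats p v w : (w \in sats p v) = (p w == v) && (w != v).
Proof. by rewrite inE. Qed.

Lemma order_starof p v : Defs.order (starof p v) = ord p v.
Proof. by []. Qed.

Lemma starof_inj p : injective (starof p).
Proof. by move=> u v []. Qed.

Lemma ord_gt0_center p v : star_map p -> 0 < ord p v -> p v = v.
Proof.
move=> [pp _] /card_gt0P[w]; rewrite in_sats => /andP[/eqP <- _]; exact: pp.
Qed.

Lemma ord_sat p v : star_map p -> p v != v -> ord p v = 0.
Proof.
move=> sm vN; apply/eqP; rewrite -leqn0 leqNgt; apply: contra vN => h.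
by apply/eqP/ord_gt0_center.
Qed.

Lemma ord_pgt0 p v : p v != v -> 0 < ord p (p v).
Proof. by move=> vN; apply/card_gt0P; exists v; rewrite in_sats eqxx eq_sym. Qed.

Lemma ord_eq p q v : p =1 q -> ord p v = ord q v.
Proof. by move=> pq; apply: eq_card => w; rewrite !in_sats pq. Qed.

Lemma mem_packing_of p s :
  (s \in packing_of p) = (0 < ord p s.1) && (s == starof p s.1).
Proof.
apply/imsetP/andP => [[v]|[h /eqP ->]]; first by rewrite inE => h ->.
by exists s.1.
Qed.

Lemma starof_vertices p v :
  star_map p -> 0 < ord p v -> star_vertices (starof p v) = [set w | p w == v].
Proof.
move=> sm h; apply/setP=> w; rewrite !inE /=.
have := ord_gt0_center sm h.
by case: eqVneq => [->|_ _] /=; rewrite ?andbT // => ->; rewrite eqxx.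
Qed.

Lemma packing_of_packing k p : star_map_le k p -> star_packing e k (packing_of p).
Proof.
move=> [sm pk]; apply/andP; split.
  apply/forallP=> s; apply/implyP; rewrite mem_packing_of => /andP[h /eqP ->].
  rewrite /is_star_le /is_star order_starof eqxx h pk in_sats eqxx andbF /= andbT.
  apply/forallP=> w; apply/implyP; rewrite in_sats => /andP[/eqP <- hw].
  by apply: sm.2; rewrite eq_sym.
apply/forallP=> s1; apply/implyP; rewrite mem_packing_of => /andP[h1 /eqP ->].
apply/forallP=> s2; apply/implyP; rewrite mem_packing_of => /andP[h2 /eqP ->].
apply/implyP=> /eqP neq; rewrite !starof_vertices //.
rewrite -setI_eq0; apply/eqP/setP=> w; rewrite !inE; apply/negP.
by move=> /andP[/eqP e1 /eqP e2]; apply: neq; rewrite -e1 -e2.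
Qed.

Lemma covered_packing_of p v :
  star_map p -> (v \in covered (packing_of p)) = (0 < ord p (p v)).
Proof.
move=> sm; apply/bigcupP/idP.
  move=> [s]; rewrite mem_packing_of => /andP[h /eqP ->].
  by rewrite starof_vertices // inE => /eqP ->.
move=> h; exists (starof p (p v)); rewrite ?mem_packing_of /= ?h ?eqxx //.
by rewrite starof_vertices // inE.
Qed.

Lemma packingP k (Q : {set star T}) :
  star_packing e k Q ->
  (forall s, s \in Q -> [/\ 0 < Defs.order s <= k, s.1 \notin s.2 &
                         forall x, x \in s.2 -> e s.1 x]) /\
  (forall s1 s2 v, s1 \in Q -> s2 \in Q ->
     v \in star_vertices s1 -> v \in star_vertices s2 -> s1 = s2).
Proof.
move=> /andP[/forallP h1 /forallP h2]; split.
  move=> s sQ; have := h1 s; rewrite sQ /= => /andP[/and4P[a _ b /forallP c] d].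
  split=> //; first by rewrite a d.
  by move=> x xs; have := c x; rewrite xs.
move=> s1 s2 v q1 q2 v1 v2; apply/eqP.
have := h2 s1; rewrite q1 /= => /forallP/(_ s2); rewrite q2 /=.
case: eqP => //= _; rewrite -setI_eq0 => /eqP/setP/(_ v).
by rewrite in_setI v1 v2 inE.
Qed.

Definition map_of_packing (Q : {set star T}) v : T :=
  if [pick s in Q | v \in star_vertices s] is Some s then s.1 else v.

Lemma map_of_packing_in k Q s v : star_packing e k Q ->
  s \in Q -> v \in star_vertices s -> map_of_packing Q v = s.1.
Proof.
move=> /packingP[_ dj] sQ vs; rewrite /map_of_packing.
case: pickP => [s' /andP[s'Q vs']|/(_ s)]; last by rewrite sQ vs.
by rewrite (dj _ _ v s'Q sQ).
Qed.

Lemma map_of_packing_out Q v :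
  (forall s, s \in Q -> v \notin star_vertices s) -> map_of_packing Q v = v.
Proof.
move=> h; rewrite /map_of_packing; case: pickP => // s /andP[sQ vs].
by have := h s sQ; rewrite vs.
Qed.

Lemma map_of_packing_sats k Q s : star_packing e k Q -> s \in Q ->
  sats (map_of_packing Q) s.1 = s.2.
Proof.
move=> pk sQ; have [h1 h2] := packingP pk.
apply/setP=> w; rewrite in_sats; apply/andP/idP.
  move=> [/eqP]; rewrite /map_of_packing; case: pickP => [s' /andP[s'Q ws']|_ ->];
    last by rewrite eqxx.
  move=> ss; have E : s' = s by apply: (h2 _ _ s.1); rewrite // !inE ?ss eqxx.
  by move: ws'; rewrite E => /setU1P[->|//]; rewrite eqxx.
move=> ws; rewrite (map_of_packing_in pk sQ) ?eqxx ?inE ?ws ?orbT //.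
split=> //; apply: contraTneq ws => ->; by have [] := h1 s sQ.
Qed.

(** A 1-star keeps the end that the packing names as its center, so the packing is recovered
    exactly, and statements pass from packings to star maps and back. *)
Lemma map_of_packingP k Q : star_packing e k Q ->
  star_map_le k (map_of_packing Q) /\ packing_of (map_of_packing Q) = Q.
Proof.
move=> pk; have [h1 h2] := packingP pk.
have cases v : (exists2 s, s \in Q & v \in star_vertices s) \/
    (forall s, s \in Q -> v \notin star_vertices s).
  case: (boolP [exists s in Q, v \in star_vertices s]) => [/exists_inP[s]|].
    by move=> a b; left; exists s.
  by move=> /exists_inPn h; right.
have sm : star_map (map_of_packing Q).
  split=> v; case: (cases v) => [[s sQ vs]|out].
  - rewrite (map_of_packing_in pk sQ vs) (map_of_packing_in pk sQ) //.
    by rewrite !inE eqxx.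
  - by rewrite !(map_of_packing_out out).
  - rewrite (map_of_packing_in pk sQ vs); move: vs => /setU1P[->|vs _].
      by rewrite eqxx.
    by have [_ _] := h1 s sQ; apply.
  by rewrite (map_of_packing_out out) eqxx.
have ordE s : s \in Q -> ord (map_of_packing Q) s.1 = Defs.order s.
  by move=> sQ; rewrite /ord (map_of_packing_sats pk sQ).
split; first split=> // v.
  case: (posnP (ord (map_of_packing Q) v)) => [->//|gt0].
  have := ord_gt0_center sm gt0; case: (cases v) => [[s sQ vs]|out].
    rewrite (map_of_packing_in pk sQ vs) => <-; rewrite ordE //.
    by have [/andP[]] := h1 s sQ.
  move=> _; move/card_gt0P: gt0 => [w]; rewrite in_sats => /andP[/eqP E wv].
  case: (cases w) => [[s sQ ws]|outw].
    have sv : s.1 = v by rewrite -(map_of_packing_in pk sQ ws).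
    by have := out s sQ; rewrite -sv !inE eqxx.
  by move: wv; rewrite -E (map_of_packing_out outw) eqxx.
apply/setP=> s; rewrite mem_packing_of; apply/andP/idP.
  move=> [gt0 /eqP E].
  have c1 := ord_gt0_center sm gt0; move/card_gt0P: gt0 => [w].
  rewrite in_sats => /andP[/eqP ws w1].
  case: (cases w) => [[s' s'Q ws']|outw]; last first.
    by move: w1; rewrite -ws (map_of_packing_out outw) eqxx.
  have s1 : s'.1 = s.1 by rewrite -(map_of_packing_in pk s'Q ws').
  suff -> : s = s' by [].
  by rewrite E /starof -s1 (map_of_packing_sats pk s'Q); case: (s').
move=> sQ; rewrite ordE //; have [/andP[-> _] _ _] := h1 s sQ; split=> //.
by rewrite /starof (map_of_packing_sats pk sQ); case: (s).
Qed.

Lemma card_packing_of p (a : pred nat) :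
  #|[set s in packing_of p | a (Defs.order s)]| = #|[set v | (0 < ord p v) && a (ord p v)]|.
Proof.
rewrite -(card_imset _ (@starof_inj p)); apply: eq_card => s.
rewrite !inE mem_packing_of; apply/andP/imsetP.
  move=> [/andP[h1 /eqP h2] h3]; exists s.1 => //.
  by rewrite inE h1 -order_starof -h2.
by move=> [v]; rewrite inE => /andP[h1 h2] ->; rewrite order_starof h1 h2 eqxx.
Qed.

Lemma num_t_packing_of p t : 0 < t ->
  num_t t (packing_of p) = #|[set v | ord p v == t]|.
Proof.
move=> t0; rewrite /num_t (card_packing_of p (pred1 t)); apply: eq_card => v.
by rewrite !inE /=; case: eqP => [->|]; rewrite ?t0 ?andbF.
Qed.

Lemma num_other_packing_of p t :
  num_other t (packing_of p) = #|[set v | (0 < ord p v) && (ord p v != t)]|.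
Proof. exact: (card_packing_of p (predC (pred1 t))). Qed.

End StarMaps.

(** * Revise operations *)

(** The legality of a revision depends on the two lists of orders only. As this test is decidable,
    the program can tabulate the revisions beforehand. *)
Definition revise_shape (t : nat) (os ns : seq nat) : bool :=
  [|| [&& t != 2, perm_eq os [:: t] & perm_eq ns [:: t - 2; 1]],
      [&& size os == 2, t \in os &
          (size ns == 2) && (count_mem t ns == 0) ||
          (size ns == 3) && (count_mem t ns <= 1)]
    | [&& has (fun i => perm_eq os [:: t; t; i]) [:: 1; t - 1; t + 1],
          [|| size ns == 2, size ns == 3 | (t == 2) && (size ns == 4)]
        & count_mem t ns == 0]].

(** For [t > 1] each shape improves by itself, so applicability needs no separate check. The last
    conjunct is what bounds the number of rounds: the stars that are not t-stars become more
    numerous in every case, even when the number of t-stars drops. *)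
Lemma revise_shape_improves t os ns : 1 < t -> revise_shape t os ns ->
  ((count_mem t ns < count_mem t os) ||
   (count_mem t ns == count_mem t os) && (size os < size ns)) &&
  (size os - count_mem t os < size ns - count_mem t ns).
Proof.
move=> t2 /or3P[/and3P[_ /[dup]/perm_size -> /permP -> /[dup]/perm_size -> /permP ->]
  |/and3P[/eqP os2 tos h]|/and3P[/hasP[i _ /[dup]/perm_size -> /permP ->] h /eqP ->]].
- rewrite /= eqxx; have -> : (t - 2 == t) = false by apply/eqP; lia.
  by have -> : (1 == t) = false by apply/eqP; lia.
- have c1 : 0 < count_mem t os by rewrite -has_count has_pred1.
  have := count_size (pred1 t) os; rewrite os2.
  move: c1; set a := count_mem t os; set b := count_mem t ns in h *.
  by case/orP: h => /andP[/eqP ->]; lia.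
- rewrite /= eqxx; case: (i == t); case/or3P: h => [/eqP->|/eqP->|/andP[_ /eqP->]] //.
Qed.

Section Revise.
Variables (T : finType) (e : rel T).
Hypotheses (e_sym : symmetric e) (e_irr : irreflexive e).
Implicit Types (p q : T -> T) (u v w x c z : T) (F : seq T) (Q : {set star T}).

Lemma sub_packing k Q Q' : Q' \subset Q -> star_packing e k Q -> star_packing e k Q'.
Proof.
move=> /subsetP sub /andP[/forallP h1 /forallP h2]; apply/andP; split.
  by apply/forallP=> s; apply/implyP=> /sub sQ; have := h1 s; rewrite sQ.
apply/forallP=> s1; apply/implyP=> /sub s1Q; apply/forallP=> s2; apply/implyP=> /sub s2Q.
by have := h2 s1; rewrite s1Q => /forallP/(_ s2); rewrite s2Q.
Qed.

Lemma revise_shapeP t (old new : {set star T}) os ns :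
  perm_eq (orders old) os -> perm_eq (orders new) ns ->
  [\/ revise_t_shape t old new, exists i, revise_ti_shape t i old new |
      exists i, revise_tti_shape t i old new] <-> revise_shape t os ns.
Proof.
move=> po pn.
have sz : #|new| = size ns by rewrite -(perm_size pn) size_map cardE.
have ct : num_t t new = count_mem t ns.
  rewrite -(permP pn) count_map /num_t -size_filter.
  rewrite -(card_uniqP (filter_uniq _ (enum_uniq _))); apply: eq_card => s.
  by rewrite !inE mem_filter mem_enum andbC.
have pO l : perm_eq (orders old) l = perm_eq os l by exact: permPl.
split.
  move=> [[h1 h2 h3]|[i [h1 h2]]|[i [h1 h2 h3 h4]]]; apply/or3P.
  - by constructor 1; rewrite h1 -pO h2 /= -(permPl pn) h3.
  - constructor 2; move: h1; rewrite pO => h1.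
    rewrite (perm_size h1) (perm_mem h1) mem_head /= -sz -ct.
    by case: h2 => [[-> ->]//|[-> ->]]; rewrite orbT.
  - constructor 3; apply/and3P; split; last by rewrite -ct h4.
      by apply/hasP; exists i => //; rewrite -pO.
    by rewrite -sz; case: h3 => [->|->|[-> ->]] //; rewrite ?orbT.
move=> /or3P[/and3P[h1 h2 h3]|/and3P[/eqP h1 h2 h3]|/and3P[/hasP[i hi h1] h2 h3]].
- by constructor 1; split=> //; rewrite ?pO // (permPl pn).
- constructor 2; have /perm_to_rem E := h2.
  case R: (rem t os) E => [|i [|? ?]] E; have := perm_size E; rewrite h1 //= => _.
  exists i; split; first by rewrite pO.
  by rewrite sz ct; case/orP: h3 => /andP[/eqP-> h]; [left|right]; split=> //; apply/eqP.
- constructor 3; exists i; split=> //; rewrite ?pO ?ct ?sz //; last exact/eqP.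
  by case/or3P: h2 => [/eqP->|/eqP->|/andP[/eqP-> /eqP->]]; [constructor 1|constructor 2|constructor 3].
Qed.

Lemma perm_orders_starof p F : uniq F ->
  perm_eq (orders [set starof p c | c in F]) [seq ord p c | c <- F].
Proof.
move=> uF; rewrite (_ : [seq ord p c | c <- F] = [seq Defs.order s | s <- [seq starof p c | c <- F]]);
  last by rewrite -map_comp.
apply/perm_map/uniq_perm; rewrite ?enum_uniq ?map_inj_uniq //; first exact: starof_inj.
move=> s; rewrite mem_enum; apply/imsetP/mapP => -[c]; by exists c.
Qed.

Lemma covered_starof p F v : star_map e p -> {in F, forall c, 0 < ord p c} ->
  (v \in covered [set starof p c | c in F]) = (p v \in F).
Proof.
move=> sm F0; apply/bigcupP/idP => [[s /imsetP[c cF ->]]|pF].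
  by rewrite (starof_vertices sm (F0 _ cF)) inE => /eqP ->.
exists (starof p (p v)); first by apply/imsetP; exists (p v).
by rewrite (starof_vertices sm (F0 _ pF)) inE.
Qed.

(* [config p F p' l]: the star map [p'] only rearranges the stars of [p] with
   centers in [F], and [l] lists the centers of [p'] on these vertices
   together with their orders (0 for a vertex temporarily left alone). *)
Definition config p F p' (l : seq (T * nat)) : Prop :=
  [/\ star_map e p', forall v, p v \notin F -> p' v = p v,
      forall v, (p v \in F) = (p' v \in unzip1 l), uniq (unzip1 l) &
      forall a : T * nat, a \in l -> p' a.1 = a.1 /\ ord p' a.1 = a.2].

Lemma config_out p F p' l v : star_map e p -> config p F p' l ->
  v \notin unzip1 l -> v \notin F -> ord p' v = ord p v.
Proof.
move=> sm [sm' h1 h2 _ _] vl vF.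
apply: eq_card => w; rewrite !in_sats; congr andb; apply/eqP/eqP => E.
  by rewrite -h1 // h2 E.
by rewrite h1 // E.
Qed.

Lemma count_centers p F (a : pred nat) : uniq F ->
  #|[set v | a (ord p v)]| =
  #|[set v | (v \notin F) && a (ord p v)]| + count a [seq ord p c | c <- F].
Proof.
move=> uF; rewrite -(cardsID [set v in F]) addnC; congr (_ + _).
  by apply: eq_card => v; rewrite !inE.
rewrite count_map -size_filter -(card_uniqP (filter_uniq _ uF)).
by apply: eq_card => v; rewrite !inE mem_filter.
Qed.

(** A vertex of [F] that is no longer a center has order 0 in [p'], and a new center had order 0 in
    [p]; a predicate failing at 0 ignores both, and outside the two lists the orders agree. *)
Lemma config_count p F p' l (a : pred nat) : star_map e p -> config p F p' l -> uniq F ->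
  {in F, forall c, 0 < ord p c} -> ~~ a 0 ->
  #|[set v | a (ord p v)]| + count a (unzip2 l) =
  #|[set v | a (ord p' v)]| + count a [seq ord p c | c <- F].
Proof.
move=> sm cf uF F0 a0; have [sm' h1 h2 ul h3] := cf.
have -> : unzip2 l = [seq ord p' c | c <- unzip1 l].
  by rewrite -map_comp; apply/eq_in_map => c /h3[_ /= ->].
rewrite (count_centers p a uF) (count_centers p' a ul) addnAC; congr (_ + _ + _).
apply: eq_card => v; rewrite !inE.
case: (boolP (v \in F)) => vF; case: (boolP (v \in unzip1 l)) => vl //=.
- rewrite (ord_sat sm') ?(negPf a0) //; apply: contraNneq vl => E.
  by rewrite -E -h2 (ord_gt0_center sm (F0 _ vF)).
- rewrite (ord_sat sm) ?(negPf a0) //; apply: contraNneq vF => E.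
  rewrite -E h2; case/mapP: vl => c cl ->; have [-> _] := h3 _ cl.
  by apply/mapP; exists c.
- by rewrite (config_out sm cf).
Qed.

Lemma config_packing p F p' l : star_map e p -> config p F p' l ->
  {in F, forall c, 0 < ord p c} -> {in unzip1 l, forall c, 0 < ord p' c} ->
  packing_of p' = (packing_of p :\: [set starof p c | c in F])
                    :|: [set starof p' c | c in unzip1 l].
Proof.
move=> sm cf F0 F'0; have [sm' h1 h2 ul h3] := cf.
set F' := unzip1 l in F'0 *.
set old := [set starof p c | c in F]; set new := [set starof p' c | c in F'].
have st v : v \notin F' -> v \notin F -> sats p' v = sats p v.
  move=> vl vF; apply/setP=> w; rewrite !in_sats; congr andb; apply/eqP/eqP => E.
    by rewrite -h1 // h2 E.
  by rewrite h1 // E.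
have oldE c : (starof p c \in old) = (c \in F).
  by apply: mem_imset; apply: starof_inj.
have newE c : (starof p' c \in new) = (c \in F').
  by apply: mem_imset; apply: starof_inj.
apply/setP=> s; rewrite in_setU in_setD !mem_packing_of; apply/andP/orP.
  move=> [gt0 /eqP Es]; case: (boolP (s.1 \in F')) => sF'.
    by right; rewrite Es newE.
  left; have sF : s.1 \notin F.
    apply: contra sF' => sF.
    by have := h2 s.1; rewrite (ord_gt0_center sm (F0 _ sF)) (ord_gt0_center sm' gt0) sF.
  have Es' : s = starof p s.1 by rewrite {1}Es /starof st.
  by rewrite Es' oldE sF -(config_out sm cf) // gt0 -Es' eqxx.
move=> [/and3P[so gt0 /eqP Es]|/imsetP[c cF ->]]; last by rewrite F'0 //= eqxx.
have sF : s.1 \notin F by rewrite -oldE -Es.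
have sF' : s.1 \notin F'.
  by apply: contra sF => sF'; have := h2 s.1; rewrite (ord_gt0_center sm gt0);
     case/mapP: sF' => a al ->; have [-> _] := h3 _ al; rewrite map_f.
by rewrite (config_out sm cf) // gt0 {1}Es /starof st // eqxx.
Qed.

(** The gate from moves to Revise operations: to contradict local optimality it suffices to build a
    [config] whose orders fit [revise_shape]. *)
Lemma revise_sound k t p F p' l :
  1 < t -> star_map_le e k p -> uniq F -> {in F, forall c, 0 < ord p c} ->
  config p F p' l -> {in unzip2 l, forall o, 0 < o <= k} ->
  revise_shape t [seq ord p c | c <- F] (unzip2 l) ->
  [/\ star_map_le e k p', revise e k t (packing_of p) (packing_of p') &
      num_other t (packing_of p) < num_other t (packing_of p')].
Proof.
move=> t2 [sm pk] uF F0 cf l0 shape; have t0 := ltnW t2.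
have [sm' h1 h2 ul h3] := cf.
set F' := unzip1 l.
have El : unzip2 l = [seq ord p' c | c <- F'].
  by rewrite -map_comp; apply/eq_in_map => c /h3[_ /= ->].
have lo c : c \in F' -> 0 < ord p' c <= k.
  by move=> cF; apply: l0; rewrite El map_f.
have F'0 : {in F', forall c, 0 < ord p' c} by move=> c /lo/andP[].
have smk' : star_map_le e k p'.
  split=> // v; case: (boolP (v \in F')) => [/lo/andP[]//|vl].
  case: (boolP (v \in F)) => vF; last by rewrite (config_out sm cf).
  rewrite (ord_sat sm') //; apply: contraNneq vl => E.
  by rewrite -E -h2 (ord_gt0_center sm (F0 _ vF)).
set old := [set starof p c | c in F]; set new := [set starof p' c | c in F'].
have oldQ : old \subset packing_of p.
  by apply/subsetP=> s /imsetP[c cF ->]; rewrite mem_packing_of F0 //= eqxx.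
have newQ : new \subset packing_of p'.
  by apply/subsetP=> s /imsetP[c cF ->]; rewrite mem_packing_of F'0 //= eqxx.
have cv : covered new = covered old.
  by apply/setP=> v; rewrite (covered_starof _ sm') // (covered_starof _ sm) // h2.
have EQ := config_packing sm cf F0 F'0.
have C a : ~~ a 0 -> #|[set v | a (ord p v)]| + count a (unzip2 l) =
  #|[set v | a (ord p' v)]| + count a [seq ord p c | c <- F] := config_count sm cf uF F0.
have /andP[imp oth] := revise_shape_improves t2 shape.
have t0' : ~~ pred1 t 0 by rewrite /=; lia.
have Ct := C _ t0'.
have /C Co : ~~ [pred o | (0 < o) && (o != t)] 0 by [].
have CC s : {in s, forall o, 0 < o} ->
    count [pred o | (0 < o) && (o != t)] s = size s - count_mem t s.
  move=> s0; rewrite -(count_predC (pred1 t)) addKn; apply: eq_in_count => o /s0 /=.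
  by move->.
rewrite !CC in Co; first last.
- by move=> o /l0/andP[].
- by move=> o /mapP[c /F0 c0 ->].
have t1 q : #|[set v | pred1 t (ord q v)]| = num_t t (packing_of q).
  by rewrite num_t_packing_of.
have t3 q : #|[set v | [pred o | (0 < o) && (o != t)] (ord q v)]| = num_other t (packing_of q).
  by rewrite num_other_packing_of.
rewrite !t1 in Ct; rewrite !t3 in Co.
rewrite !size_map in Co oth imp.
have Lo : num_other t (packing_of p) < num_other t (packing_of p').
  by move: Co oth; do 2!move: (_ - _) => ?; lia.
split=> //; exists old, new; split=> //.
- by split=> //; apply: sub_packing newQ _; apply: packing_of_packing.
- apply/revise_shapeP; last exact: shape; first exact: perm_orders_starof.
  by rewrite El; apply: perm_orders_starof.
- by rewrite /improves Lo andbT; move: Ct imp; do 2!move: (count_mem _ _) => ?; lia.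
Qed.

Lemma revise_complete k t p Q' : star_map_le e k p ->
  revise e k t (packing_of p) Q' ->
  exists F p' F', [/\ uniq F, {in F, forall c, 0 < ord p c},
    config p F p' [seq (c, ord p' c) | c <- F'] /\ {in F', forall c, 0 < ord p' c <= k},
    revise_shape t [seq ord p c | c <- F] [seq ord p' c | c <- F'] &
    Q' = packing_of p'].
Proof.
move=> [sm pk] [old [new [oldQ [pkn cv] sh EQ _]]].
have [[smn pnk] Enew] := map_of_packingP pkn.
set pn := map_of_packing new in smn pnk Enew.
have inold s : s \in old -> 0 < ord p s.1 /\ s = starof p s.1.
  by move=> /(subsetP oldQ); rewrite mem_packing_of => /andP[? /eqP].
have innew s : s \in new -> 0 < ord pn s.1 /\ s = starof pn s.1.
  by rewrite -Enew mem_packing_of => /andP[? /eqP].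
pose F := [seq s.1 | s <- enum old]; pose F' := [seq s.1 | s <- enum new].
have F0 : {in F, forall c, 0 < ord p c}.
  by move=> c /mapP[s]; rewrite mem_enum => /inold[? _] ->.
have F'0 : {in F', forall c, 0 < ord pn c}.
  by move=> c /mapP[s]; rewrite mem_enum => /innew[? _] ->.
have uF : uniq F.
  rewrite map_inj_in_uniq ?enum_uniq // => s1 s2.
  by rewrite !mem_enum => /inold[_ {2}->] /inold[_ {2}->] ->.
have uF' : uniq F'.
  rewrite map_inj_in_uniq ?enum_uniq // => s1 s2.
  by rewrite !mem_enum => /innew[_ {2}->] /innew[_ {2}->] ->.
have Eold : old = [set starof p c | c in F].
  apply/setP=> s; apply/idP/imsetP => [so|[c /mapP[s' +] -> ->]].
    exists s.1; last by have [] := inold _ so.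
    by apply/mapP; exists s; rewrite ?mem_enum.
  by rewrite mem_enum => so; have [_ <-] := inold _ so.
have Enew' : new = [set starof pn c | c in F'].
  apply/setP=> s; apply/idP/imsetP => [so|[c /mapP[s' +] -> ->]].
    exists s.1; last by have [] := innew _ so.
    by apply/mapP; exists s; rewrite ?mem_enum.
  by rewrite mem_enum => so; have [_ <-] := innew _ so.
have cvE v : (p v \in F) = (pn v \in F').
  by rewrite -(covered_starof v sm F0) -Eold -cv Enew' (covered_starof v smn F'0).
(* The two maps can be glued because [old] and [new] cover the same vertices: by [cvE] the fibers of
   [p] over [F] and those of [pn] over [F'] have the same union. *)
pose p' v := if p v \in F then pn v else p v.
have cenF' c : c \in F' -> pn c = c by move=> /F'0/(ord_gt0_center smn).
have sm' : star_map e p'.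
  split=> v; rewrite /p'; case: (boolP (p v \in F)) => vF.
  - by rewrite cvE smn.1 -cvE vF.
  - by rewrite sm.1 (negPf vF).
  - exact: smn.2.
  - exact: sm.2.
have p'F v : (p v \in F) = (p' v \in F').
  rewrite /p'; case: ifP => [vF|/negbT vF]; first by rewrite -cvE vF.
  by apply/esym/negbTE; apply: contra vF => vF'; rewrite -sm.1 cvE (cenF' _ vF').
have st c : c \in F' -> starof p' c = starof pn c.
  move=> cF; congr pair; apply/setP=> w; rewrite !in_sats; congr andb.
  apply/eqP/eqP => E; last by rewrite /p' cvE E cF.
  have wF : p w \in F by rewrite p'F E.
  by rewrite -E /p' wF.
have ordE c : c \in F' -> ord p' c = ord pn c.
  by move=> /st E; rewrite -!order_starof E.
have E1 : unzip1 [seq (c, ord p' c) | c <- F'] = F'.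
  by rewrite /unzip1 -map_comp map_id_in.
have cf : config p F p' [seq (c, ord p' c) | c <- F'].
  split=> //; rewrite ?E1 //; first by move=> v; rewrite /p' => /negbTE->.
  move=> a /mapP[c cF ->] /=; split=> //.
  by rewrite /p' cvE (cenF' _ cF) cF.
have F'E : [set starof p' c | c in F'] = new.
  by rewrite Enew'; apply: eq_in_imset => c /st.
exists F, p', F'; split=> //.
- by split=> // c cF; rewrite ordE // F'0 // pnk.
- have po : perm_eq (orders old) [seq ord p c | c <- F].
    by rewrite Eold; apply: perm_orders_starof.
  have pn' : perm_eq (orders new) [seq ord p' c | c <- F'].
    by rewrite -F'E; apply: perm_orders_starof.
  by have /(_ t)[+ _] := revise_shapeP _ po pn'; apply.
- rewrite EQ (config_packing sm cf F0) ?E1 ?F'E -?Eold // => c cF.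
  by rewrite ordE // F'0.
Qed.

(** * Elementary moves: detaching and attaching a single vertex *)

Section Moves.
Variables (p : T -> T) (F : seq T).

Definition move p' s z v : T := if v == s then z else p' v.

Lemma config_init : star_map e p -> uniq F -> {in F, forall c, p c = c} ->
  config p F p [seq (c, ord p c) | c <- F].
Proof.
move=> sm uF Fc; have E : unzip1 [seq (c, ord p c) | c <- F] = F.
  by rewrite /unzip1 -map_comp map_id_in.
split=> //; rewrite ?E // => a /mapP[c /Fc cc ->] /=.
by split.
Qed.

Lemma config_perm p' l l' : perm_eq l l' -> config p F p' l -> config p F p' l'.
Proof.
move=> ll [h1 h2 h3 h4 h5]; have l1 : perm_eq (unzip1 l) (unzip1 l') by exact: perm_map.
split=> //; first by move=> v; rewrite h3 (perm_mem l1).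
  by rewrite -(perm_uniq l1).
by move=> a; rewrite -(perm_mem ll); apply: h5.
Qed.

Lemma config_rot i p' l : config p F p' l -> config p F p' (rot i l).
Proof. by apply: config_perm; rewrite perm_sym perm_rot. Qed.

(** The list serves as a stack: the elementary moves act on its first entries, and [config_perm]
    brings the wanted ones to the front. The revisions in the analysis of local optima are scripts
    of such moves. *)
Lemma config_detach p' c o l s : p' s = c -> s != c ->
  config p F p' ((c, o) :: l) ->
  config p F (move p' s s) ((s, 0) :: (c, o.-1) :: l).
Proof.
move=> ps sc [sm h1 h2 ul h5].
have [/= pc oc] := h5 _ (mem_head _ _).
have ns v : p' v != s by apply: contraNneq sc => E; rewrite -ps -E sm.1.
have sl : s \notin c :: unzip1 l.
  rewrite inE negb_or sc /=; apply/negP => /mapP[a al Es].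
  by have [] := h5 a (mem_behead (s := _ :: l) al); rewrite -Es ps => E; rewrite E eqxx in sc.
have ordE v : v \in c :: unzip1 l -> v != c -> ord (move p' s s) v = ord p' v.
  move=> vl vc; apply: eq_card => w; rewrite !in_sats /move.
  case: (eqVneq w s) => // ->; rewrite ps (eq_sym c) (negPf vc).
  by apply/negbTE; apply: contra sl => /andP[/eqP -> _].
split.
- split=> v; rewrite /move; last by case: (v =P s) => [->|_]; rewrite ?eqxx //; apply: sm.2.
  by case: (v =P s) => _; rewrite ?eqxx // (negPf (ns v)) sm.1.
- move=> v vF; rewrite /move; case: eqP vF => [->|_]; last exact: h1.
  by rewrite h2 ps mem_head.
- move=> v; rewrite /move h2 /=; case: eqP => [->|_]; first by rewrite ps !mem_head.
  by rewrite [in RHS]inE (negPf (ns v)).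
- by rewrite /= sl.
- move=> a; rewrite 2!inE => /or3P[/eqP->|/eqP->|al] /=.
  + rewrite /move eqxx; split=> //; apply/eqP; rewrite cards_eq0; apply/eqP/setP=> w.
    rewrite in_sats inE /move; case: (eqVneq w s) => [_|_]; rewrite ?andbF //.
    by rewrite (negPf (ns w)).
  + rewrite /move eq_sym (negPf sc); split=> //; rewrite -oc /= /ord (cardsD1 s (sats p' c)).
    rewrite in_sats ps eqxx sc add1n /=; apply: eq_card => w; rewrite !inE.
    by case: (eqVneq w s) => // ->; rewrite (negPf sc).
  have [E1 E2] := h5 a (mem_behead (s := _ :: l) al).
  have a1 : a.1 \in unzip1 l by apply: map_f.
  have aN : a.1 != c by move: ul => /= /andP[+ _]; apply: contraNneq => <-.
  by rewrite ordE ?inE ?a1 ?orbT //; split=> //; rewrite /move; case: eqP => // ->.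
Qed.

Lemma config_attach p' s z o l : e z s ->
  config p F p' ((s, 0) :: (z, o) :: l) ->
  config p F (move p' s z) ((z, o.+1) :: l).
Proof.
move=> ezs [sm h1 h2 /= /and3P[sl zl ul] h5].
have [/= ps os] := h5 (s, 0) (mem_head _ _).
have [/= pz oz] := h5 (z, o) (mem_behead (s := _ :: _) (mem_head _ _)).
have sz : s != z by apply: contraNneq sl => ->; rewrite mem_head.
have ns v : v != s -> p' v != s.
  move=> vs; apply/eqP=> E; have: v \in sats p' s by rewrite in_sats E eqxx.
  by move/eqP: os; rewrite cards_eq0 => /eqP->; rewrite inE.
split.
- split=> v; rewrite /move; last by case: (v =P s) => [-> _|_] //; apply: sm.2.
  case: (eqVneq v s) => [_|vs]; first by rewrite eq_sym (negPf sz).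
  by rewrite (negPf (ns v vs)) sm.1.
- move=> v vF; rewrite /move; case: eqP vF => [->|_]; last exact: h1.
  by rewrite h2 ps mem_head.
- move=> v; rewrite /move h2 /=; case: (eqVneq v s) => [->|vs]; first by rewrite ps !mem_head.
  by rewrite inE (negPf (ns v vs)).
- by rewrite /= zl.
- move=> a; rewrite inE => /orP[/eqP->|al] /=.
  + rewrite /move eq_sym (negPf sz); split=> //; rewrite -oz /ord (cardsD1 s (sats _ z)).
    rewrite in_sats eqxx eqxx sz add1n; congr S; apply: eq_card => w; rewrite !inE.
    by case: (eqVneq w s) => // ->; rewrite ps (negPf sz).
  have [E1 E2] := h5 a (mem_behead (s := _ :: _ :: l) (mem_behead (s := _ :: l) al)).
  have a1 : a.1 \in unzip1 l by apply: map_f.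
  have as_ : a.1 != s by apply: contraNneq sl => <-; rewrite inE a1 orbT.
  have az : a.1 != z by apply: contraNneq zl => <-.
  split; first by rewrite /move (negPf as_).
  rewrite -E2; apply: eq_card => w; rewrite !in_sats /move.
  by case: (eqVneq w s) => // ->; rewrite ps eq_sym (negPf az) eq_sym (negPf as_).
Qed.

End Moves.
End Revise.

(** * Maximum star packings: augmentations, shifts and released vertices *)

Section Maximum.
Variables (T : finType) (e : rel T).
Hypotheses (e_sym : symmetric e) (e_irr : irreflexive e).
Variable k : nat.
Hypothesis k2 : 1 < k.
Implicit Types (p q : T -> T) (u v w x c z : T) (F : seq T) (Q : {set star T}).

Definition cov p : {set T} := [set v | 0 < ord p (p v)].

Lemma cov_covered p : star_map e p -> cov p = covered (packing_of p).
Proof. by move=> sm; apply/setP=> v; rewrite inE (covered_packing_of _ sm). Qed.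

Lemma config_away p F p' l v : star_map e p -> config e p F p' l -> p v \notin F ->
  p' v = p v /\ ord p' (p v) = ord p (p v).
Proof.
move=> sm cf vF; have [sm' h1 h2 _ h5] := cf; split; first exact: h1.
apply: (config_out sm cf) => //; apply: contra vF => /mapP[a al E].
rewrite -sm.1 h2 E; have [-> _] := h5 _ al; exact: map_f.
Qed.

Lemma config_le p F p' l : star_map_le e k p -> config e p F p' l ->
  {in F, forall c, p c = c} -> all (fun o => o <= k) (unzip2 l) -> star_map_le e k p'.
Proof.
move=> [sm pk] cf Fc /allP lk; have [sm' h1 h2 ul h3] := cf; split=> // v.
case: (boolP (v \in unzip1 l)) => [/mapP[a al ->]|vl].
  by have [_ ->] := h3 _ al; apply/lk/map_f.
case: (boolP (v \in F)) => vF; last by rewrite (config_out sm cf).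
by rewrite (ord_sat sm') //; apply: contraNneq vl => E; rewrite -E -h2 Fc.
Qed.

Lemma config_cov p F p' l v : star_map e p -> config e p F p' l -> p v \notin F ->
  (v \in cov p') = (v \in cov p).
Proof. by move=> sm cf vF; have [E1 E2] := config_away sm cf vF; rewrite !inE E1 E2. Qed.

Lemma config_covF p F p' l v : config e p F p' l -> p v \in F ->
  all (fun o => 0 < o) (unzip2 l) -> v \in cov p'.
Proof.
move=> [_ _ h2 _ h3]; rewrite h2 inE => /mapP[a al ->] /allP l0.
by have [_ ->] := h3 _ al; apply/l0/map_f.
Qed.

(** A center, or an uncovered vertex, [u] simply receives [w]. A satellite [u] of a star of order at
    least 2 leaves it and forms a 1-star with [w]. If [u] is an end of a 1-star, leaving would
    strand the other end, so both vertices become satellites of [u]; this is where [1 < k] is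
    needed. *)
Definition augment p w u : T -> T :=
  let p' := move (move p u u) w u in
  if p u == u then move p w u
  else if ord p (p u) == 1 then move p' (p u) u else p'.

Lemma augment_ok p w u : star_map_le e k p -> w \notin cov p -> e w u -> ord p u != k ->
  star_map_le e k (augment p w u) /\ w |: cov p \subset cov (augment p w u).
Proof.
move=> smk; have [sm pk] := smk; rewrite inE lt0n negbK => w0 ewu uk.
have pw : p w = w.
  by apply/eqP/negPn/negP => /ord_pgt0; rewrite (eqP w0).
have ow : ord p w = 0 by rewrite -{1}pw (eqP w0).
have uw : u != w by apply: contraTneq ewu => ->; rewrite e_irr.
have pu : p u != w.
  by apply/eqP=> E; have := @ord_pgt0 _ p u; rewrite E ow (eq_sym w) uw => /(_ isT).
pose F := [:: w; p u].
have Fc : {in F, forall c, p c = c}.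
  by move=> c; rewrite !inE => /orP[/eqP->|/eqP->] //; apply: sm.1.
have uF : uniq F by rewrite /= inE eq_sym pu.
have := config_init sm uF Fc; rewrite /= ow => cf0.
suff [l cf lk] : exists2 l, config e p F (augment p w u) l & all (fun o => 0 < o <= k) (unzip2 l).
  split; first by apply: (config_le smk cf Fc); apply: sub_all lk => o /andP[].
  apply/subsetP=> v; case: (boolP (p v \in F)) => vF.
    by move=> _; apply: (config_covF cf vF); apply: sub_all lk => o /andP[].
  rewrite (config_cov sm cf vF) in_setU1 => /orP[/eqP E|//].
  by case/negP: vF; rewrite E pw mem_head.
have := pk (p u); have := pk u; rewrite /augment => pku pkpu.
have euw : e u w by rewrite e_sym.
case: eqVneq => [E|N].
  exists [:: (u, (ord p u).+1)]; first by apply: (config_attach euw); move: cf0; rewrite E.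
  by rewrite /= andbT ltn_neqAle uk.
have /= cf1 := config_rot 1 cf0.
have uN : u != p u by rewrite eq_sym.
have cf2 := config_detach erefl uN cf1.
have {cf2}/= cf2 := config_rot 2 cf2.
have cf3 := config_attach euw cf2.
have o0 : 0 < ord p (p u) by apply: ord_pgt0; rewrite eq_sym.
case: eqVneq => [E|N1].
  exists [:: (u, 2)]; last by rewrite /= k2.
  apply: config_attach; first by rewrite e_sym; apply: sm.2; rewrite eq_sym.
  by have := config_rot 1 cf3; rewrite E.
exists [:: (u, 1); (p u, (ord p (p u)).-1)] => //=.
rewrite andbT (ltnW k2) /=; lia.
Qed.

Definition shift p w u x := move (move p x x) w u.

(** The orders do not change at all: [u] remains full, and [x] and [w] have order 0 before and
    after. Hence the test [ord p u != k] in [releasable] has the same outcome for the shifted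
    map. *)
Lemma shift_ok p w u x : star_map_le e k p -> w \notin cov p -> e w u -> ord p u = k ->
  x \in sats p u ->
  [/\ star_map_le e k (shift p w u x), ord (shift p w u x) =1 ord p,
      x \notin cov (shift p w u x) & cov (shift p w u x) = w |: (cov p :\ x)].
Proof.
move=> smk; have [sm pk] := smk; rewrite inE lt0n negbK => w0 ewu uk.
rewrite in_sats => /andP[/eqP px xu].
have pw : p w = w.
  by apply/eqP/negPn/negP => /ord_pgt0; rewrite (eqP w0).
have ow : ord p w = 0 by rewrite -{1}pw (eqP w0).
have pu : p u = u by rewrite -px sm.1.
have uw : u != w by apply: contraTneq ewu => ->; rewrite e_irr.
have xw : x != w by apply: contraNneq uw => E; rewrite -px E pw.
pose F := [:: w; u].
have Fc : {in F, forall c, p c = c}.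
  by move=> c; rewrite !inE => /orP[/eqP->|/eqP->].
have uF : uniq F by rewrite /= inE eq_sym uw.
have := config_init sm uF Fc; rewrite /= ow uk => cf0.
have euw : e u w by rewrite e_sym.
have /= cf1 := config_rot 1 cf0.
have cf2 := config_detach px xu cf1.
have {cf2}cf2 : config e p F (move p x x) [:: (w, 0); (u, k.-1); (x, 0)].
  by apply: config_perm cf2; apply/permP=> a /=; lia.
have := config_attach euw cf2; rewrite -/(shift p w u x) prednK ?(ltnW k2) // => cf.
have smk' : star_map_le e k (shift p w u x).
  by apply: (config_le smk cf Fc); rewrite /= leqnn.
have [sm' _ _ _ h5] := cf.
have [_ ou] := h5 _ (mem_head _ _).
have [px' ox] := h5 (x, 0) (mem_behead (s := _ :: _) (mem_head _ _)).
rewrite /= in ou px' ox.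
have xc : x \notin cov (shift p w u x) by rewrite inE px' ox.
have ordE : ord (shift p w u x) =1 ord p.
  move=> v; case: (eqVneq v u) => [->|vu]; first by rewrite ou.
  case: (eqVneq v x) => [->|vx]; first by rewrite ox (ord_sat sm) // px eq_sym.
  case: (eqVneq v w) => [->|vw].
    by rewrite ow (ord_sat sm') // /shift /move eqxx.
  by apply: (config_out sm cf); rewrite /= !inE !negb_or ?vu ?vx ?vw.
split=> //; apply/setP=> v; rewrite in_setU1 in_setD1.
case: (eqVneq v x) => [->|vx]; first by rewrite (negPf xw) (negPf xc).
case: (eqVneq v w) => [->|vw] /=.
  by rewrite inE ordE /shift /move eqxx uk (ltnW k2).
by rewrite !inE ordE /shift /move (negPf vw) (negPf vx).
Qed.

(* [w] in [releasable p X] has a neighbour from which it can get covered at no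
   other expense than releasing a vertex of [X]. *)
Definition releasable p (X : {set T}) : {set T} :=
  [set w | [exists u, e w u && ((ord p u != k) || [exists x in sats p u, x \in X])]].

Lemma releasable_mono p : {homo releasable p : X Y / X \subset Y}.
Proof.
move=> X Y /subsetP XY; apply/subsetP=> w; rewrite !inE => /existsP[u /andP[ewu h]].
apply/existsP; exists u; rewrite ewu /=; case/orP: h => [->//|/exists_inP[x xu /XY xY]].
by apply/orP; right; apply/exists_inP; exists x.
Qed.

Definition release p r := iter r (releasable p) set0.

Lemma release_sub p i j : i <= j -> release p i \subset release p j.
Proof. by move=> ij; apply: (@subset_iter T (releasable p) (@releasable_mono p) i j ij). Qed.

Lemma releaseS p r w : reflect
  (exists2 u, e w u & ord p u != k \/ exists2 x, x \in sats p u & x \in release p r)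
  (w \in release p r.+1).
Proof.
rewrite /= inE; apply: (iffP existsP) => [[u /andP[ewu h]]|[u ewu h]].
  by exists u => //; case/orP: h => [|/exists_inP]; [left|right].
by exists u; rewrite ewu /=; case: h => [->//|/exists_inP ->]; rewrite orbT.
Qed.

Definition released p := release p #|T|.

Lemma release_released p r : release p r \subset released p.
Proof. exact: iter_sub_fix (@releasable_mono p) r. Qed.

Lemma releasedP p w : reflect
  (exists2 u, e w u & ord p u != k \/ exists2 x, x \in sats p u & x \in released p)
  (w \in released p).
Proof.
have fK : release p #|T|.+1 = released p := fixsetK (@releasable_mono p).
by apply: (iffP idP); [rewrite -{1}fK => /releaseS|rewrite -{2}fK => h; apply/releaseS].
Qed.

(* A shortest chain of shifts starting with [w -> u, release x] remains a
   chain of shifts for the new star map. *)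
Lemma shift_release p w u x r : star_map_le e k p -> w \notin cov p -> e w u ->
  ord p u = k -> x \in sats p u -> w \notin release p r ->
  release p r \subset release (shift p w u x) r.
Proof.
move=> smk wc ewu uk xu wr.
have [smk' ordE _ _] := shift_ok smk wc ewu uk xu.
have [sm pk] := smk.
have pw : p w = w.
  apply/eqP/negPn/negP => /ord_pgt0; move: wc; rewrite inE lt0n negbK => /eqP->.
  by [].
elim: r wr => [|r IH] wr; first exact: sub0set.
have {}IH : release p r \subset release (shift p w u x) r.
  by apply: IH; apply: contra wr; apply/subsetP/release_sub.
apply/subsetP=> y /releaseS[u' eyu' h]; apply/releaseS; exists u' => //.
rewrite ordE; case: h => [|[x' x'u' x'r]]; [by left|right].
exists x'; last exact: (subsetP IH).
(* If [u'] were [u], its satellite [x'], released by round [r], would release [w] by round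
   [r.+1]. *)
have uu' : u' != u.
  apply: contraNneq wr => E; apply/releaseS; exists u => //; right.
  by exists x' => //; rewrite -E.
move: x'u' xu; rewrite !in_sats => /andP[/eqP px' x'N] /andP[/eqP px xN].
rewrite x'N andbT /shift /move; case: (eqVneq x' w) => [E|_].
  by move: x'N; rewrite -px' E pw eqxx.
by case: (eqVneq x' x) => [E|_]; [move: uu'; rewrite -px' E px eqxx|rewrite px'].
Qed.

Lemma released_augment p w r : star_map_le e k p -> w \notin cov p -> w \in release p r ->
  exists2 p', star_map_le e k p' & #|cov p| < #|cov p'|.
Proof.
elim/ltn_ind: r p w => r IH p w smk wc wr.
(* Going back to the first round that releases [w] provides [wN], without which [shift_release]
   would not apply; the induction then continues with the smaller [r'] and the vertex given up by
   the shift. *)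
have [r' r'r [wr' wN]] : exists2 r', r' < r & w \in release p r'.+1 /\ w \notin release p r'.
  have := wr; rewrite {1}/release in_iter_fixE; last exact: releasable_mono.
  set m := fix_order _ _ => /andP[m0 mr]; exists m.-1; first lia.
  rewrite prednK // /release !in_iter_fixE -/m; try exact: releasable_mono.
  by rewrite m0 leqnn; split=> //; rewrite -ltnNge prednK.
have [u ewu] := releaseS _ _ _ wr'.
case: (eqVneq (ord p u) k) => [uk|uk _]; last first.
  have [sm' sub] := augment_ok smk wc ewu uk; exists (augment p w u) => //.
  by apply: leq_trans (subset_leq_card sub); rewrite cardsU1 wc.
case=> // -[x xu xr'].
have [sm' _ xc cE] := shift_ok smk wc ewu uk xu.
have [|p' smp' lt] := IH _ r'r _ x sm' xc.
  exact: (subsetP (shift_release smk wc ewu uk xu wN)).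
exists p' => //; apply: leq_trans lt; rewrite cE cardsU1 in_setD1 (negPf wc) andbF.
by rewrite (cardsD1 x (cov p)) ltnS leq_add2r leq_b1.
Qed.

Definition onbr q u v := (u != v) && ((q u == v) || (q v == u)).

Lemma onbr_sym q u v : onbr q u v = onbr q v u.
Proof. by rewrite /onbr eq_sym orbC. Qed.

Lemma onbr_edge q u v : star_map e q -> onbr q u v -> e u v.
Proof.
move=> [_ sm] /andP[uv /orP[]/eqP E]; last by rewrite -E sm // E.
by rewrite e_sym -E sm // E eq_sym.
Qed.

Lemma onbr_degree q u : star_map_le e k q -> #|[set v | onbr q u v]| <= k.
Proof.
move=> [sm qk]; case: (eqVneq (q u) u) => [E|N].
  apply: leq_trans (qk u); apply/subset_leq_card/subsetP=> v; rewrite in_sats !inE /onbr E.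
  by rewrite (eq_sym v); case: eqVneq => //= _ ->.
apply: leq_trans (ltnW k2); rewrite -(cards1 (q u)); apply/subset_leq_card/subsetP=> v.
rewrite !inE /onbr => /andP[_ /orP[/eqP->//|/eqP E]].
by case/eqP: N; rewrite -E sm.1.
Qed.

Lemma covP q v : star_map e q -> reflect (exists u, onbr q v u) (v \in cov q).
Proof.
move=> sm; rewrite inE; apply: (iffP idP) => [/card_gt0P[w]|[u /andP[vu /orP[/eqP E|/eqP E]]]].
- rewrite in_sats => /andP[/eqP E wN]; case: (eqVneq (q v) v) => [E'|N].
    by exists w; rewrite /onbr E E' eq_sym -{1}E' wN eqxx orbT.
  by exists (q v); rewrite /onbr eqxx eq_sym N.
- by apply: ord_pgt0; rewrite E eq_sym.
- by rewrite -E sm.1; apply: ord_pgt0; rewrite E.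
Qed.

Lemma card_cover_leq (S D : {set T}) (N : T -> {set T}) m :
  (forall v, v \in D -> exists2 z, z \in S & v \in N z) ->
  (forall z, z \in S -> #|N z| <= m) -> #|D| <= m * #|S|.
Proof.
move=> h Nm; rewrite mulnC -sum_nat_const.
apply: (@leq_trans (\sum_(z in S) #|N z|)); last exact: leq_sum.
apply: leq_trans (_ : #|\bigcup_(z in S) N z| <= _).
  by apply/subset_leq_card/subsetP=> v /h[z zS vz]; apply/bigcupP; exists z.
elim/big_rec2: _ => [|z n A _ le]; first by rewrite cards0.
apply: leq_trans (leq_card_setU _ _) _; by rewrite leq_add2l.
Qed.

(** * Barrier structure of a packing without augmentation *)

Section Structure.
Variable p : T -> T.
Hypotheses (smk : star_map_le e k p) (stuck : ~: cov p \subset ~: released p).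

(** [locked_part] and [barrier] are the sets D and S of the overview: an optimality certificate in
    the manner of a Tutte-Berge barrier. *)
Definition locked_part : {set T} := ~: released p.
Definition barrier : {set T} := [set u | [exists w in locked_part, e w u]].

Lemma locked_nbr w u : w \in locked_part -> e w u -> ord p u = k /\ sats p u \subset locked_part.
Proof.
rewrite inE => wr ewu; split.
  by apply/eqP; apply: contraNT wr => uk; apply/releasedP; exists u => //; left.
apply/subsetP=> x xu; rewrite inE; apply: contra wr => xr; apply/releasedP.
by exists u => //; right; exists x.
Qed.

Lemma barrierP u : u \in barrier -> ord p u = k /\ sats p u \subset locked_part.
Proof. by rewrite inE => /exists_inP[w wD /(locked_nbr wD)]. Qed.

(** A barrier vertex has a satellite; were the vertex itself locked, that satellite would be a
    neighbour of a locked vertex and hence have order [k], but satellites have order 0. The same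
    argument shows in [locked_cov] that a covered locked vertex is never a center. *)
Lemma barrier_locked u : u \in barrier -> u \notin locked_part.
Proof.
move=> uS; have [uk _] := barrierP uS; have [sm _] := smk.
have /card_gt0P[x xu] : 0 < ord p u by rewrite uk ltnW.
apply/negP=> uD; have [] := locked_nbr (u := x) uD.
  by move: xu; rewrite in_sats => /andP[/eqP <- xN]; apply: sm.2; rewrite eq_sym.
move: xu; rewrite in_sats => /andP[/eqP E xN].
by rewrite (ord_sat sm) ?E 1?eq_sym // => h; move: k2; rewrite -h.
Qed.

Lemma locked_cov v : v \in locked_part -> v \in cov p -> p v != v /\ p v \in barrier.
Proof.
move=> vD; rewrite inE => v0; have [sm _] := smk.
case: (eqVneq (p v) v) => [E|N]; last first.
  by split=> //; rewrite inE; apply/exists_inP; exists v => //; rewrite e_sym sm.2.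
move: v0; rewrite E => /card_gt0P[x]; rewrite in_sats => /andP[/eqP xv xN].
have [] := locked_nbr (u := x) vD; first by rewrite -xv sm.2 // xv eq_sym.
by rewrite (ord_sat sm) ?xv 1?eq_sym // => h; move: k2; rewrite -h.
Qed.

Definition open_part : {set T} := ~: (locked_part :|: barrier).

Lemma in_open v : (v \in open_part) = (v \notin locked_part) && (v \notin barrier).
Proof. by rewrite in_setC in_setU negb_or. Qed.

(** The covered locked vertices are exactly the satellites of the barrier stars, [k] for each. All
    other vertices are covered, since the uncovered ones are locked. *)
Lemma cov_lower : k * #|barrier| + #|barrier| + #|open_part| <= #|cov p|.
Proof.
have [sm _] := smk.
have A_eq : k * #|barrier| = #|cov p :&: locked_part|.
  rewrite -[RHS]sum1_card (partition_big p (mem barrier)) /=; last first.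
    by move=> v; rewrite inE => /andP[vc vD]; have [] := locked_cov vD vc.
  rewrite mulnC -sum_nat_const.
  apply: eq_bigr => u uS; have [uk /subsetP sub] := barrierP uS.
  rewrite -uk /ord -sum1_card; apply: eq_bigl => v; rewrite in_setI.
  apply/idP/andP => [vu|[/andP[vc vD] /eqP E]].
    split; last by move: vu; rewrite in_sats => /andP[].
    rewrite sub // inE; move: vu; rewrite in_sats => /andP[/eqP E _].
    by rewrite E uk ltnW.
  by have [vN _] := locked_cov vD vc; rewrite in_sats -E eqxx eq_sym.
have B_eq : #|barrier| + #|open_part| <= #|cov p :\: locked_part|.
  rewrite -cardsUI (_ : barrier :&: open_part = set0) ?cards0 ?addn0.
    apply/subset_leq_card/subsetP=> v vB; have vD : v \notin locked_part.
      by move: vB; rewrite in_setU in_open => /orP[/barrier_locked|/andP[]].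
    rewrite in_setD vD /=; apply: contraNT vD => vc; apply: (subsetP stuck).
    by rewrite in_setC.
  by apply/setP=> v; rewrite in_setI in_open in_set0; case: (v \in barrier); rewrite ?andbF.
by rewrite A_eq -addnA -(cardsID locked_part (cov p)) leq_add2l.
Qed.

(** Each of the at most [k] edges of [q] at a barrier vertex leads to a locked vertex or to an open
    one. As [q] can cover locked vertices by such edges only, every open vertex joined to the
    barrier costs it a locked vertex. *)
Lemma cov_deficit q : star_map_le e k q ->
  #|cov q| + #|[set y in open_part | (y \notin cov q) || [exists z in barrier, onbr q y z]]|
    <= #|cov p|.
Proof.
move=> smq; have [smq1 _] := smq; apply: leq_trans cov_lower.
set bad := [set y in _ | _]; pose N := [set y in open_part | [exists z in barrier, onbr q y z]].
have c1 : #|cov q| <= #|cov q :&: locked_part| + #|barrier| + #|open_part :&: cov q|.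
  rewrite -addnA -(cardsID locked_part (cov q)) leq_add2l.
  apply: leq_trans (leq_card_setU _ _); apply/subset_leq_card/subsetP=> v.
  by rewrite in_setD in_setU in_setI in_open => /andP[-> ->]; rewrite andbT orbN.
have c2 : #|bad| <= #|open_part :\: cov q| + #|N|.
  apply: leq_trans (leq_card_setU _ _); apply/subset_leq_card/subsetP=> v.
  by rewrite in_set in_setU in_setD [v \in N]in_set => /andP[-> /orP[->|->]]; rewrite ?orbT.
have c3 : #|cov q :&: locked_part| + #|N| <= k * #|barrier|.
  rewrite -cardsUI (_ : _ :&: N = set0) ?cards0 ?addn0; last first.
    apply/setP=> v; rewrite in_setI in_setI in_set0 [v \in N]in_set in_open.
    by case: (v \in locked_part); rewrite ?andbF.
  apply: (@card_cover_leq barrier _ (fun z => [set v | onbr q z v])) => [v|z _]; last exact: onbr_degree.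
  rewrite in_setU => /orP[|].
    rewrite in_setI => /andP[/(covP _ smq1)[z vz] vD]; exists z; last by rewrite inE onbr_sym.
    by rewrite inE; apply/exists_inP; exists v => //; apply: onbr_edge vz.
  by rewrite inE => /andP[_ /exists_inP[z zS vz]]; exists z; rewrite // inE onbr_sym.
have := cardsID (cov q) open_part; lia.
Qed.

End Structure.

Lemma max_stuck p : star_map_le e k p -> max_star_packing e k (packing_of p) ->
  ~: cov p \subset ~: released p.
Proof.
move=> smk [_ mx]; apply/subsetP=> w; rewrite !in_setC => wc; apply/negP=> wr.
have [p' smk' lt] := released_augment smk wc wr.
have := mx _ (packing_of_packing smk').
by rewrite -(cov_covered (proj1 smk)) -(cov_covered (proj1 smk')) leqNgt lt.
Qed.

(** The converse certifies the result of the program: once no augmentation is reachable,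
    [cov_deficit] bounds every other packing. *)
Lemma stuck_max p : star_map_le e k p -> ~: cov p \subset ~: released p ->
  max_star_packing e k (packing_of p).
Proof.
move=> smk st; split=> [|Q /map_of_packingP[smq <-]]; first exact: packing_of_packing.
rewrite -(cov_covered (proj1 smk)) -(cov_covered (proj1 smq)).
exact: leq_trans (leq_addr _ _) (cov_deficit smk st smq).
Qed.

End Maximum.

(** Two explicit lists are permutations of each other when every predicate has the same count on
    both, which is linear arithmetic over its truth values. *)
Ltac reorder :=
  let f := fresh "f" in
  apply/permP => f /=;
  repeat match goal with |- context [nat_of_bool ?b] => generalize (nat_of_bool b); intro end;
  clear; lia.

(** * Local optima *)

Section Shapes.
Variable t : nat.

Lemma revise_shape_ti2 i a b : a != t -> b != t -> revise_shape t [:: t; i] [:: a; b].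
Proof.
by move=> /negPf at_ /negPf bt; apply/or3P; constructor 2; rewrite /= mem_head at_ bt.
Qed.

Lemma revise_shape_ti3 i a b c : (a == t) + (b == t) + (c == t) <= 1 ->
  revise_shape t [:: t; i] [:: a; b; c].
Proof. by move=> h; apply/or3P; constructor 2; rewrite /= mem_head addn0 addnA h. Qed.

Lemma revise_shape_tti i ns : i \in [:: 1; t - 1; t + 1] -> t \notin ns ->
  [|| size ns == 2, size ns == 3 | (t == 2) && (size ns == 4)] ->
  revise_shape t [:: t; t; i] ns.
Proof.
move=> hi tn h; apply/or3P; constructor 3; apply/and3P; split=> //.
  by apply/hasP; exists i.
by apply/eqP/count_memPn.
Qed.
End Shapes.

Section LocalOptimum.
Variables (T : finType) (e : rel T).
Hypotheses (e_sym : symmetric e) (e_irr : irreflexive e).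
Variables k t : nat.
Hypotheses (t2 : 1 < t) (tk : t < k).
Variable p : T -> T.
Hypotheses (smk : star_map_le e k p) (stuck : ~: cov p \subset ~: released e k p).
Hypothesis optimal : forall Q', ~ revise e k t (packing_of p) Q'.
Implicit Types (u v w x y c z a b s : T) (F : seq T).

Let sm : star_map e p. Proof. by case: smk. Qed.
Let k2 : 1 < k. Proof. lia. Qed.

Lemma no_revision F p' l : uniq F -> {in F, forall c, 0 < ord p c} ->
  config e p F p' l -> all (fun o => 0 < o <= k) (unzip2 l) ->
  ~~ revise_shape t [seq ord p c | c <- F] (unzip2 l).
Proof.
move=> uF F0 cf /allP lk; apply/negP=> sh.
by have [_ /optimal] := revise_sound t2 smk uF F0 cf lk sh.
Qed.

(* In a 2-star whose vertices form a triangle any vertex can be the center, so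
   that the center behaves like a satellite. *)
Definition triangle c := (t == 2) && [exists a in sats p c, exists b in sats p c, e a b].
Definition satlike c x := (x \in sats p c) || (x == c) && triangle c.

Lemma satlike_fiber c x : ord p c = t -> satlike c x -> p x = c.
Proof.
move=> ct /orP[|/andP[/eqP-> _]]; first by rewrite in_sats => /andP[/eqP].
by apply: (ord_gt0_center sm); rewrite ct ltnW.
Qed.

(** In the triangle case [c] itself is set free and the edge between its two satellites becomes the
    remaining star, so the center may change to [c1]. The agreement outside the star of [c] allows
    several unloadings in succession. *)
Lemma config_unload F p' c x l : ord p c = t -> satlike c x ->
  (forall v, p v = c -> p' v = c) -> config e p F p' ((c, t) :: l) ->
  exists p'' c1, config e p F p'' ((x, 0) :: (c1, t - 1) :: l) /\
    forall v, p v != c -> p'' v = p' v.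
Proof.
move=> ct sl pc cf; case/orP: (sl) => [xc|/andP[/eqP xc /andP[/eqP t_2]]].
  exists (move p' x x), c; move: xc; rewrite in_sats => /andP[/eqP xc xN]; split.
    by rewrite subn1; apply: config_detach => //; apply: pc.
  by move=> v vc; rewrite /move; case: (eqVneq v x) vc => // ->; rewrite xc eqxx.
move=> /exists_inP[a ac /exists_inP[b bc eab]].
move: ac bc; rewrite !in_sats => /andP[/eqP ac aN] /andP[/eqP bc bN].
have ab : a != b by apply: contraTneq eab => ->; rewrite e_irr.
have cf1 := config_detach (pc _ bc) bN cf.
have {}cf1 : config e p F (move p' b b) [:: (c, t.-1), (b, 0) & l].
  by apply: config_perm cf1; reorder.
have pa : move p' b b a = c by rewrite /move (negPf ab) pc.
have cf2 := config_detach pa aN cf1.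
rewrite t_2 /= in cf2.
have {}cf2 : config e p F (move (move p' b b) a a) [:: (b, 0), (a, 0), (c, 0) & l].
  apply: config_perm cf2; reorder.
have cf3 := config_attach eab cf2.
exists (move (move (move p' b b) a a) b a), a; split.
  by rewrite t_2 xc; apply: config_perm cf3; rewrite subn1; reorder.
move=> v vc; have va : v != a by apply: contraNneq vc => ->; apply/eqP.
have vb : v != b by apply: contraNneq vc => ->; apply/eqP.
by rewrite /move (negPf va) (negPf vb).
Qed.

(** A [config] names one center per star, so using the other end of a 1-star as the center is a
    genuine change: [v] is detached and [z] attached to it. *)
Lemma config_flip F p' z v l : p v = z ->
  (forall u, p u = z -> p' u = z) -> config e p F p' ((z, 1) :: l) ->
  exists p'', [/\ config e p F p'' ((v, 1) :: l),
     forall u, p u = z -> u != v -> p'' u = v &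
     forall u, p u != z -> p'' u = p' u].
Proof.
move=> vz pz cf; case: (eqVneq v z) => [->|vN].
  by exists p'; split=> // u /pz.
have cf1 := config_detach (pz _ vz) vN cf.
have ezv : e v z by rewrite e_sym -vz; apply: sm.2; rewrite vz eq_sym.
have {}cf1 : config e p F (move p' v v) [:: (z, 0), (v, 0) & l].
  by apply: config_perm cf1; reorder.
have cf2 := config_attach ezv cf1.
exists (move (move p' v v) z v); split=> //.
  move=> u uz uv; rewrite /move (negPf uv); case: eqVneq => // uzN.
  have [_ _ _ _ /(_ _ (mem_head _ _))[_ /= o1]] := cf.
  have : #|[set u; v]| <= ord p' z.
    apply/subset_leq_card/subsetP=> w; rewrite in_set2 in_sats.
    by case/orP=> /eqP->; rewrite ?pz // eqxx.
  by rewrite o1 cards2 uv.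
move=> u uz; rewrite /move.
have zz : p z = z by rewrite -vz sm.1.
have -> : (u == z) = false by apply: contraNF uz => /eqP->; apply/eqP.
by have -> : (u == v) = false by apply: contraNF uz => /eqP->; apply/eqP.
Qed.

(** An uncovered neighbour would be locked, and the neighbours of locked vertices have order [k],
    whereas [c] has order [t < k]. *)
Lemma star_vertex_covered c y : ord p c = t -> p (c) = c -> e c y -> 0 < ord p (p y).
Proof.
move=> ct cc ecy; rewrite lt0n; apply/negP => /eqP y0.
have yD : y \in locked_part e k p.
  by apply: (subsetP stuck); rewrite in_setC inE y0.
have eyc : e y c by rewrite e_sym.
by have [] := locked_nbr yD eyc; rewrite ct => h; move: tk; rewrite h ltnn.
Qed.

(** Suppose that the star of [v] has order [i]. If [v] is its center, handing [x] over turns the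
    orders [t, i] into [t - 1, i + 1], a revision unless [i = k] or [i = t - 1]. If [v] is a
    satellite and [i > 1], the edge from [x] to [v] becomes a third star. If [i = 1], the 1-star is
    recentered at [v], which fails only for [t = 2]. *)
Lemma satlike_nbr c x v : ord p c = t -> satlike c x -> e x v -> p v != c ->
  ord p (p v) = k /\ p v = v \/ ord p (p v) = t - 1 /\ (p v = v \/ t = 2).
Proof.
move=> ct sl exv vc; have xc := satlike_fiber ct sl.
have cc : p c = c by rewrite -xc sm.1.
have i0 : 0 < ord p (p v).
  rewrite lt0n; apply/negP => /eqP y0.
  have vD : v \in locked_part e k p by apply: (subsetP stuck); rewrite in_setC inE y0.
  have evx : e v x by rewrite e_sym.
  have [xk _] := locked_nbr vD evx.
  case: (eqVneq (p x) x) => [E|N]; last by move: tk; rewrite -xk (ord_sat sm N).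
  by move: tk; rewrite -xk -E xc ct ltnn.
set z := p v in vc i0 *; have zz : p z = z by rewrite /z sm.1.
have uF : uniq [:: c; z] by rewrite /= inE eq_sym vc.
have F0 : {in [:: c; z], forall a, 0 < ord p a}.
  by move=> a; rewrite !inE => /orP[/eqP->|/eqP->] //; rewrite ct ltnW.
have Fc : {in [:: c; z], forall a, p a = a} by move=> a /F0 /(ord_gt0_center sm).
have ik : ord p z <= k by case: smk.
have := config_init sm uF Fc; rewrite /= ct => cf.
have [p1 [c1 [cf1 ag1]]] := config_unload ct sl (fun _ => id) cf.
have NR := no_revision uF F0.
case: (eqVneq v z) => [vz|vN].
  case: (eqVneq (ord p z) k) => [->|ikN]; first by left.
  case: (eqVneq (ord p z) (t - 1)) => [->|itN]; first by right; split=> //; left.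
  have {}cf1 : config e p [:: c; z] p1 [:: (x, 0); (z, ord p z); (c1, t - 1)].
    by apply: config_perm cf1; reorder.
  have ezx : e z x by rewrite -vz e_sym.
  have := NR _ _ (config_attach ezx cf1); rewrite /= ct revise_shape_ti2 //; [|lia|lia].
  by rewrite andbT; lia.
case: (leqP (ord p z) 1) => [i1|i1].
  have {i1}i1 : ord p z = 1 by lia.
  case: (eqVneq t 2) => [->|t3]; first by right; rewrite i1; split=> //; right.
  have {}cf1 : config e p [:: c; z] p1 [:: (z, 1); (x, 0); (c1, t - 1)].
    by apply: config_perm cf1; rewrite i1; reorder.
  have pz u : p u = z -> p1 u = z by move=> uz; rewrite ag1 uz.
  have [p2 [cf2 _ _]] := config_flip (v := v) erefl pz cf1.
  have {}cf2 : config e p [:: c; z] p2 [:: (x, 0); (v, 1); (c1, t - 1)].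
    by apply: config_perm cf2; reorder.
  have evx : e v x by rewrite e_sym.
  have := NR _ _ (config_attach evx cf2); rewrite /= ct revise_shape_ti2 //; [|lia|lia].
  by rewrite andbT; lia.
have {}cf1 : config e p [:: c; z] p1 [:: (z, ord p z); (x, 0); (c1, t - 1)].
  by apply: config_perm cf1; reorder.
have pv : p1 v = z by rewrite ag1.
have cf2 := config_detach pv vN cf1.
have {}cf2 : config e p [:: c; z] (move p1 v v) [:: (x, 0); (v, 0); (z, (ord p z).-1); (c1, t - 1)].
  by apply: config_perm cf2; reorder.
have evx : e v x by rewrite e_sym.
have := NR _ _ (config_attach evx cf2); rewrite /= ct revise_shape_ti3 //; last lia.
by rewrite andbT; lia.
Qed.

(** A satellite [y] of a star of order [i] could be moved to [c], giving the orders [t + 1] and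
    [i - 1]. This is a revision unless it leaves a vertex alone, for [i = 1], or creates a new
    t-star, for [i = t + 1]. *)
Lemma center_nbr c y : ord p c = t -> p c = c -> e c y -> p y != c ->
  [\/ p y = y, ord p (p y) = 1 | ord p (p y) = t + 1].
Proof.
move=> ct cc ecy yc; have i0 := star_vertex_covered ct cc ecy.
set z := p y in yc i0 *; have zz : p z = z by rewrite /z sm.1.
case: (eqVneq z y) => [E|yN]; first by constructor 1.
case: (eqVneq (ord p z) 1) => [->|i1]; first by constructor 2.
case: (eqVneq (ord p z) (t + 1)) => [->|it]; first by constructor 3.
have uF : uniq [:: z; c] by rewrite /= inE yc.
have F0 : {in [:: z; c], forall a, 0 < ord p a}.
  by move=> a; rewrite !inE => /orP[/eqP->|/eqP->] //; rewrite ct ltnW.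
have Fc : {in [:: z; c], forall a, p a = a} by move=> a /F0 /(ord_gt0_center sm).
have ik : ord p z <= k by case: smk.
have := config_init sm uF Fc; rewrite /= ct => cf.
have yz : y != z by rewrite eq_sym.
have cf2 := config_detach (erefl _ : p y = z) yz cf.
have {}cf2 : config e p [:: z; c] (move p y y) [:: (y, 0); (c, t); (z, (ord p z).-1)].
  by apply: config_perm cf2; reorder.
have := no_revision uF F0 (config_attach ecy cf2).
have -> : revise_shape t [seq ord p a | a <- [:: z; c]] (unzip2 [:: (c, t.+1); (z, (ord p z).-1)]).
  by rewrite /= ct; apply/or3P; constructor 2; rewrite /= !inE eqxx orbT /=; lia.
by rewrite /= andbT; lia.
Qed.

Lemma config_split F p' z v v' l : p v = z -> p v' = z -> v != v' ->
  (forall u, p u = z -> p' u = z) -> config e p F p' ((z, 1) :: l) ->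
  exists p'', config e p F p'' [:: (v, 0), (v', 0) & l] /\
    forall u, p u != z -> p'' u = p' u.
Proof.
move=> vz v'z vv' pz cf; have [p1 [cf1 h1 h2]] := config_flip vz pz cf.
have v'v : v' != v by rewrite eq_sym.
have cf2 := config_detach (h1 _ v'z v'v) v'v cf1.
exists (move p1 v' v'); split.
  by apply: config_perm cf2; reorder.
move=> u uz; rewrite -h2 // /move; case: (eqVneq u v') uz => // ->.
by rewrite v'z eqxx.
Qed.

Lemma config_recenter F p' z v o l : p v = z -> v = z \/ o = 1 ->
  (forall u, p u = z -> p' u = z) -> config e p F p' ((z, o) :: l) ->
  exists p'', config e p F p'' ((v, o) :: l) /\ forall u, p u != z -> p'' u = p' u.
Proof.
move=> vz [->|->] pz cf; first by exists p'.
by have [p1 [cf1 h1 h2]] := config_flip vz pz cf; exists p1.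
Qed.

Lemma centers_init F : uniq F -> {in F, forall c, 0 < ord p c} ->
  config e p F p [seq (c, ord p c) | c <- F].
Proof. by move=> uF F0; apply: config_init => // c /F0/(ord_gt0_center sm). Qed.

Lemma no_revision_tti c c' z i p' l : i \in [:: 1; t - 1; t + 1] ->
  uniq [:: c; c'; z] -> ord p c = t -> ord p c' = t -> ord p z = i -> 0 < i ->
  config e p [:: c; c'; z] p' l -> all (fun o => (0 < o <= k) && (o != t)) (unzip2 l) ->
  [|| size l == 2, size l == 3 | (t == 2) && (size l == 4)] -> False.
Proof.
move=> hi uF ct c't zi i0 cf lk sz.
have F0 : {in [:: c; c'; z], forall a, 0 < ord p a}.
  by move=> a; rewrite !inE => /or3P[] /eqP->; rewrite ?ct ?c't ?zi // ltnW.
have lk' : all (fun o => 0 < o <= k) (unzip2 l) by apply: sub_all lk => o /andP[].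
have := no_revision uF F0 cf lk'; rewrite /= ct c't zi.
rewrite revise_shape_tti ?size_map //.
by apply/negP=> /(allP lk); rewrite eqxx andbF.
Qed.

Lemma config_init3 c c' z i : uniq [:: c; c'; z] -> ord p c = t -> ord p c' = t ->
  ord p z = i -> 0 < i -> config e p [:: c; c'; z] p [:: (c, t); (c', t); (z, i)].
Proof.
move=> uF ct c't zi i0.
have F0 : {in [:: c; c'; z], forall a, 0 < ord p a}.
  by move=> a; rewrite !inE => /or3P[] /eqP->; rewrite ?ct ?c't ?zi // ltnW.
by have := centers_init uF F0; rewrite /= ct c't zi.
Qed.

(* Here and below, the excluded configurations of two t-stars and a third star
   are those allowing a revision, given by the moves in the proof. *)
Lemma two_satlike_common_nbr c c' x x' v : ord p c = t -> ord p c' = t -> c != c' ->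
  satlike c x -> satlike c' x' -> ord p (p v) = t - 1 -> p v = v \/ t = 2 ->
  e x v -> e x' v -> False.
Proof.
move=> ct c't cc' sl sl' vt pv exv ex'v; set z := p v in vt pv.
have zc : c != z by apply/eqP=> E; move: vt; rewrite -E ct; move: t2 tk; clear; lia.
have zc' : c' != z by apply/eqP=> E; move: vt; rewrite -E c't; move: t2 tk; clear; lia.
have uF : uniq [:: c; c'; z] by rewrite /= !inE negb_or cc' zc zc'.
have t1 : 0 < t - 1 by rewrite subn_gt0.
have cf := config_init3 uF ct c't vt t1.
have [p1 [c1 [cf1 ag1]]] := config_unload ct sl (fun _ => id) cf.
have {}cf1 : config e p [:: c; c'; z] p1 [:: (c', t); (x, 0); (c1, t - 1); (z, t - 1)].
  by apply: config_perm cf1; reorder.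
have pc' u : p u = c' -> p1 u = c'.
  by move=> uc; rewrite ag1 uc // eq_sym.
have [p2 [c2 [cf2 ag2]]] := config_unload c't sl' pc' cf1.
have {}cf2 : config e p [:: c; c'; z] p2
    [:: (z, t - 1); (x', 0); (c2, t - 1); (x, 0); (c1, t - 1)].
  by apply: config_perm cf2; reorder.
have pz u : p u = z -> p2 u = z.
  by move=> uz; rewrite ag2 ?ag1 uz // eq_sym.
have vz1 : v = z \/ t - 1 = 1 by case: pv => [/esym|->]; [left|right].
have [p3 [cf3 _]] := config_recenter (erefl _ : p v = z) vz1 pz cf2.
have evx : e v x by rewrite e_sym.
have evx' : e v x' by rewrite e_sym.
have {}cf3 : config e p [:: c; c'; z] p3
    [:: (x', 0); (v, t - 1); (x, 0); (c1, t - 1); (c2, t - 1)].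
  by apply: config_perm cf3; reorder.
have cf4 := config_attach evx' cf3.
have {}cf4 : config e p [:: c; c'; z] (move p3 x' v)
    [:: (x, 0); (v, (t - 1).+1); (c1, t - 1); (c2, t - 1)].
  by apply: config_perm cf4; reorder.
have cf5 := config_attach evx cf4.
apply: (no_revision_tti _ uF ct c't vt t1 cf5) => //=.
  by rewrite !inE eqxx orbT.
move: t2 tk; clear; lia.
Qed.

(** The star of [z] receives [x] and gives [y] to [c']: orders [t, t, t + 1] become
    [t - 1, t + 1, t + 1]. *)
Lemma satlike_and_center_big_star c c' x z y : ord p c = t -> ord p c' = t -> c != c' ->
  satlike c x -> ord p z = t + 1 -> e x z -> y \in sats p z -> e c' y -> False.
Proof.
move=> ct c't cc' sl zt exz; rewrite in_sats => /andP[/eqP yz yN] ec'y.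
have zc : c != z by apply/eqP=> E; move: zt; rewrite -E ct; move: t2 tk; clear; lia.
have zc' : c' != z by apply/eqP=> E; move: zt; rewrite -E c't; move: t2 tk; clear; lia.
have uF : uniq [:: c; c'; z] by rewrite /= !inE negb_or cc' zc zc'.
have t1 : 0 < t + 1 by rewrite addn1.
have cf := config_init3 uF ct c't zt t1.
have [p1 [c1 [cf1 ag1]]] := config_unload ct sl (fun _ => id) cf.
have {}cf1 : config e p [:: c; c'; z] p1 [:: (z, t + 1); (x, 0); (c1, t - 1); (c', t)].
  by apply: config_perm cf1; reorder.
have py : p1 y = z by rewrite ag1 yz // eq_sym.
have cf2 := config_detach py yN cf1.
have {}cf2 : config e p [:: c; c'; z] (move p1 y y)
    [:: (y, 0); (c', t); (x, 0); (z, (t + 1).-1); (c1, t - 1)].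
  by apply: config_perm cf2; reorder.
have cf3 := config_attach ec'y cf2.
have {}cf3 : config e p [:: c; c'; z] (move (move p1 y y) y c')
    [:: (x, 0); (z, (t + 1).-1); (c', t.+1); (c1, t - 1)].
  by apply: config_perm cf3; reorder.
have ezx : e z x by rewrite e_sym.
have cf4 := config_attach ezx cf3.
apply: (no_revision_tti _ uF ct c't zt t1 cf4) => //=.
  by rewrite !inE eqxx !orbT.
move: t2 tk; clear; lia.
Qed.

(** Both centers take a satellite of [z]: orders [t, t, t + 1] become [t + 1, t + 1, t - 1]. *)
Lemma two_centers_big_star c c' z y y' : ord p c = t -> ord p c' = t -> c != c' ->
  ord p z = t + 1 -> y \in sats p z -> y' \in sats p z -> y != y' ->
  e c y -> e c' y' -> False.
Proof.
move=> ct c't cc' zt; rewrite !in_sats => /andP[/eqP yz yN] /andP[/eqP y'z y'N] yy' ecy ec'y'.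
have zc : c != z by apply/eqP=> E; move: zt; rewrite -E ct; move: t2 tk; clear; lia.
have zc' : c' != z by apply/eqP=> E; move: zt; rewrite -E c't; move: t2 tk; clear; lia.
have uF : uniq [:: c; c'; z] by rewrite /= !inE negb_or cc' zc zc'.
have t1 : 0 < t + 1 by rewrite addn1.
have cf := config_init3 uF ct c't zt t1.
have {}cf : config e p [:: c; c'; z] p [:: (z, t + 1); (c, t); (c', t)].
  by apply: config_perm cf; reorder.
have cf1 := config_detach yz yN cf.
have {}cf1 : config e p [:: c; c'; z] (move p y y) [:: (z, (t + 1).-1); (y, 0); (c, t); (c', t)].
  by apply: config_perm cf1; reorder.
have py' : move p y y y' = z by rewrite /move eq_sym (negPf yy').
have cf2 := config_detach py' y'N cf1.
have {}cf2 : config e p [:: c; c'; z] (move (move p y y) y' y')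
    [:: (y, 0); (c, t); (y', 0); (c', t); (z, (t + 1).-1.-1)].
  by apply: config_perm cf2; reorder.
have cf3 := config_attach ecy cf2.
have {}cf3 : config e p [:: c; c'; z] (move (move (move p y y) y' y') y c)
    [:: (y', 0); (c', t); (c, t.+1); (z, (t + 1).-1.-1)].
  by apply: config_perm cf3; reorder.
have cf4 := config_attach ec'y' cf3.
apply: (no_revision_tti _ uF ct c't zt t1 cf4) => //=.
  by rewrite !inE eqxx !orbT.
move: t2 tk; clear; lia.
Qed.

(** Orders [t, t - 1] become [t - 2, t + 1], a star of order [t - 2] existing for [t > 2] only. *)
Lemma two_sats_common_nbr c x x' z : t != 2 -> ord p c = t -> x \in sats p c ->
  x' \in sats p c -> x != x' -> ord p z = t - 1 -> e x z -> e x' z -> False.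
Proof.
move=> t3 ct; rewrite !in_sats => /andP[/eqP xc xN] /andP[/eqP x'c x'N] xx' zt exz ex'z.
have zc : c != z by apply/eqP=> E; move: zt; rewrite -E ct; move: t2 tk; clear; lia.
have uF : uniq [:: c; z] by rewrite /= !inE zc.
have F0 : {in [:: c; z], forall a, 0 < ord p a}.
  by move=> a; rewrite !inE => /orP[] /eqP->; rewrite ?ct ?zt; move: t2; clear; lia.
have := centers_init uF F0; rewrite /= ct zt => cf.
have cf1 := config_detach xc xN cf.
have {}cf1 : config e p [:: c; z] (move p x x) [:: (c, t.-1); (x, 0); (z, t - 1)].
  by apply: config_perm cf1; reorder.
have px' : move p x x x' = c by rewrite /move eq_sym (negPf xx').
have cf2 := config_detach px' x'N cf1.
have {}cf2 : config e p [:: c; z] (move (move p x x) x' x')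
    [:: (x, 0); (z, t - 1); (x', 0); (c, t.-1.-1)].
  by apply: config_perm cf2; reorder.
have ezx : e z x by rewrite e_sym.
have ezx' : e z x' by rewrite e_sym.
have cf3 := config_attach ezx cf2.
have {}cf3 : config e p [:: c; z] (move (move (move p x x) x' x') x z)
    [:: (x', 0); (z, (t - 1).+1); (c, t.-1.-1)].
  by apply: config_perm cf3; reorder.
have := no_revision uF F0 (config_attach ezx' cf3).
rewrite /= ct zt revise_shape_ti2; [|by move: t2; clear; lia..].
by rewrite andbT; move: t2 tk t3; clear; lia.
Qed.

(** The 1-star is dissolved, each of its ends going to one of the centers: orders [t, t, 1] become
    [t + 1, t + 1]. *)
Lemma two_centers_edge c c' y y' : ord p c = t -> ord p c' = t -> c != c' ->
  ord p (p y) = 1 -> p y' = p y -> y != y' -> e c y -> e c' y' -> False.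
Proof.
move=> ct c't cc' z1 y'z yy' ecy ec'y'; set z := p y in z1 y'z.
have zc : c != z by apply/eqP=> E; move: z1; rewrite -E ct; move: t2 tk; clear; lia.
have zc' : c' != z by apply/eqP=> E; move: z1; rewrite -E c't; move: t2 tk; clear; lia.
have uF : uniq [:: c; c'; z] by rewrite /= !inE negb_or cc' zc zc'.
have cf := config_init3 uF ct c't z1 isT.
have {}cf : config e p [:: c; c'; z] p [:: (z, 1); (c, t); (c', t)].
  by apply: config_perm cf; reorder.
have [p1 [cf1 _]] := config_split (erefl _ : p y = z) y'z yy' (fun _ => id) cf.
have {}cf1 : config e p [:: c; c'; z] p1 [:: (y, 0); (c, t); (y', 0); (c', t)].
  by apply: config_perm cf1; reorder.
have cf3 := config_attach ecy cf1.
have {}cf3 : config e p [:: c; c'; z] (move p1 y c) [:: (y', 0); (c', t); (c, t.+1)].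
  by apply: config_perm cf3; reorder.
have cf4 := config_attach ec'y' cf3.
by apply: (no_revision_tti _ uF ct c't z1 isT cf4) => //=; move: t2 tk; clear; lia.
Qed.

(** * Two 2-stars around a 1-star, in the case t = 2 *)

Section PairRevisions.
Hypothesis t_2 : t = 2.

(** Here four new stars occur: orders [2, 2, 1] become [1, 1, 1, 1]. *)
Lemma two_satlike_edge c c' x x' v v' : ord p c = t -> ord p c' = t -> c != c' ->
  satlike c x -> satlike c' x' -> ord p (p v) = 1 -> p v' = p v -> v != v' ->
  e x v -> e x' v' -> False.
Proof.
move=> ct c't cc' sl sl' v1 v'z vv' exv ex'v'; set z := p v in v1 v'z.
have zc : c != z by apply/eqP=> E; move: v1; rewrite -E ct; move: t2 tk; clear; lia.
have zc' : c' != z by apply/eqP=> E; move: v1; rewrite -E c't; move: t2 tk; clear; lia.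
have uF : uniq [:: c; c'; z] by rewrite /= !inE negb_or cc' zc zc'.
have cf := config_init3 uF ct c't v1 isT.
have [p1 [c1 [cf1 ag1]]] := config_unload ct sl (fun _ => id) cf.
have {}cf1 : config e p [:: c; c'; z] p1 [:: (c', t); (x, 0); (c1, t - 1); (z, 1)].
  by apply: config_perm cf1; reorder.
have pc' u : p u = c' -> p1 u = c'.
  by move=> uc; rewrite ag1 uc // eq_sym.
have [p2 [c2 [cf2 ag2]]] := config_unload c't sl' pc' cf1.
have {}cf2 : config e p [:: c; c'; z] p2
    [:: (z, 1); (x', 0); (c2, t - 1); (x, 0); (c1, t - 1)].
  by apply: config_perm cf2; reorder.
have pz u : p u = z -> p2 u = z.
  by move=> uz; rewrite ag2 ?ag1 uz // eq_sym.
have [p3 [cf3 _]] := config_split (erefl _ : p v = z) v'z vv' pz cf2.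
have evx : e v x by rewrite e_sym.
have ev'x' : e v' x' by rewrite e_sym.
have {}cf3 : config e p [:: c; c'; z] p3
    [:: (x, 0); (v, 0); (x', 0); (v', 0); (c1, t - 1); (c2, t - 1)].
  by apply: config_perm cf3; reorder.
have cf4 := config_attach evx cf3.
have {}cf4 : config e p [:: c; c'; z] (move p3 x v)
    [:: (x', 0); (v', 0); (v, 1); (c1, t - 1); (c2, t - 1)].
  by apply: config_perm cf4; reorder.
have cf5 := config_attach ev'x' cf4.
by apply: (no_revision_tti _ uF ct c't v1 isT cf5) => //=; move: t2 tk t_2; clear; lia.
Qed.

(** Without its two satellites the center [c] would be left alone; it survives as a third satellite
    of the adjacent center [c']. *)
Lemma config_unload_pair c c' z x x' : uniq [:: c; c'; z] -> ord p c = t -> ord p c' = t ->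
  ord p z = 1 -> x \in sats p c -> x' \in sats p c -> x != x' -> e c' c ->
  exists p', config e p [:: c; c'; z] p' [:: (z, 1); (x, 0); (x', 0); (c', t.+1)] /\
    forall u, p u = z -> p' u = z.
Proof.
move=> uF ct c't z1; rewrite !in_sats => /andP[/eqP xc xN] /andP[/eqP x'c x'N] xx' ec'c.
have /= := uF; rewrite !inE negb_or => /andP[/andP[cc' cz] _].
have cf := config_init3 uF ct c't z1 isT.
have cf1 := config_detach xc xN cf.
have {}cf1 : config e p [:: c; c'; z] (move p x x) [:: (c, t.-1); (x, 0); (c', t); (z, 1)].
  by apply: config_perm cf1; reorder.
have px' : move p x x x' = c by rewrite /move eq_sym (negPf xx').
have cf2 := config_detach px' x'N cf1; rewrite t_2 /= in cf2.
have {}cf2 : config e p [:: c; c'; z] (move (move p x x) x' x')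
    [:: (c, 0); (c', 2); (x, 0); (x', 0); (z, 1)].
  by apply: config_perm cf2; reorder.
have cf3 := config_attach ec'c cf2.
exists (move (move (move p x x) x' x') c c'); split.
  by rewrite t_2; apply: config_perm cf3; reorder.
have cN : p c = c by rewrite -xc sm.1.
move=> u uz; rewrite /move.
case: (eqVneq u c) => [E|_]; first by move: cz; rewrite -uz E cN eqxx.
case: (eqVneq u x') => [E|_]; first by move: cz; rewrite -uz E x'c eqxx.
by case: (eqVneq u x) => [E|//]; move: cz; rewrite -uz E xc eqxx.
Qed.

(** This excludes that a 2-star sends its own token and a borrowed one to the same 1-star. Orders
    [2, 2, 1] become [3, 3] if both satellites meet the same end of the 1-star, and [3, 1, 1]
    otherwise. *)
Lemma two_sats_adjacent_centers c c' x x' v v' : ord p c = t -> ord p c' = t -> c != c' ->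
  x \in sats p c -> x' \in sats p c -> x != x' -> e c' c ->
  ord p (p v) = 1 -> p v' = p v -> e x v -> e x' v' -> False.
Proof.
move=> ct c't cc' xc x'c xx' ec'c v1 v'z exv ex'v'; set z := p v in v1 v'z.
have zc : c != z by apply/eqP=> E; move: v1; rewrite -E ct; move: t2 tk; clear; lia.
have zc' : c' != z by apply/eqP=> E; move: v1; rewrite -E c't; move: t2 tk; clear; lia.
have uF : uniq [:: c; c'; z] by rewrite /= !inE negb_or cc' zc zc'.
have [p1 [cf1 pz]] := config_unload_pair uF ct c't v1 xc x'c xx' ec'c.
have evx : e v x by rewrite e_sym.
have ev'x' : e v' x' by rewrite e_sym.
case: (eqVneq v v') => [E|vv'].
  have [p2 [cf2 _]] := config_recenter (erefl _ : p v = z) (or_intror erefl) pz cf1.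
  have {}cf2 : config e p [:: c; c'; z] p2 [:: (x, 0); (v, 1); (x', 0); (c', t.+1)].
    by apply: config_perm cf2; reorder.
  have cf3 := config_attach evx cf2.
  have {}cf3 : config e p [:: c; c'; z] (move p2 x v) [:: (x', 0); (v, 2); (c', t.+1)].
    by apply: config_perm cf3; reorder.
  rewrite -E in ev'x'; have cf4 := config_attach ev'x' cf3.
  by apply: (no_revision_tti _ uF ct c't v1 isT cf4) => //=; move: t2 tk t_2; clear; lia.
have [p2 [cf2 _]] := config_split (erefl _ : p v = z) v'z vv' pz cf1.
have {}cf2 : config e p [:: c; c'; z] p2 [:: (x, 0); (v, 0); (x', 0); (v', 0); (c', t.+1)].
  by apply: config_perm cf2; reorder.
have cf3 := config_attach evx cf2.
have {}cf3 : config e p [:: c; c'; z] (move p2 x v) [:: (x', 0); (v', 0); (v, 1); (c', t.+1)].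
  by apply: config_perm cf3; reorder.
have cf4 := config_attach ev'x' cf3.
by apply: (no_revision_tti _ uF ct c't v1 isT cf4) => //=; move: t2 tk t_2; clear; lia.
Qed.

Lemma satlike_and_center_edge c c' x v v' : ord p c = t -> ord p c' = t -> c != c' ->
  satlike c x -> ord p (p v) = 1 -> p v' = p v -> v != v' -> e x v -> e c' v' -> False.
Proof.
move=> ct c't cc' sl v1 v'z vv' exv ec'v'; set z := p v in v1 v'z.
have zc : c != z by apply/eqP=> E; move: v1; rewrite -E ct; move: t2 tk; clear; lia.
have zc' : c' != z by apply/eqP=> E; move: v1; rewrite -E c't; move: t2 tk; clear; lia.
have uF : uniq [:: c; c'; z] by rewrite /= !inE negb_or cc' zc zc'.
have cf := config_init3 uF ct c't v1 isT.
have [p1 [c1 [cf1 ag1]]] := config_unload ct sl (fun _ => id) cf.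
have {}cf1 : config e p [:: c; c'; z] p1 [:: (z, 1); (c', t); (x, 0); (c1, t - 1)].
  by apply: config_perm cf1; reorder.
have pz u : p u = z -> p1 u = z by move=> uz; rewrite ag1 uz // eq_sym.
have [p3 [cf3 _]] := config_split (erefl _ : p v = z) v'z vv' pz cf1.
have evx : e v x by rewrite e_sym.
have {}cf3 : config e p [:: c; c'; z] p3
    [:: (x, 0); (v, 0); (v', 0); (c', t); (c1, t - 1)].
  by apply: config_perm cf3; reorder.
have cf4 := config_attach evx cf3.
have {}cf4 : config e p [:: c; c'; z] (move p3 x v)
    [:: (v', 0); (c', t); (v, 1); (c1, t - 1)].
  by apply: config_perm cf4; reorder.
have cf5 := config_attach ec'v' cf4.
by apply: (no_revision_tti _ uF ct c't v1 isT cf5) => //=; move: t2 tk t_2; clear; lia.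
Qed.

End PairRevisions.

End LocalOptimum.

(** * Counting t-stars *)

Section Tokens.
Variables (T : finType) (e : rel T).
Hypotheses (e_sym : symmetric e) (e_irr : irreflexive e).
Variables k t : nat.
Hypotheses (t2 : 1 < t) (tk : t < k).
Variable p : T -> T.
Hypotheses (smk : star_map_le e k p) (stuck : ~: cov p \subset ~: released e k p).
Hypothesis optimal : forall Q', ~ revise e k t (packing_of p) Q'.
Variable q : T -> T.
Hypotheses (smq : star_map_le e k q) (q_no_t : forall v, ord q v != t).
Implicit Types (u v w x y c z a b s : T).

Let sm : star_map e p. Proof. by case: smk. Qed.
Let sq : star_map e q. Proof. by case: smq. Qed.
Let k2 : 1 < k. Proof. lia. Qed.

Notation satlike := (satlike e t p).
Notation triangle := (triangle e t p).

(** For [t > 2] two adjacent satellites split off as a 1-star, which is Revise-t; for [t = 2] the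
    edge between them is what makes the star a triangle. *)
Lemma sats_independent c s s' : ord p c = t -> s \in sats p c -> s' \in sats p c ->
  e s s' -> triangle c.
Proof.
move=> ct sc s'c ess'; rewrite /triangle; case: (eqVneq t 2) => [_|t3] /=.
  by apply/exists_inP; exists s => //; apply/exists_inP; exists s'.
move: sc s'c; rewrite !in_sats => /andP[/eqP sc sN] /andP[/eqP s'c s'N].
have ss' : s != s' by apply: contraTneq ess' => ->; rewrite e_irr.
have uF : uniq [:: c] by [].
have F0 : {in [:: c], forall a, 0 < ord p a}.
  by move=> a; rewrite !inE => /eqP->; rewrite ct ltnW.
have := centers_init smk uF F0; rewrite /= ct => cf.
have cf1 := config_detach sc sN cf.
have {}cf1 : config e p [:: c] (move p s s) [:: (c, t.-1); (s, 0)].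
  by apply: config_perm cf1; reorder.
have ps' : move p s s s' = c by rewrite /move eq_sym (negPf ss').
have cf2 := config_detach ps' s'N cf1.
have {}cf2 : config e p [:: c] (move (move p s s) s' s') [:: (s', 0); (s, 0); (c, t.-1.-1)].
  by apply: config_perm cf2; reorder.
have := no_revision t2 smk optimal uF F0 (config_attach ess' cf2).
rewrite /= ct andbT => /(_ _)/negP[]; first lia.
apply/or3P; constructor 1; rewrite t3 /=; apply/andP; split; first by [].
by rewrite -[t.-1.-1]/(t.-2) -subn2; reorder.
Qed.

Definition bad : {set T} := [set y in open_part e k p |
  (y \notin cov q) || [exists z in barrier e k p, onbr q y z]].

Lemma t_star_open x : ord p (p x) = t -> x \in open_part e k p.
Proof.
move=> xt; rewrite in_open; apply/andP; split; apply/negP => h.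
  have xc : x \in cov p by rewrite inE xt ltnW.
  have [_ /barrierP[]] := locked_cov e_sym k2 smk h xc.
  by rewrite xt => h'; move: tk; rewrite h' ltnn.
have [xk _] := barrierP h.
case: (eqVneq (p x) x) => [E|N].
  by move: tk; rewrite -xk -{1}E xt ltnn.
by move: tk; rewrite -xk (ord_sat sm N).
Qed.

Let sl_nbr := satlike_nbr e_sym e_irr t2 tk smk stuck optimal.
Let ce_nbr := center_nbr e_sym t2 tk smk stuck optimal.

Lemma not_bad x : ord p (p x) = t -> x \notin bad ->
  x \in cov q /\ forall z, onbr q x z -> z \notin barrier e k p.
Proof.
move=> xt; rewrite in_set t_star_open //= negb_or negbK => /andP[xc /exists_inPn h].
by split=> // z xz; apply/negP => /h; rewrite xz.
Qed.

Definition leaves c x := [exists w, onbr q x w && (p w != c)].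
(* An exit vertex of a t-star is one through which the star is charged: a bad
   vertex or a vertex that behaves like a satellite and is joined by [q] to
   another star. *)
Definition exit_vertex c x :=
  (p x == c) && ((x \in bad) || satlike c x && leaves c x).
Definition exits c := [exists x, exit_vertex c x].

Lemma triangle_isolated c v : ord p c = t -> p c = c -> triangle c -> e c v ->
  p v != c -> ord p (p v) <> t.
Proof.
move=> ct cc tri ecv vc vt; have sl : satlike c c by rewrite /satlike eqxx tri orbT.
by case: (sl_nbr ct sl ecv vc) => [[]|[]]; rewrite vt; move: t2 tk; clear; lia.
Qed.

Lemma sat_nbr_inside c s w : ord p c = t -> s \in sats p c -> onbr q s w -> p w = c ->
  ~~ triangle c -> w = c.
Proof.
move=> ct sc sw wc; apply: contraNeq => wN.
apply: (@sats_independent c s w) => //; first by rewrite in_sats wc eqxx.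
exact: onbr_edge sw.
Qed.

(** All three vertices of a triangle behave like satellites, so without exit [q] covers them by
    stars inside the triangle. Its 1-stars would cover an even number of vertices, and 2-stars are
    forbidden for [q]. *)
Lemma no_exit_triangle c : ord p c = t -> p c = c -> ~~ exits c -> ~~ triangle c.
Proof.
move=> ct cc ex; apply/negP => tri; have /andP[/eqP t_2 _] := tri.
pose A := [set x | p x == c].
have slA x : x \in A -> satlike c x.
  rewrite inE /satlike in_sats => ->; case: eqVneq => //= _.
have nb x : x \in A -> x \notin bad /\ ~~ leaves c x.
  move=> xA; have := xA; rewrite inE => xc; apply/andP; rewrite -negb_or.
  apply: contra ex => h; apply/existsP; exists x; rewrite /exit_vertex xc slA //.
have oA x w : x \in A -> onbr q x w -> w \in A.
  move=> /nb[_ /existsPn/(_ w)]; rewrite inE.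
  by case: (p w == c); rewrite ?andbT // => /negPf->.
have xt x : x \in A -> ord p (p x) = t by rewrite inE => /eqP->.
have cA x : x \in A -> 0 < ord q (q x).
  by move=> xA; have [xb _] := nb x xA; have [] := not_bad (xt _ xA) xb; rewrite inE.
have qA x : x \in A -> q x \in A.
  move=> xA; case: (eqVneq (q x) x) => [->//|N]; apply: (oA x) => //.
  by rewrite /onbr eq_sym N eqxx.
have sA z : z \in A -> sats q z \subset A :\ z.
  move=> zA; apply/subsetP=> w; rewrite in_sats !inE => /andP[/eqP wz wN].
  rewrite wN /=; have := oA z w zA; rewrite inE; apply.
  by rewrite /onbr eq_sym wN wz eqxx orbT.
have A3 : #|A| = 3.
  rewrite -t_2 -ct /ord (cardsD1 c A) inE cc eqxx add1n; congr S.
  by apply: eq_card => w; rewrite in_sats !inE andbC.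
have o1 z : z \in A -> 0 < ord q z -> ord q z = 1.
  move=> zA z0; have := subset_leq_card (sA z zA).
  have := cardsD1 z A; rewrite zA A3 -/(ord q z).
  by have := q_no_t z; rewrite t_2; move: z0; clear; lia.
have cA' : c \in A by rewrite inE cc.
pose z := q c; have zA : z \in A by exact: qA.
have zz : q z = z by exact: sq.1.
have z1 : #|sats q z| = 1 by apply: o1 => //; apply: cA.
have [w wE] := cards1P (introT eqP z1).
have wz : w \in sats q z by rewrite wE inE.
have /setD1P[wN wA] := subsetP (sA z zA) _ wz.
have [u uE] : exists u, A :\ z :\ w = [set u].
  apply/cards1P; have := cardsD1 z A; have := cardsD1 w (A :\ z).
  by rewrite zA A3 !inE wN (eqP (_ : p w == c)) ?eqxx //=; [clear; lia|move: wA; rewrite inE].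
have : u \in A :\ z :\ w by rewrite uE inE.
rewrite !in_setD1 => /and3P[uw uz uA].
have cases x : x \in A -> [\/ x = z, x = w | x = u].
  move=> xA; case: (eqVneq x z) => [->|xz]; first by constructor 1.
  case: (eqVneq x w) => [->|xw]; first by constructor 2.
  by constructor 3; apply/set1P; rewrite -uE !in_setD1 xw xz.
have qw : q w = z by move: wz; rewrite in_sats => /andP[/eqP].
have qu : q u = u.
  case: (cases _ (qA _ uA)) => // E.
    have : u \in sats q z by rewrite in_sats E eqxx.
    by rewrite wE inE (negPf uw).
  by have := sq.1 u; rewrite E qw => E'; move: wN; rewrite E' eqxx.
have /card_gt0P[x xu] := cA _ uA; rewrite qu in xu.
have /setD1P[xN xA] := subsetP (sA u uA) _ xu.
move: xu; rewrite in_sats => /andP[/eqP xu _].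
case: (cases _ xA) => E.
- by move: uz; rewrite -xu E zz eqxx.
- by move: uz; rewrite -xu E qw eqxx.
- by move: xN; rewrite E eqxx.
Qed.

(** Without exit each satellite is joined by [q] to [c] only, so all [t] satellites belong to the
    star of [c] in [q]. That star is not a t-star and must have a further satellite, necessarily
    outside. *)
Lemma no_exit_center c : ord p c = t -> p c = c -> ~~ exits c ->
  exists y, [&& q y == c, y != c & p y != c].
Proof.
move=> ct cc ex; have tri := no_exit_triangle ct cc ex.
have sc s : s \in sats p c -> onbr q s c.
  move=> ss; have := ss; rewrite in_sats => /andP[/eqP psc _].
  have : ~~ exit_vertex c s by apply: contra ex => h; apply/existsP; exists s.
  rewrite /exit_vertex psc eqxx /= negb_or /satlike ss /= => /andP[sb /existsPn lv].
  have st : ord p (p s) = t by rewrite psc.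
  have [/(covP _ sq)[w sw] _] := not_bad st sb.
  have := lv w; rewrite sw /= negbK => /eqP wc.
  by rewrite -(sat_nbr_inside ct ss sw wc tri).
have s2 : 1 < #|sats p c| by rewrite -/(ord p c) ct.
have qc : q c = c.
  apply/eqP/negPn/negP => N; have [s [s' [ss s's ss']]] := card_gt1P s2.
  have h x : onbr q x c -> x = q c.
    case/andP=> _ /orP[/eqP E|/eqP->//]; by move: N; rewrite -E sq.1 eqxx.
  by move: ss'; rewrite (h _ (sc _ ss)) (h _ (sc _ s's)) eqxx.
have qs s : s \in sats p c -> q s = c.
  move=> ss; have /andP[sN /orP[/eqP//|/eqP E]] := sc _ ss.
  by move: sN; rewrite -E qc eqxx.
have sub : sats p c \subset sats q c.
  apply/subsetP=> s ss; rewrite in_sats qs // eqxx.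
  by move: ss; rewrite in_sats => /andP[].
have : ~~ (sats q c \subset sats p c).
  apply/negP => sub'; have /eqP E : sats q c == sats p c by rewrite eqEsubset sub' sub.
  by have := q_no_t c; rewrite /ord E -/(ord p c) ct eqxx.
case/subsetPn=> y; rewrite in_sats => /andP[/eqP yq yN] yp; exists y.
by rewrite yq eqxx yN /=; apply: contra yp => py; rewrite in_sats py.
Qed.

Definition outer c := odflt c [pick y | [&& q y == c, y != c & p y != c]].

Lemma outerP c : ord p c = t -> p c = c -> ~~ exits c ->
  [/\ q (outer c) = c, outer c != c, p (outer c) != c & e c (outer c)].
Proof.
move=> ct cc ex; rewrite /outer; case: pickP => [y /and3P[/eqP yq yN yp]|h] /=.
  by split=> //; rewrite -yq sq.2 // yq eq_sym.
by have [y] := no_exit_center ct cc ex; rewrite h.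
Qed.

(** By [center_nbr], [y] is the center of its t-star, and this star is not a triangle because its
    center has a neighbour in another t-star. In [q] the vertex [y] is a satellite of [c], so no
    satellite of [y] can be joined to it and each one must lead outside or be bad. *)
Lemma outer_t c : ord p c = t -> p c = c -> ~~ exits c -> ord p (p (outer c)) = t ->
  let y := outer c in p y = y /\ forall s, s \in sats p y -> exit_vertex y s.
Proof.
move=> ct cc ex yt y; rewrite -/y in yt; have [yq yN yp ecy] := outerP ct cc ex.
rewrite -/y in yq yN yp ecy.
have py : p y = y.
  by case: (ce_nbr ct cc ecy yp) => //; rewrite yt; move: t2; clear; lia.
split=> // s ss; have := ss; rewrite in_sats => /andP[/eqP sy sN].
have {}yt : ord p y = t by rewrite -py.
rewrite /exit_vertex sy eqxx /=; case: (boolP (s \in bad)) => //= sb.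
have st : ord p (p s) = t by rewrite sy.
rewrite /satlike ss /=; have [/(covP _ sq)[w sw] _] := not_bad st sb.
apply/existsP; exists w; rewrite sw /=; apply/negP => /eqP wy.
have tri : ~~ triangle y.
  apply/negP => tri; have eyc : e y c by rewrite e_sym.
  have cy : p c != y by rewrite cc eq_sym.
  by have := triangle_isolated yt py tri eyc cy; rewrite cc.
have E := sat_nbr_inside yt ss sw wy tri; rewrite E in sw.
case/andP: sw => _ /orP[/eqP qs|/eqP qs].
  by move: yN; rewrite -yq -qs sq.1 qs eqxx.
have sc : s = c by rewrite -qs yq.
by move: yN; rewrite -sy sc cc eqxx.
Qed.

Definition first_exit c := odflt c [pick x | exit_vertex c x].
(** It must differ from [first_exit] because the lending star may use that vertex for its own
    token. *)
Definition second_exit c :=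
  odflt c [pick x | [&& x \in sats p c, exit_vertex c x & x != first_exit c]].

Lemma exit_vertexP c x : exit_vertex c x ->
  p x = c /\ (x \in bad) || satlike c x && leaves c x.
Proof. by case/andP=> /eqP. Qed.

Lemma first_exitP c : exits c -> exit_vertex c (first_exit c).
Proof.
rewrite /first_exit => /existsP[x xc].
by case: pickP => [y //|/(_ x)]; rewrite xc.
Qed.

Lemma second_exitP c : ord p c = t -> (forall s, s \in sats p c -> exit_vertex c s) ->
  [/\ second_exit c \in sats p c, exit_vertex c (second_exit c) &
      second_exit c != first_exit c].
Proof.
move=> ct ex; rewrite /second_exit; case: pickP => [y /and3P[]//|h] /=.
have /card_gt1P[s [s' [ss s's ss']]] : 1 < #|sats p c| by rewrite -/(ord p c) ct.
have := h s; have := h s'; rewrite ss s's (ex _ ss) (ex _ s's) /=.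
by move=> /negbFE/eqP E /negbFE/eqP E'; move: ss'; rewrite E E' eqxx.
Qed.

(* A t-star of [p] without exit whose center has, in [q], the center of another
   t-star of [p] as a satellite borrows an exit vertex from that star. *)
Definition token_vertex c :=
  if exits c then first_exit c else second_exit (outer c).

Definition t_centers := [set c | ord p c == t].
(** These are the t-stars that pay through an exit, their own or a borrowed one; the remaining ones,
    [nbr_centers], hand their token over from the center to the star of [outer c]. *)
Definition exit_centers :=
  [set c in t_centers | exits c || (ord p (p (outer c)) == t)].
Definition nbr_centers := t_centers :\: exit_centers.

Lemma t_centersP c : c \in t_centers -> ord p c = t /\ p c = c.
Proof.
rewrite inE => /eqP ct; split=> //; apply: (ord_gt0_center sm).
by rewrite ct ltnW.
Qed.

Lemma in_exit_centers c :
  (c \in exit_centers) = (c \in t_centers) && (exits c || (ord p (p (outer c)) == t)).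
Proof. by rewrite in_set. Qed.

Lemma in_good_centers c :
  (c \in [set c in exit_centers | token_vertex c \notin bad]) =
  (c \in exit_centers) && (token_vertex c \notin bad).
Proof. by rewrite in_set. Qed.

Lemma exit_centersP c : c \in exit_centers ->
  exits c \/ [/\ ~~ exits c, p (outer c) = outer c &
                 forall s, s \in sats p (outer c) -> exit_vertex (outer c) s].
Proof.
rewrite in_exit_centers => /andP[/t_centersP[ct cc]]; case: (boolP (exits c)) => [|ex /= /eqP yt].
  by left.
by right; have [] := outer_t ct cc ex yt.
Qed.

Lemma token_vertexP c : c \in exit_centers ->
  let x := token_vertex c in
  [/\ exit_vertex (p x) x, p x \in t_centers, exits (p x) &
      p x = c /\ exits c \/
      [/\ ~~ exits c, p x = outer c, x \in sats p (p x) & x != first_exit (p x)]].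
Proof.
move=> cE; have := cE; rewrite {1}in_exit_centers => /andP[cT yt]; have [ct cc] := t_centersP cT.
rewrite /token_vertex; case: (exit_centersP cE) => [ex|[ex yy h]].
  have h := first_exitP ex; have [pE _] := exit_vertexP h.
  by rewrite ex pE cT; split=> //; left.
rewrite (negPf ex) /= in yt *.
have {}yt : ord p (outer c) = t by rewrite -yy; apply/eqP.
have [h1 h2 h3] := second_exitP yt h.
have -> : p (second_exit (outer c)) = outer c by move: h1; rewrite in_sats => /andP[/eqP].
split=> //; first by rewrite inE yt.
  by apply/existsP; exists (second_exit (outer c)).
by right.
Qed.

Lemma outer_inj c c' : c \in t_centers -> c' \in t_centers -> ~~ exits c -> ~~ exits c' ->
  outer c = outer c' -> c = c'.
Proof.
move=> /t_centersP[ct cc] /t_centersP[c't c'c'] ex ex' E.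
have [<- _ _ _] := outerP ct cc ex; have [<- _ _ _] := outerP c't c'c' ex'.
by rewrite E.
Qed.

Lemma exit_t_centers c : c \in exit_centers -> c \in t_centers.
Proof. by rewrite in_exit_centers => /andP[]. Qed.

(** A lender keeps its first exit and lends a different one. Two borrowers never share a lender,
    since [q] maps [outer c] back to [c]. *)
Lemma token_vertex_inj : {in exit_centers &, injective token_vertex}.
Proof.
move=> c c' cE c'E E.
have [_ _ _ h] := token_vertexP cE; have [_ _ _ h'] := token_vertexP c'E.
rewrite -E in h'.
case: h => [[pc ex]|[ex pc xs xN]]; case: h' => [[pc' ex']|[ex' pc' xs' xN']].
- by rewrite -pc pc'.
- by move: xN'; rewrite pc {1}/token_vertex ex eqxx.
- by move: xN; rewrite pc' E {1}/token_vertex ex' eqxx.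
by apply: outer_inj => //; rewrite ?exit_t_centers // -pc.
Qed.

Definition good_centers := [set c in exit_centers | token_vertex c \notin bad].

Lemma card_t_centers : #|t_centers| <= #|bad| + #|good_centers :|: nbr_centers|.
Proof.
rewrite -(cardsID exit_centers) (setIidPr _); last first.
  by apply/subsetP=> c; apply: exit_t_centers.
rewrite -(cardsID [set c | token_vertex c \in bad] exit_centers) -addnA leq_add //.
  rewrite -(card_in_imset (f := token_vertex)); last first.
    by move=> c c' /setIP[cE _] /setIP[c'E _]; apply: token_vertex_inj.
  by apply/subset_leq_card/subsetP=> x /imsetP[c /setIP[_]]; rewrite in_set => + ->.
rewrite -cardsUI (_ : _ :&: nbr_centers = set0) ?cards0 ?addn0.
  apply/subset_leq_card/setSU/subsetP=> c.
  by rewrite in_setD in_good_centers in_set andbC.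
by apply/setP=> c; rewrite in_setI !in_setD in_set0; case: (c \in exit_centers); rewrite ?andbF.
Qed.

Definition leaf x := odflt x [pick w | onbr q x w && (p w != p x)].
Definition token c := if c \in good_centers then p (leaf (token_vertex c)) else p (outer c).

Lemma good_centersP c : c \in good_centers ->
  let x := token_vertex c in let w := leaf x in let a := p x in
  [/\ ord p a = t, satlike a x, onbr q x w, e x w &
    p w != a /\ (ord p (p w) = k /\ p w = w \/ ord p (p w) = t - 1 /\ (p w = w \/ t = 2))].
Proof.
rewrite in_good_centers => /andP[cE xb] x w a.
have [/exit_vertexP[_ h] /t_centersP[at_ aa] _ _] := token_vertexP cE.
rewrite -/x (negPf xb) /= in h; case/andP: h => sl /existsP[w' ww'].
have [xw wa] : onbr q x w /\ p w != a.
  rewrite /w /leaf; case: pickP => [y /andP[]//|/(_ w')].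
  by rewrite ww'.
have exw : e x w by apply: onbr_edge xw.
by split=> //; split=> //; apply: (sl_nbr at_ sl exw wa).
Qed.

Lemma nbr_centersP c : c \in nbr_centers ->
  let y := outer c in
  [/\ ord p c = t, p c = c, ~~ exits c, q y = c &
    [/\ y != c, p y != c, e c y, ord p (p y) != t &
      [\/ p y = y, ord p (p y) = 1 | ord p (p y) = t + 1]]].
Proof.
rewrite in_setD => /andP[h cT]; have [ct cc] := t_centersP cT.
move: h; rewrite in_exit_centers cT andTb negb_or => /andP[ex yt] y.
have [yq yN yp ecy] := outerP ct cc ex.
by have h3 := ce_nbr ct cc ecy yp; split.
Qed.

Lemma good_nbr c c' : c \in good_centers -> c' \in nbr_centers ->
  p (token_vertex c) != c' /\ token_vertex c != c'.
Proof.
rewrite in_good_centers => /andP[cE _] /nbr_centersP[_ c'c' ex _ _].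
have [_ _ ex' _] := token_vertexP cE.
have N : p (token_vertex c) != c' by apply: contraNneq ex => <-.
by split=> //; apply: contraNneq N => E; rewrite E c'c'.
Qed.

Definition holders z := [set c in good_centers :|: nbr_centers | token c == z].

Lemma holdersP z c : c \in holders z ->
  c \in good_centers /\ p (leaf (token_vertex c)) = z \/
  [/\ c \notin good_centers, c \in nbr_centers & p (outer c) = z].
Proof.
rewrite in_set in_setU /token => /andP[].
by case: (boolP (c \in good_centers)) => /= [cg _ /eqP|cg cn /eqP]; [left|right].
Qed.

Lemma holder_ord z c : c \in holders z -> ord p z != t /\ 0 < ord p z.
Proof.
case/holdersP=> [[cg <-]|[_ cn <-]].
  have [_ _ _ _ [_ h]] := good_centersP cg.
  by case: h => [[-> _]|[-> _]]; move: t2 tk; clear; split; lia.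
have [ct cc _ _ [_ _ ecy yt _]] := nbr_centersP cn.
by split=> //; apply: (star_vertex_covered e_sym tk stuck ct cc ecy).
Qed.

Lemma card_le1 (A : {set T}) : (forall c c', c \in A -> c' \in A -> c = c') -> #|A| <= 1.
Proof.
move=> h; case: (set_0Vmem A) => [->|[c cA]]; first by rewrite cards0.
by rewrite -(cards1 c); apply/subset_leq_card/subsetP=> c' c'A; rewrite inE (h c' c).
Qed.

Lemma card_le2 (A : {set T}) c c' : A \subset [set c; c'] -> #|A| <= 2.
Proof. by move=> /subset_leq_card h; apply: leq_trans h _; rewrite cards2; case: eqP. Qed.

Lemma good_pair_false c c' : c \in good_centers -> c' \in good_centers -> c != c' ->
  t != 2 -> leaf (token_vertex c) = leaf (token_vertex c') ->
  ord p (p (leaf (token_vertex c))) = t - 1 -> False.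
Proof.
move=> cg c'g cc' t3 E wt.
have [xt sl _ exw [_ hw]] := good_centersP cg.
have [x't sl' _ ex'w [_ hw']] := good_centersP c'g.
have xx' : token_vertex c != token_vertex c'.
  apply: contraNneq cc' => /token_vertex_inj E'; apply/eqP/E'.
    by move: cg; rewrite in_good_centers => /andP[].
  by move: c'g; rewrite in_good_centers => /andP[].
rewrite -E in ex'w.
have ww : p (leaf (token_vertex c)) = leaf (token_vertex c).
  by case: hw => [[]//|[_ [//|E2]]]; rewrite E2 in t3.
case: (eqVneq (p (token_vertex c)) (p (token_vertex c'))) => [aa'|aa'].
  rewrite -aa' in sl'; rewrite ww in wt.
  have sa x : satlike (p (token_vertex c)) x -> x \in sats p (p (token_vertex c)).
    by case/orP=> // /andP[_ /andP[E2 _]]; rewrite E2 in t3.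
  exact: (two_sats_common_nbr e_sym t2 tk smk optimal t3 xt (sa _ sl) (sa _ sl') xx' wt exw ex'w).
by apply: (two_satlike_common_nbr e_sym e_irr t2 tk smk optimal xt x't aa' sl sl' wt _ exw ex'w); left.
Qed.

Lemma outer_pair c c' : c \in nbr_centers -> c' \in nbr_centers -> c != c' ->
  outer c != outer c'.
Proof.
move=> /nbr_centersP[_ _ _ yq _] /nbr_centersP[_ _ _ y'q _]; apply: contraNneq => E.
by rewrite -yq -y'q E.
Qed.

(** Any two holders of a 1-star would allow a revision. A token arriving through a leaf requires
    [t = 2] here, by [satlike_nbr], whence the lemmas on pairs of 2-stars; two tokens coming
    directly from centers are excluded for every [t]. *)
Lemma holders_edge z : ord p z = 1 -> #|holders z| <= 1.
Proof.
move=> z1; apply: card_le1 => c c' cz c'z; apply/eqP/negPn/negP => cc'.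
have NN a a' : a \in nbr_centers -> a' \in nbr_centers -> a != a' ->
    p (outer a) = z -> p (outer a') = z -> False.
  move=> an a'n aa' az a'z; have [at_ _ _ _ [_ _ eay _ _]] := nbr_centersP an.
  have [a't _ _ _ [_ _ ea'y _ _]] := nbr_centersP a'n.
  have yy' := outer_pair an a'n aa'.
  apply: (two_centers_edge e_sym t2 tk smk optimal at_ a't aa' _ _ yy' eay ea'y).
    by rewrite az.
  by rewrite az a'z.
have GN a a' : a \in good_centers -> a' \in nbr_centers ->
    p (leaf (token_vertex a)) = z -> p (outer a') = z -> False.
  move=> ag a'n az a'z; have [xt sl xw exw [_ hw]] := good_centersP ag.
  have [a't a'a' _ yq [yN _ ea'y _ _]] := nbr_centersP a'n.
  have [N1 N2] := good_nbr ag a'n.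
  have t_2 : t = 2.
    by move: hw; rewrite az z1 => -[[h _]|[h _]]; move: h t2 tk; clear; lia.
  (* In [q] the only neighbour of the satellite [outer a'] is [a'], which is not the token
     vertex. *)
  have wy : leaf (token_vertex a) != outer a'.
    apply/eqP=> E; move: xw; rewrite E => /andP[_ /orP[/eqP h|/eqP h]].
      have : q (outer a') = outer a' by rewrite -h sq.1.
      by rewrite yq => E'; rewrite -E' eqxx in yN.
    by have := N2; rewrite -h yq eqxx.
  apply: (satlike_and_center_edge e_sym e_irr t2 tk smk optimal t_2 xt a't N1 sl _ _ wy exw ea'y).
    by rewrite az.
  by rewrite az a'z.
case/holdersP: cz => [[cg cz]|[_ cn cz]]; case/holdersP: c'z => [[c'g c'z]|[_ c'n c'z]];
  [|exact: (GN c c')|exact: (GN c' c)|exact: (NN c c')].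
have [xt sl xw exw [_ hw]] := good_centersP cg.
have [x't sl' x'w' ex'w' _] := good_centersP c'g.
have t_2 : t = 2.
  by move: hw; rewrite cz z1 => -[[h _]|[h _]]; move: h t2 tk; clear; lia.
have cE : c \in exit_centers by move: cg; rewrite in_good_centers => /andP[].
have c'E : c' \in exit_centers by move: c'g; rewrite in_good_centers => /andP[].
have xx' : token_vertex c != token_vertex c'.
  by apply: contraNneq cc' => /token_vertex_inj E'; apply/eqP/E'.
have w1 : ord p (p (leaf (token_vertex c))) = 1 by rewrite cz.
have pww : p (leaf (token_vertex c')) = p (leaf (token_vertex c)) by rewrite cz.
case: (eqVneq (p (token_vertex c)) (p (token_vertex c'))) => [aa'|aa']; last first.
  case: (eqVneq (leaf (token_vertex c)) (leaf (token_vertex c'))) => [ww'|ww'].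
    rewrite -ww' in ex'w'.
    by apply: (two_satlike_common_nbr e_sym e_irr t2 tk smk optimal xt x't aa' sl sl' _ _ exw ex'w');
      [rewrite w1 t_2|right].
  exact: (two_satlike_edge e_sym e_irr t2 tk smk optimal t_2 xt x't aa' sl sl' w1 pww ww' exw ex'w').
(* Both tokens come from the same t-star: one of [c], [c'] is its center, the
   other one is the center of a neighbouring t-star that borrowed a vertex. *)
have main a a' : a \in good_centers -> a' \in good_centers ->
    p (token_vertex a) = p (token_vertex a') -> token_vertex a != token_vertex a' ->
    p (leaf (token_vertex a)) = z -> p (leaf (token_vertex a')) = z ->
    [/\ ~~ exits a', p (token_vertex a') = outer a' &
        token_vertex a' \in sats p (p (token_vertex a'))] -> False.
  move=> ag a'g E xN az a'z [ex' po xs'].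
  have [at_ asl _ aexw _] := good_centersP ag; have [a't _ _ a'exw _] := good_centersP a'g.
  have a'E : a' \in exit_centers by move: a'g; rewrite in_good_centers => /andP[].
  have [a't' a'c] := t_centersP (exit_t_centers a'E).
  have [yq yN py ey] := outerP a't' a'c ex'.
  have yy : p (outer a') = outer a' by rewrite -po sm.1.
  rewrite -E in po a't xs'.
  have xs : token_vertex a \in sats p (p (token_vertex a)).
    case/orP: (asl) => // /andP[_]; rewrite po => tri.
    have yt : ord p (outer a') = t by rewrite -po.
    have ya : e (outer a') a' by rewrite e_sym.
    have pN : p a' != outer a' by rewrite a'c eq_sym.
    by have := triangle_isolated yt yy tri ya pN; rewrite a'c.
  have N : p (token_vertex a) != a' by rewrite po.
  have eo : e a' (p (token_vertex a)) by rewrite po.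
  apply: (two_sats_adjacent_centers e_sym t2 tk smk optimal t_2 at_ a't' N xs xs' xN eo _ _ aexw a'exw).
    by rewrite az.
  by rewrite a'z.
have [_ _ _ h] := token_vertexP cE; have [_ _ _ h'] := token_vertexP c'E.
have x'x : token_vertex c' != token_vertex c by rewrite eq_sym.
case: h' => [[pc' ex']|[ex' pc' xs' _]]; last exact: (main c c').
case: h => [[pc ex]|[ex pc xs _]]; last exact: (main c' c).
by move: cc'; rewrite -pc -pc' aa' eqxx.
Qed.

Lemma good_big z c : c \in good_centers -> p (leaf (token_vertex c)) = z -> 1 < ord p z ->
  leaf (token_vertex c) = z /\ (ord p z = k \/ ord p z = t - 1 /\ t != 2).
Proof.
move=> cg <- z2; have [_ _ _ _ [_ h]] := good_centersP cg.
case: h => [[h hw]|[h hw]]; first by rewrite hw in h *; split=> //; left.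
have t3 : t != 2 by move: z2 h; clear; lia.
by case: hw => [hw|E]; [rewrite hw in h *; split=> //; right|rewrite E in t3].
Qed.

(** A 1-star holds at most one token. A larger star holds at most two, unless it is a k-star all of
    whose tokens arrive at its center [z]; then the degree of [z] in [q] is the bound. *)
Lemma card_holders z : #|holders z| <= ord p z.
Proof.
case: (set_0Vmem (holders z)) => [->|[c0 /holder_ord[zt z0]]]; first by rewrite cards0.
case: (leqP (ord p z) 1) => [z1|z2].
  by have {z0 z1}E : ord p z = 1 by [lia]; rewrite E; apply: holders_edge.
case: (boolP [exists c in nbr_centers, (p (outer c) == z) && (outer c != z)]).
  move=> /exists_inP[c cn /andP[/eqP cz yz]].
  have [ct cc ex yq [yN yp ecy _ hy]] := nbr_centersP cn.
  have zt1 : ord p z = t + 1.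
    by case: hy; rewrite cz => // E; [move: yz; rewrite E eqxx|move: z2; rewrite E].
  have ys : outer c \in sats p z by rewrite in_sats cz eqxx.
  (* Besides [c], the only possible holder is the one whose [outer] vertex is [z] itself, and that
     is [q z]. *)
  apply: (leq_trans _ z2); apply: (@card_le2 _ c (q z)); apply/subsetP=> c' /holdersP h.
  rewrite !inE; case: eqVneq => //= c'c; case: h => [[c'g c'z]|[_ c'n c'z]].
    have [xt sl xw exw [_ hw]] := good_centersP c'g; have [N _] := good_nbr c'g cn.
    have [wz _] := good_big c'g c'z z2; rewrite wz in exw.
    by have := satlike_and_center_big_star e_sym e_irr t2 tk smk optimal xt ct N sl zt1 exw ys ecy.
  have [c't c'c' _ y'q [_ _ ec'y _ _]] := nbr_centersP c'n.
  case: (eqVneq (outer c') z) => [<-|y'z]; first by rewrite y'q.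
  have y's : outer c' \in sats p z by rewrite in_sats c'z eqxx.
  have yy' := outer_pair c'n cn c'c.
  by have := two_centers_big_star t2 tk smk optimal c't ct c'c zt1 y's ys yy' ec'y ecy.
move=> /exists_inPn h.
have yz c : c \in nbr_centers -> p (outer c) = z -> outer c = z /\ q z = c.
  move=> cn cz; have := h c cn; rewrite cz eqxx negbK => /eqP E.
  by have [_ _ _ yq _] := nbr_centersP cn; split=> //; rewrite -E.
case: (eqVneq (ord p z) k) => [zk|zk].
  (* Here every token runs along an edge of [q] at [z]; its other end [f c] determines the holder,
     and there are at most [k] such edges. *)
  rewrite zk; pose f c := if c \in good_centers then token_vertex c else c.
  rewrite -(card_in_imset (f := f)).
    apply: leq_trans (onbr_degree k2 z smq); apply/subset_leq_card/subsetP=> x.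
    move=> /imsetP[c cz ->]; rewrite inE /f; case/holdersP: cz => [[cg cz]|[cg cn cz]].
      rewrite cg; have [_ _ xw _ _] := good_centersP cg.
      by have [<- _] := good_big cg cz z2; rewrite onbr_sym.
    rewrite (negPf cg); have [E1 E2] := yz _ cn cz; have [_ _ _ _ [yN _ _ _ _]] := nbr_centersP cn.
    by rewrite /onbr E2 eqxx -E1 yN.
  move=> c c' /holdersP cz /holdersP c'z; rewrite /f.
  case: cz => [[cg cz]|[cg cn cz]]; case: c'z => [[c'g c'z]|[c'g c'n c'z]]; rewrite ?cg ?c'g ?(negPf cg) ?(negPf c'g).
  - by apply: token_vertex_inj; [move: cg|move: c'g]; rewrite in_good_centers => /andP[].
  - by move=> E; have [_] := good_nbr cg c'n; rewrite E eqxx.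
  - by move=> E; have [_] := good_nbr c'g cn; rewrite E eqxx.
  - by [].
apply: (leq_trans _ z2).
case: (boolP [exists c in good_centers, p (leaf (token_vertex c)) == z]).
  move=> /exists_inP[c cg /eqP cz]; apply: (@card_le2 _ c (q z)); apply/subsetP=> c' /holdersP h'.
  rewrite !inE; case: eqVneq => //= c'c; case: h' => [[c'g c'z]|[_ c'n c'z]]; last first.
    by have [_ ->] := yz _ c'n c'z.
  have [wz hz] := good_big cg cz z2; have [w'z _] := good_big c'g c'z z2.
  case: hz => [E|[E t3]]; first by rewrite E eqxx in zk.
  have cc' : c != c' by rewrite eq_sym.
  by have := good_pair_false cg c'g cc' t3; rewrite cz wz w'z => /(_ erefl E).
move=> /exists_inPn h'; apply: (@card_le2 _ (q z) (q z)); apply/subsetP=> c /holdersP h''.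
case: h'' => [[cg cz]|[_ cn cz]]; first by have := h' c cg; rewrite cz eqxx.
by have [_ ->] := yz _ cn cz; rewrite !inE eqxx.
Qed.

(** The inequality [i / (i + 1) <= k / (k + 1)] for stars of order [i <= k], summed over the stars
    with the denominators cleared. *)
Lemma token_count : k.+1 * #|good_centers :|: nbr_centers| <=
  k * \sum_(z | (0 < ord p z) && (ord p z != t)) (ord p z).+1.
Proof.
rewrite -sum1_card (partition_big token (fun z => (0 < ord p z) && (ord p z != t))) /=; last first.
  move=> c cg; have /holder_ord[-> ->] // : c \in holders (token c).
  by rewrite in_set cg eqxx.
rewrite !big_distrr /=; apply: leq_sum => z /andP[z0 zt].
have -> : \sum_(c in good_centers :|: nbr_centers | token c == z) 1 = #|holders z|.
  by rewrite -sum1_card; apply: eq_bigl => c; rewrite [RHS]in_set.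
have := card_holders z; have := smk.2 z; move: (ord p z) => o; move: #|_| => h.
move=> ok ho; apply: (@leq_trans (k.+1 * o)); first by rewrite leq_mul2l ho orbT.
by rewrite mulSn mulnS leq_add2r.
Qed.

Lemma card_cov : #|cov p| =
  t.+1 * #|t_centers| + \sum_(z | (0 < ord p z) && (ord p z != t)) (ord p z).+1.
Proof.
have fib z : 0 < ord p z -> #|[set v | p v == z]| = (ord p z).+1.
  move=> z0; rewrite (cardsD1 z) inE (ord_gt0_center sm z0) eqxx add1n; congr S.
  by apply: eq_card => v; rewrite !inE andbC.
rewrite -sum1_card (partition_big p (fun z => 0 < ord p z)) /=; last by move=> v; rewrite inE.
have E z : 0 < ord p z -> \sum_(v in cov p | p v == z) 1 = (ord p z).+1.
  move=> z0; rewrite -fib // -sum1_card; apply: eq_bigl => v; rewrite !inE.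
  by case: eqP => [->|]; rewrite ?z0 ?andbF.
rewrite (eq_bigr _ E) (bigID (fun z => ord p z == t)) /=; congr addn.
rewrite mulnC -sum_nat_const.
rewrite [RHS](eq_bigl (fun z => (0 < ord p z) && (ord p z == t))); last first.
  by move=> z; rewrite inE; case: eqP => [->|]; rewrite ?andbF // andbT ltnW.
by apply: eq_bigr => z /andP[_ /eqP->].
Qed.

Lemma ratio_nat : #|cov q| * (k * t.+1 + 1) <=
  (k * t.+2 + 1) * (#|cov p| - #|t_centers|).
Proof.
have := cov_deficit e_sym k2 smk stuck smq; rewrite -/bad.
have := token_count; have := card_t_centers; rewrite card_cov.
set R := \sum_(_ | _) _; move: #|t_centers| #|bad| #|_ :|: _| #|cov q| => n b g m.
move=> h1 h2 h3.
have h4 : k.+1 * n <= k.+1 * b + k * R.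
  apply: leq_trans (_ : k.+1 * (b + g) <= _); first by rewrite leq_mul2l h1 orbT.
  by rewrite mulnDr leq_add2l.
have -> : t.+1 * n + R - n = t * n + R by lia.
apply: (@leq_trans ((t.+1 * n + R - b) * (k * t.+1 + 1))).
  by rewrite leq_mul2r; apply/orP; right; lia.
(* Bad vertices do not worsen the ratio: what they subtract from the size of [q] outweighs the
   t-stars that they permit. *)
have : k.+1 * b <= (k * t.+1 + 1) * b by rewrite leq_mul2r; apply/orP; right; lia.
rewrite mulnBl leq_subLR => h5; lia.
Qed.

End Tokens.

(** * The approximation ratio *)

Section Approximation.
Variables (T : finType) (e : rel T).
Hypotheses (e_sym : symmetric e) (e_irr : irreflexive e).
Variables k t : nat.
Hypotheses (t2 : 1 < t) (tk : t < k).
Implicit Types (p : T -> T) (v c : T) (f : T -> T) (Q P R : {set star T}).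

Let k2 : 1 < k. Proof. exact: leq_trans t2 (ltnW tk). Qed.

Definition trim_map p f v :=
  if (ord p (p v) == t) && (f (p v) == v) then v else p v.

Lemma trim_mapP p f : star_map_le e k p ->
  (forall c, ord p c = t -> f c \in sats p c) ->
  [/\ star_map_le e k (trim_map p f),
      forall c, sats (trim_map p f) c = if ord p c == t then sats p c :\ f c else sats p c &
      cov (trim_map p f) = cov p :\: [set f c | c in [set c | ord p c == t]]].
Proof.
move=> [sm pk] fs.
have satsE c : sats (trim_map p f) c = if ord p c == t then sats p c :\ f c else sats p c.
  apply/setP=> w; rewrite in_sats /trim_map; case: ifP => [/andP[/eqP ot /eqP fw]|h].
    case: (eqVneq w c) => [->|wc] /=.
      by case: ifP => _; rewrite ?in_setD1 in_sats eqxx ?andbF.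
    case: ifP => [_|/eqP oc]; rewrite ?in_setD1 in_sats.
      by case: (eqVneq (p w) c) => [<-|]; rewrite ?fw ?eqxx ?andbF.
    by case: (eqVneq (p w) c) oc => [<-|].
  case: ifP => [oc|_]; rewrite ?in_setD1 in_sats //.
  case: (eqVneq (p w) c) => [E|]; rewrite ?andbF //=.
  by move: h; rewrite E oc /= eq_sym => ->.
have ordE c : ord (trim_map p f) c = if ord p c == t then t.-1 else ord p c.
  rewrite /ord satsE; case: eqP => [ot|//].
  by have := cardsD1 (f c) (sats p c); rewrite (fs _ ot) -/(ord p c) ot add1n => ->.
have pp v : p (p v) = p v by exact: sm.1.
have fN c : ord p c = t -> f c != c /\ p (f c) = c.
  by move=> /fs; rewrite in_sats => /andP[/eqP].
have sm' : star_map e (trim_map p f).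
  split=> v; last by rewrite /trim_map; case: ifP => [|_]; [rewrite eqxx|exact: sm.2].
  case: (boolP ((ord p (p v) == t) && (f (p v) == v))) => h.
    have E : trim_map p f v = v by rewrite /trim_map h.
    by rewrite !E.
  have -> : trim_map p f v = p v by rewrite /trim_map (negPf h).
  rewrite /trim_map pp; case: ifP => [/andP[/eqP ot /eqP fe]|//].
  by have [] := fN _ ot; rewrite fe eqxx.
split=> //; first split=> // v.
  by rewrite ordE; case: eqP => // _; apply: leq_trans (leq_pred _) (ltnW tk).
apply/setP=> v; rewrite in_setD !inE ordE.
have -> : (v \in [set f c | c in [set c | ord p c == t]]) =
          (ord p (p v) == t) && (f (p v) == v).
  apply/imsetP/andP => [[c]|[ot /eqP fv]]; last by exists (p v); rewrite ?inE.
  by rewrite inE => /eqP ot ->; have [_ ->] := fN _ ot; rewrite ot !eqxx.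
rewrite [trim_map p f v]/trim_map.
case: (boolP ((ord p (p v) == t) && (f (p v) == v))) => [/andP[/eqP ot /eqP fe]|_] /=.
  have [fv _] := fN _ ot; rewrite fe in fv.
  rewrite (ord_sat sm); last by rewrite eq_sym.
  by case: eqP => // <-.
by case: eqP => [->|//]; move: t2; clear; lia.
Qed.

Lemma packing_of_trim_map p f : star_map_le e k p ->
  (forall c, ord p c = t -> f c \in sats p c) ->
  packing_of (trim_map p f) =
  [set (if Defs.order s == t then (s.1, s.2 :\ f s.1) else s) | s in packing_of p].
Proof.
move=> smk fs; have [smk' satsE _] := trim_mapP smk fs.
have ordE c : (0 < ord (trim_map p f) c) = (0 < ord p c).
  rewrite /ord satsE; case: eqP => [ot|//].
  have := cardsD1 (f c) (sats p c); rewrite (fs _ ot) -/(ord p c) ot; move: t2; clear; lia.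
have stE c : starof (trim_map p f) c =
    (if Defs.order (starof p c) == t then (c, sats p c :\ f c) else starof p c).
  by rewrite /starof satsE order_starof; case: ifP.
apply/setP=> s; rewrite mem_packing_of; apply/andP/imsetP.
  move=> [s0 /eqP ->]; exists (starof p s.1); last exact: stE.
  by rewrite mem_packing_of -ordE s0 /=.
move=> [s']; rewrite mem_packing_of => /andP[s0 /eqP ->] ->; rewrite -stE /=.
by rewrite ordE s0.
Qed.

Lemma revise_max Q Q' : max_star_packing e k Q -> revise e k t Q Q' ->
  max_star_packing e k Q'.
Proof.
move=> [pkQ mx]; have [smk E] := map_of_packingP pkQ; rewrite -{1}E => rv.
have [F [p' [F' [uF F0 [cf lk] _ ->]]]] := revise_complete smk rv.
set p := map_of_packing Q in smk E rv F0 cf *.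
have [sm _] := smk.
have lE : unzip2 [seq (c, ord p' c) | c <- F'] = [seq ord p' c | c <- F'].
  by rewrite /unzip2 -map_comp.
have smk' : star_map_le e k p'.
  apply: (config_le smk cf) => [c /F0/(ord_gt0_center sm)//|].
  by rewrite lE; apply/allP => o /mapP[c /lk/andP[_ ?] ->].
split; first exact: packing_of_packing.
move=> Q1 /mx/leq_trans; apply; rewrite -E -(cov_covered sm) -(cov_covered smk'.1).
apply/subset_leq_card/subsetP=> v vp; case: (boolP (p v \in F)) => vF.
  apply: (config_covF cf vF); rewrite lE.
  by apply/allP => o /mapP[c /lk/andP[? _] ->].
by rewrite (config_cov sm cf vF).
Qed.

Lemma revise_loop_max Q Qs R : revise_loop e k t Q Qs R -> max_star_packing e k Q ->
  max_star_packing e k R /\ forall Q', ~ revise e k t R Q'.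
Proof.
elim=> {Q Qs R} [Q opt_ mx|Q Q' Qs R rv _ IH mx]; first by split.
exact/IH/(revise_max mx rv).
Qed.

Lemma rat_ratio (a b : nat) : a * (k * t.+1 + 1) <= (k * t.+2 + 1) * b ->
  (a%:R <= (1 + 1 / (t%:R + 1 + 1 / k%:R)) * b%:R :> rat)%R.
Proof.
move=> h; have k0 : (0 < k%:R :> rat)%R by rewrite ltr0n ltnW.
have X0 : (0 < (k * t.+1 + 1)%:R :> rat)%R by rewrite ltr0n addn1.
have -> : (1 + 1 / (t%:R + 1 + 1 / k%:R) = (k * t.+2 + 1)%:R / (k * t.+1 + 1)%:R :> rat)%R.
  have -> : (t%:R + 1 + 1 / k%:R = (k * t.+1 + 1)%:R / k%:R :> rat)%R.
    rewrite natrD natrM mulrDl -natr1 mulrAC mulfV ?mul1r //; exact: lt0r_neq0.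
  rewrite mul1r invf_div -[X in (X + _)%R](mulfV (lt0r_neq0 X0)) -mulrDl -natrD.
  by congr (_%:R / _)%R; rewrite mulnS; lia.
by rewrite mulrAC ler_pdivlMr // -!natrM ler_nat.
Qed.

Lemma approximation Qs P : local_search e k t Qs P ->
  star_packing_no e k t P /\
  ((opt e k t)%:R <= (1 + 1 / (t%:R + 1 + 1 / k%:R)) * #|covered P|%:R :> rat)%R.
Proof.
move=> [Q0 [R [mx0 loop [f [fs EP]]]]].
have [mx opt_] := revise_loop_max loop mx0.
have [smk ER] := map_of_packingP mx.1; set p := map_of_packing R in smk ER.
pose g c := f (starof p c).
have gs c : ord p c = t -> g c \in sats p c.
  move=> ct; apply: (fs (starof p c)) => //.
  by rewrite -ER mem_packing_of ct ltnW //= eqxx.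
have {}EP : P = packing_of (trim_map p g).
  rewrite (packing_of_trim_map smk gs) EP -ER; apply: eq_in_imset => s.
  by rewrite mem_packing_of => /andP[_ /eqP E]; rewrite /g -E.
have [smk' satsE covE] := trim_mapP smk gs.
rewrite -ER in mx opt_; have st := max_stuck e_sym e_irr k2 smk mx.
split.
  rewrite /star_packing_no EP packing_of_packing //=; apply/forallP=> s; apply/implyP.
  rewrite mem_packing_of => /andP[_ /eqP->]; rewrite order_starof /ord satsE.
  case: (eqVneq (ord p s.1) t) => [ot|//]; have := cardsD1 (g s.1) (sats p s.1).
  by rewrite (gs _ ot) -/(ord p _) ot; move: t2; clear; lia.
apply: rat_ratio; rewrite EP -(cov_covered smk'.1) covE.
rewrite cardsD (setIidPr _); last first.
  apply/subsetP=> v /imsetP[c]; rewrite inE => /eqP ct ->; rewrite inE.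
  by have := gs c ct; rewrite in_sats => /andP[/eqP-> _]; rewrite ct ltnW.
rewrite card_in_imset; last first.
  move=> c c'; rewrite !inE => /eqP ct /eqP c't E; have := gs c ct; have := gs c' c't.
  by rewrite -E !in_sats => /andP[/eqP-> _] /andP[/eqP-> _].
rewrite /opt; elim/big_rec: _ => [|O m pkO le]; first by rewrite mul0n.
rewrite maxnMl geq_max le andbT.
case/andP: pkO => /map_of_packingP[smq EO] /forallP no_t.
rewrite -{1}EO -(cov_covered smq.1); apply: (ratio_nat e_sym e_irr t2 tk smk st opt_ smq).
move=> v; apply/negP => /eqP vt.
have vO : starof (map_of_packing O) v \in packing_of (map_of_packing O).
  by rewrite mem_packing_of /= vt eqxx andbT ltnW.
rewrite EO in vO.
by have := no_t (starof (map_of_packing O) v); rewrite vO order_starof vt eqxx.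
Qed.

End Approximation.

(** * Bounded loop programs and their compilation *)

(* A language of bounded loops.  Its state consists of countably many arrays;
   array 0 holds the variables.  [XSum b x e] is the sum of [e] for [x] below
   the bound, [XFst b x e] the first [x] such that [e] is nonzero (or the bound
   if there is none); both leave the state unchanged. *)
Inductive bound := BN | BM.

Inductive ex :=
| XL of nat
| XB of bound
| XG of nat & ex
| XI of ex
| XA of ex & ex
| XS of ex & ex
| XSum of bound & nat & ex
| XFst of bound & nat & ex.

Inductive cmd :=
| CSkip
| CSet of nat & ex & ex
| CEmit of ex
| CSeq of cmd & cmd
| CIf of ex & cmd & cmd
| CFor of bound & nat & cmd.

Definition state := nat -> nat -> nat.

Definition upd (s : state) a i v : state :=
  fun a' i' => if a' == a then if i' == i then v else s a' i' else s a' i'.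

Section Semantics.
Variable inp : nat -> nat.

Definition bval b := match b with BN => inp 0 | BM => inp 1 end.

(** Input addresses are cut off explicitly, because in the compiled memory the arrays begin right
    after the input. *)
Fixpoint xeval (s : state) e : nat :=
  match e with
  | XL n => n
  | XB b => bval b
  | XG a i => s a (xeval s i)
  | XI i => if xeval s i < inp 1 + inp 1 + 2 then inp (xeval s i) else 0
  | XA e1 e2 => xeval s e1 + xeval s e2
  | XS e1 e2 => xeval s e1 - xeval s e2
  | XSum b x f => \sum_(0 <= i < bval b) xeval (upd s 0 x i) f
  | XFst b x f => find (fun i => xeval (upd s 0 x i) f != 0) (iota 0 (bval b))
  end.

Fixpoint run c (s : state) : state * seq nat :=
  match c with
  | CSkip => (s, [::])
  | CSet a i v => (upd s a (xeval s i) (xeval s v), [::])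
  | CEmit e => (s, [:: xeval s e])
  | CSeq c1 c2 =>
      let r1 := run c1 s in let r2 := run c2 r1.1 in (r2.1, r1.2 ++ r2.2)
  | CIf e c1 c2 => if xeval s e != 0 then run c1 s else run c2 s
  | CFor b x f =>
      foldl (fun r i => let r' := run f (upd r.1 0 x i) in (r'.1, r.2 ++ r'.2))
        (s, [::]) (iota 0 (bval b))
  end.
End Semantics.

(* [xdeg e a b] and [cdeg c a b] bound the loop nesting: they imply a cost of
   O(n^a m^b). *)
Fixpoint xdeg e a b : bool :=
  match e with
  | XL _ | XB _ => true
  | XG _ i | XI i => xdeg i a b
  | XA e1 e2 | XS e1 e2 => xdeg e1 a b && xdeg e2 a b
  | XSum BN _ f | XFst BN _ f => (0 < a) && xdeg f a.-1 b
  | XSum BM _ f | XFst BM _ f => (0 < b) && xdeg f a b.-1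
  end.

Fixpoint cdeg c a b : bool :=
  match c with
  | CSkip => true
  | CSet _ i v => xdeg i a b && xdeg v a b
  | CEmit e => xdeg e a b
  | CSeq c1 c2 => cdeg c1 a b && cdeg c2 a b
  | CIf e c1 c2 => [&& xdeg e a b, cdeg c1 a b & cdeg c2 a b]
  | CFor BN _ f => (0 < a) && cdeg f a.-1 b
  | CFor BM _ f => (0 < b) && cdeg f a b.-1
  end.

(* Entry [i] of array [a] is stored at [cell m a.+1 i], after the input; row 0
   holds the temporaries of the compiled program. *)
Definition cell m a i : nat := m + m + 2 + 2 ^ a * (i + i + 1).

(** A positive integer is a power of 2 times an odd number in only one way. *)
Lemma cell_inj m a i a' i' : cell m a i = cell m a' i' -> a = a' /\ i = i'.
Proof.
rewrite /cell => /addnI; elim: a a' => [|a IH] [|a'] E.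
- by split=> //; move: E; rewrite !mul1n; lia.
- by move: E; rewrite expnS mul1n -mulnA; lia.
- by move: E; rewrite expnS mul1n -mulnA; lia.
have /IH[-> ->//] : 2 ^ a * (i + i + 1) = 2 ^ a' * (i' + i' + 1).
by move: E; rewrite !expnS -!mulnA; lia.
Qed.

Lemma cell_neq_row m a i a' i' : a != a' -> cell m a i <> cell m a' i'.
Proof. by move=> /eqP N /cell_inj[]. Qed.

Lemma cell_input m a i : m + m + 2 <= cell m a i.
Proof. exact: leq_addr. Qed.

(** The machine does not multiply; a product by a constant is unrolled into additions. Its cost is
    constant since the array numbers are fixed by the program. *)
Definition emul c x := iter c (Add x) (Lit 0).
Definition base := Add (Add (Reg (Lit 1)) (Reg (Lit 1))) (Lit 2).
Definition cellx a i := Add base (emul (2 ^ a) (Add (Add i i) (Lit 1))).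
Definition tmp d := cellx 0 (Lit d).
Definition rtmp d := Reg (tmp d).
Definition breg b := Reg (Lit (match b with BN => 0 | BM => 1 end)).

Definition loop d b body :=
  Seq (Store (tmp d) (Lit 0))
      (While (Defs.Sub (breg b) (rtmp d)) (Seq body (Store (tmp d) (Add (rtmp d) (Lit 1))))).

(** Temporary [d] accumulates the result, [d.+1] is the counter, and [d.+2] saves the variable [x],
    restored at the end because expressions must not change the state. The body works from [d.+3]
    on. *)
Definition bind_loop d b x body :=
  Seq (Store (tmp d) (Lit 0))
  (Seq (Store (tmp d.+2) (Reg (cellx 1 (Lit x))))
  (Seq (loop d.+1 b (Seq (Store (cellx 1 (Lit x)) (rtmp d.+1)) body))
       (Store (cellx 1 (Lit x)) (rtmp d.+2)))).

Fixpoint compx d e : prog :=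
  match e with
  | XL n => Store (tmp d) (Lit n)
  | XB b => Store (tmp d) (breg b)
  | XG a i => Seq (compx d i) (Store (tmp d) (Reg (cellx a.+1 (rtmp d))))
  | XI i => Seq (compx d i) (If (Defs.Sub base (rtmp d)) (Store (tmp d) (Reg (rtmp d)))
                                                  (Store (tmp d) (Lit 0)))
  | XA e1 e2 => Seq (compx d e1) (Seq (compx d.+1 e2)
                  (Store (tmp d) (Add (rtmp d) (rtmp d.+1))))
  | XS e1 e2 => Seq (compx d e1) (Seq (compx d.+1 e2)
                  (Store (tmp d) (Defs.Sub (rtmp d) (rtmp d.+1))))
  | XSum b x f => bind_loop d b x
      (Seq (compx d.+3 f) (Store (tmp d) (Add (rtmp d) (rtmp d.+3))))
  | XFst b x f => bind_loop d b x
      (Seq (compx d.+3 f)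
        (If (rtmp d.+3) Skip
          (If (Defs.Sub (rtmp d.+1) (rtmp d)) Skip (Store (tmp d) (Add (rtmp d.+1) (Lit 1))))))
  end.

Fixpoint compc d c : prog :=
  match c with
  | CSkip => Skip
  | CSet a i v => Seq (compx d i) (Seq (compx d.+1 v) (Store (cellx a.+1 (rtmp d)) (rtmp d.+1)))
  | CEmit e => Seq (compx d e) (Emit (rtmp d))
  | CSeq c1 c2 => Seq (compc d c1) (compc d c2)
  | CIf e c1 c2 => Seq (compx d e) (If (rtmp d) (compc d c1) (compc d c2))
  | CFor b x f => loop d b (Seq (Store (cellx 1 (Lit x)) (rtmp d)) (compc d.+1 f))
  end.

(** A Hoare triple for total correctness with a bound on the cost. *)
Definition runs p mu (P : memory -> seq nat -> Prop) c : Prop :=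
  exists mu' out c', [/\ exec p mu mu' out c', c' <= c & P mu' out].

Section Runs.
Implicit Types (P Q : memory -> seq nat -> Prop).

Lemma runs_conseq p mu P Q c c' : runs p mu P c -> c <= c' ->
  (forall mu' o, P mu' o -> Q mu' o) -> runs p mu Q c'.
Proof.
move=> [mu' [o [c1 [h1 h2 h3]]]] cc h; exists mu', o, c1; split=> //; last exact: h.
exact: leq_trans cc.
Qed.

Lemma runs_skip mu P : P mu [::] -> runs Skip mu P 1.
Proof. by move=> h; exists mu, [::], 1; split=> //; constructor. Qed.

Lemma runs_store mu P a b : P (update mu (eval mu a) (eval mu b)) [::] ->
  runs (Store a b) mu P (ecost a + ecost b).+1.
Proof. by move=> h; do 3!eexists; split; [constructor| |exact: h]. Qed.

Lemma runs_emit mu P a : P mu [:: eval mu a] -> runs (Emit a) mu P (ecost a).+1.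
Proof. by move=> h; do 3!eexists; split; [constructor| |exact: h]. Qed.

Lemma runs_seq p q mu P Q c1 c2 : runs p mu P c1 ->
  (forall mu1 o1, P mu1 o1 -> runs q mu1 (fun mu2 o2 => Q mu2 (o1 ++ o2)) c2) ->
  runs (Seq p q) mu Q (c1 + c2).
Proof.
move=> [mu1 [o1 [d1 [x1 l1 h1]]]] /(_ _ _ h1)[mu2 [o2 [d2 [x2 l2 h2]]]].
by exists mu2, (o1 ++ o2), (d1 + d2); split=> //; [apply: exec_seq x1 x2|apply: leq_add].
Qed.

Lemma runs_if a p q mu P c : runs (if eval mu a != 0 then p else q) mu P c ->
  runs (If a p q) mu P (ecost a + c).+1.
Proof.
move=> [mu1 [o1 [d1 [x1 l1 h1]]]]; exists mu1, o1, (ecost a + d1).+1; split=> //.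
  exact: exec_if.
by rewrite ltnS leq_add2l.
Qed.

Lemma runs_while a body N (I : nat -> memory -> seq nat -> Prop) cb i mu o :
  (forall i mu o, I i mu o -> i <= N /\ eval mu a = N - i) ->
  (forall i mu o, i < N -> I i mu o ->
     runs body mu (fun mu' o' => I i.+1 mu' (o ++ o')) cb) ->
  I i mu o ->
  runs (While a body) mu (fun mu' o' => I N mu' (o ++ o'))
    ((N - i) * (ecost a + cb).+1 + (ecost a).+1).
Proof.
move=> Ia Ib; move E: (N - i) => k; elim: k i mu o E => [|k IH] i mu o E Ii.
  have [iN ea] := Ia _ _ _ Ii; exists mu, [::], (ecost a).+1; split=> //.
    by apply: exec_while_exit; rewrite ea.
  have -> : N = i by lia.
  by rewrite cats0.
have iN : i < N by lia.
have [_ ea] := Ia _ _ _ Ii.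
have [mu1 [o1 [c1 [x1 l1 h1]]]] := Ib _ _ _ iN Ii.
have [|mu2 [o2 [c2 [x2 l2 h2]]]] := IH i.+1 _ _ _ h1; first lia.
exists mu2, (o1 ++ o2), (ecost a + c1 + c2).+1; split=> //; last by rewrite catA.
  by apply: exec_while_loop x1 x2; rewrite ea; lia.
by rewrite mulSn; lia.
Qed.

End Runs.

Lemma eval_cellx mu m a i : mu 1 = m -> eval mu (cellx a i) = cell m a (eval mu i).
Proof.
move=> m1; rewrite /= m1 /cell; congr (_ + _).
rewrite /emul; move: (2 ^ a) => c; elim: c => [|c IH]; first by rewrite mul0n.
by rewrite iterS /= IH mulSn.
Qed.

Lemma eval_rtmp mu m d : mu 1 = m -> eval mu (rtmp d) = mu (cell m 0 d).
Proof. by move=> m1; rewrite -(eval_cellx 0 (Lit d) m1). Qed.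

Lemma update_same mu i v : update mu i v i = v.
Proof. by rewrite /update eqxx. Qed.

Lemma update_neq mu i v j : j <> i -> update mu i v j = mu j.
Proof. by move=> /eqP/negPf N; rewrite /update N. Qed.

Definition bix b := match b with BN => 0 | BM => 1 end.

Lemma runs_loop d b : exists K, forall body mu N m (I : nat -> memory -> seq nat -> Prop) cb,
  mu 1 = m ->
  (forall i mu o, I i mu o -> mu 1 = m /\ mu (bix b) = N) ->
  (forall i mu o, i < N -> I i mu o -> mu (cell m 0 d) = i ->
    runs body mu (fun mu' o' => [/\ mu' 1 = m, mu' (cell m 0 d) = i &
      I i.+1 (update mu' (cell m 0 d) i.+1) (o ++ o')]) cb) ->
  I 0 (update mu (cell m 0 d) 0) [::] ->
  runs (loop d b body) mu (I N) (K + N * (cb + K)).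
Proof.
pose a := Defs.Sub (breg b) (rtmp d).
exists (ecost (tmp d) + ecost (tmp d) + ecost a + ecost (Add (rtmp d) (Lit 1)) + 5).
move=> body mu N m I cb m1 I1 Ib I0; rewrite /loop -/a.
pose J i mu o := [/\ I i mu o, mu (cell m 0 d) = i & i <= N].
have m1' : update mu (cell m 0 d) 0 1 = m.
  by rewrite update_neq // => E; have := cell_input m 0 d; rewrite -E; lia.
apply: (runs_conseq (c := (ecost (tmp d) + ecost (Lit 0)).+1 +
   ((N - 0) * (ecost a + (cb + (ecost (tmp d) + ecost (Add (rtmp d) (Lit 1))).+1)).+1 + (ecost a).+1))
   (P := fun mu' o => J N mu' o)); first last.
- by move=> mu' o [].
- rewrite subn0 /=; set x := ecost (tmp d); set y := ecost a; set z := _ + _.+2.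
  rewrite [in X in _ <= X]mulnDr; lia.
apply: (runs_seq (P := fun mu1 o1 => mu1 = update mu (cell m 0 d) 0 /\ o1 = [::])).
  by apply: runs_store; rewrite (eval_cellx _ _ m1).
move=> mu1 o1 [-> ->].
have := @runs_while a _ N J _ 0 (update mu (cell m 0 d) 0) [::]; apply.
- move=> i mu2 o2 [/I1[E1 E2] E3 iN]; split=> //.
  have -> : eval mu2 a = mu2 (bix b) - eval mu2 (rtmp d) by rewrite /a; case: (b).
  by rewrite (eval_rtmp _ E1) E3 E2.
- move=> i mu2 o2 iN [Ii E3 _].
  apply: (runs_seq (Ib _ _ _ iN Ii E3)) => mu3 o3 [F1 F2 F3].
  apply: runs_store; rewrite cats0 (eval_cellx _ _ F1).
  have -> : eval mu3 (Add (rtmp d) (Lit 1)) = eval mu3 (rtmp d) + 1 by [].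
  rewrite (eval_rtmp _ F1) F2 addn1.
  by split; rewrite ?update_same.
by split; rewrite ?update_same.
Qed.

Section Compile.
Variable inp : nat -> nat.
Let m := inp 1.
Implicit Types (s : state) (mu : memory).

Definition represents s mu : Prop :=
  (forall i, i < m + m + 2 -> mu i = inp i) /\
  (forall a i, mu (cell m a.+1 i) = s a i).

(** The frame condition of compiled expressions: the temporaries below [d] hold pending intermediate
    results and must survive. *)
Definition agree d mu mu' : Prop :=
  forall y, (forall d', d <= d' -> y <> cell m 0 d') -> mu' y = mu y.

Lemma agree_trans d mu1 mu2 mu3 : agree d mu1 mu2 -> agree d mu2 mu3 -> agree d mu1 mu3.
Proof. by move=> h1 h2 y yd; rewrite h2 // h1. Qed.

Lemma agree_leq d d' mu1 mu2 : d <= d' -> agree d' mu1 mu2 -> agree d mu1 mu2.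
Proof. by move=> dd' h y yd; apply: h => d1 h1; apply: yd; apply: leq_trans h1. Qed.

Lemma agree_update d d' mu v : d <= d' -> agree d mu (update mu (cell m 0 d') v).
Proof. by move=> dd' y yd; apply: update_neq; apply: yd. Qed.

Lemma agree_tmp d mu mu' d' : agree d mu mu' -> d' < d -> mu' (cell m 0 d') = mu (cell m 0 d').
Proof. by move=> h dd; apply: h => d1 h1 /cell_inj[_ E]; lia. Qed.

Lemma agree_cell d mu mu' a i : agree d mu mu' -> mu' (cell m a.+1 i) = mu (cell m a.+1 i).
Proof. by move=> h; apply: h => d1 h1; apply: cell_neq_row. Qed.

Lemma agree_input d mu mu' i : agree d mu mu' -> i < m + m + 2 -> mu' i = mu i.
Proof. by move=> h im; apply: h => d1 h1 E; have := cell_input m 0 d1; lia. Qed.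

Lemma represents_agree s d mu mu' : agree d mu mu' -> represents s mu -> represents s mu'.
Proof.
move=> h [h1 h2]; split=> [i im|a i]; first by rewrite (agree_input h) // h1.
by rewrite (agree_cell _ _ h).
Qed.

Lemma represents_update s mu a i v : represents s mu ->
  represents (upd s a i v) (update mu (cell m a.+1 i) v).
Proof.
move=> [h1 h2]; split=> [j jm|a' i'].
  by rewrite update_neq ?h1 // => E; have := cell_input m a.+1 i; lia.
rewrite /upd; case: (eqVneq a' a) => [->|N]; last first.
  by rewrite update_neq //; apply: cell_neq_row.
case: (eqVneq i' i) => [->|N]; first exact: update_same.
by rewrite update_neq // => /cell_inj[_ E]; rewrite E eqxx in N.
Qed.

Lemma represents1 s mu : represents s mu -> mu 1 = m.
Proof. by move=> [h _]; rewrite h //; lia. Qed.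

Lemma represents_bound s mu b : represents s mu -> mu (bix b) = bval inp b.
Proof. by move=> [h _]; case: b; rewrite /= h //; lia. Qed.

Definition computes p d s v mu c := runs p mu
  (fun mu' o => [/\ o = [::], mu' (cell m 0 d) = v & agree d mu mu']) c.

Lemma computes_store d a mu s v : represents s mu -> eval mu a = v ->
  computes (Store (tmp d) a) d s v mu (ecost (tmp d) + ecost a).+1.
Proof.
move=> rs E; apply: runs_store; rewrite (eval_cellx _ _ (represents1 rs)) E.
by split; rewrite ?update_same //; apply: agree_update.
Qed.

Lemma computes_seq p p' d s v w mu c c' : computes p d s v mu c ->
  (forall mu', agree d mu mu' -> mu' (cell m 0 d) = v -> computes p' d s w mu' c') ->
  computes (Seq p p') d s w mu (c + c').
Proof.
move=> h1 h2; apply: runs_seq h1 _ => mu1 o1 [-> E A].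
apply: (runs_conseq (h2 _ A E) (leqnn _)) => mu2 o2 [-> E2 A2]; split=> //.
exact: agree_trans A A2.
Qed.

Definition size2 a b := inp 0 ^ a * inp 1 ^ b.

Hypotheses (n0 : 0 < inp 0) (m0 : 0 < inp 1).

Lemma size2_gt0 a b : 0 < size2 a b.
Proof. by rewrite muln_gt0 !expn_gt0 n0 m0. Qed.

End Compile.

Lemma loop_degree (bd : bound) a b (deg : nat -> nat -> bool) :
  match bd with BN => (0 < a) && deg a.-1 b | BM => (0 < b) && deg a b.-1 end ->
  exists a' b', deg a' b' /\
    forall inp, bval inp bd * size2 inp a' b' = size2 inp a b.
Proof.
case: bd => /andP[h1 h2]; [exists a.-1, b|exists a, b.-1]; split=> // inp.
  by rewrite /size2 mulnA /= -expnS prednK.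
by rewrite /size2 mulnCA /= -expnS prednK.
Qed.

(** As all sizes are positive, overheads occurring once or once per iteration are absorbed in the
    product, with a constant that does not depend on the input. *)
Lemma loop_cost K C c N S S' : 0 < S -> N * S' = S ->
  K + N * (C * S' + c + K) <= (K + C + c + K) * S.
Proof.
move=> S0 E; have S'0 : 0 < S' by case: S' E S0 => // <-; rewrite muln0.
have NS : N <= S by rewrite -E leq_pmulr.
rewrite !mulnDr mulnCA E !mulnDl -!addnA leq_add ?leq_pmulr // leq_add2l.
by rewrite leq_add // mulnC leq_mul2l NS orbT.
Qed.

Lemma cell_neq_tmp m d d' : d != d' -> cell m 0 d <> cell m 0 d'.
Proof. by move=> /eqP N /cell_inj[]. Qed.

(** The sum and the search for a first index differ only in the successive values [acc] of the
    accumulator, so one invariant serves both. *)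
Lemma bind_loop_ok d bd x : exists K, forall inp body s mu (acc : nat -> nat) cb,
  let m := inp 1 in represents inp s mu -> acc 0 = 0 ->
  (forall i mu1, i < bval inp bd -> represents inp (upd s 0 x i) mu1 ->
     mu1 (cell m 0 d) = acc i -> mu1 (cell m 0 d.+1) = i ->
     runs body mu1 (fun mu2 o => [/\ o = [::], mu2 (cell m 0 d) = acc i.+1 &
        forall y, (forall d', d.+3 <= d' -> y <> cell m 0 d') -> y <> cell m 0 d ->
          mu2 y = mu1 y]) cb) ->
  computes inp (bind_loop d bd x body) d s (acc (bval inp bd)) mu (K + bval inp bd * (cb + K)).
Proof.
have [K HK] := runs_loop d.+1 bd.
pose vx := cellx 1 (Lit x).
exists (K + (ecost (tmp d) + 2) + (ecost (tmp d.+2) + ecost (Reg vx)).+1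
   + (ecost vx + ecost (rtmp d.+2)).+1 + (ecost vx + ecost (rtmp d.+1)).+1).
move=> inp body s mu acc cb m rs a0 Hb; rewrite /bind_loop -/vx.
have evx mu1 : mu1 1 = m -> eval mu1 vx = cell m 1 x by move=> h; rewrite (eval_cellx _ _ h).
pose rest mu' := forall y, (forall d', d <= d' -> y <> cell m 0 d') -> y <> cell m 1 x -> mu' y = mu y.
have rest1 mu' y : rest mu' -> y < m + m + 2 -> mu' y = mu y.
  by move=> h ym; apply: h => [d' _|] E; [have := cell_input m 0 d'|have := cell_input m 1 x]; lia.
pose I i (mu' : memory) (o : seq nat) :=
  [/\ o = [::], mu' (cell m 0 d) = acc i, mu' (cell m 0 d.+2) = s 0 x & rest mu'].
have m1 := represents1 rs.
apply: (runs_conseq (c := (ecost (tmp d) + ecost (Lit 0)).+1 +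
  ((ecost (tmp d.+2) + ecost (Reg vx)).+1 +
  ((K + bval inp bd * ((ecost vx + ecost (rtmp d.+1)).+1 + cb + K)) + (ecost vx + ecost (rtmp d.+2)).+1)))); first last.
- by move=> mu' o; apply.
- set K' := K + _ + _ + _ + _; have L1 : ecost (Lit 0) = 1 by [].
  have hN : bval inp bd * ((ecost vx + ecost (rtmp d.+1)).+1 + cb + K) <= bval inp bd * (cb + K').
    by rewrite leq_mul2l; apply/orP; right; rewrite /K'; clear; lia.
  by move: hN L1; rewrite {2}/K'; clear; lia.
apply: (runs_seq (P := fun mu1 o1 => o1 = [::] /\ mu1 = update mu (cell m 0 d) 0)).
  by apply: runs_store; rewrite (eval_cellx _ _ m1).
move=> mu1 o1 [-> Emu1]; have A1 : agree inp d mu mu1 by rewrite Emu1; apply: agree_update.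
have rs1 := represents_agree A1 rs; have m11 := represents1 rs1.
apply: (runs_seq (P := fun mu2 o2 => o2 = [::] /\ mu2 = update mu1 (cell m 0 d.+2) (s 0 x))).
  apply: runs_store; rewrite (eval_cellx _ _ m11); split=> //; congr update.
  by rewrite -(rs1.2 0 x) -(evx _ m11).
move=> mu2 o2 [-> Emu2]; have A2 : agree inp d mu1 mu2 by rewrite Emu2; apply: agree_update; lia.
have {}A2 := agree_trans A1 A2.
have rs2 := represents_agree A2 rs; have m12 := represents1 rs2.
apply: (runs_seq (P := I (bval inp bd))); last first.
  move=> mu3 o3 [-> E1 E2 R]; apply: runs_store.
  have m13 : mu3 1 = m by rewrite rest1 ?m1 //; lia.
  rewrite (evx _ m13) (eval_rtmp _ m13) E2; split=> //.
    by rewrite update_neq //; apply: cell_neq_row.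
  move=> y yd; case: (eqVneq y (cell m 1 x)) => [->|/eqP N]; last by rewrite update_neq ?R.
  by rewrite update_same (rs.2 0 x).
apply: (HK _ _ _ m) => //=.
- move=> i mu' o [_ _ _ R]; split; first by rewrite (rest1 _ _ R) ?m1 //; lia.
  by rewrite (rest1 _ _ R) ?(represents_bound _ rs) //; case: (bd); rewrite /=; lia.
- move=> i mu' o iN [-> E1 E2 R] Ei.
  have m1' : mu' 1 = m by rewrite rest1 ?m1 //; lia.
  have rs' : represents inp (upd s 0 x i) (update mu' (cell m 1 x) i).
    split=> [j jm|a j].
      rewrite update_neq; first by rewrite rest1 ?rs.1.
      by move=> E; have := cell_input m 1 x; lia.
    rewrite /upd; case: (eqVneq a 0) => [->|aN].
      case: (eqVneq j x) => [->|jN]; first exact: update_same.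
      rewrite update_neq ?R ?rs.2 //.
      + by move=> d' _; apply: cell_neq_row.
      + by move=> /cell_inj[_ E]; rewrite E eqxx in jN.
      by move=> /cell_inj[_ E]; rewrite E eqxx in jN.
    rewrite update_neq ?R ?rs.2 //.
    + by move=> d' _; apply: cell_neq_row.
    + by apply: cell_neq_row; rewrite eqSS.
    by apply: cell_neq_row; rewrite eqSS.
  apply: (runs_seq (P := fun mu4 o4 => o4 = [::] /\ mu4 = update mu' (cell m 1 x) i)).
    by apply: runs_store; rewrite (evx _ m1') (eval_rtmp _ m1') Ei.
  move=> mu4 o4 [-> Emu4]; rewrite -Emu4 in rs'.
  apply: (runs_conseq (Hb i mu4 iN rs' _ _) (leqnn _)).
  + by rewrite Emu4 update_neq //; apply: cell_neq_row.
  + by rewrite Emu4 update_neq //; apply: cell_neq_row.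
  move=> mu5 o5 [-> F1 F2].
  have F3 d' : d' < d.+3 -> d' != d -> mu5 (cell m 0 d') = mu' (cell m 0 d').
    move=> h1 h2; rewrite F2; first by rewrite Emu4 update_neq //; apply: cell_neq_row.
      by move=> d2 h; apply: cell_neq_tmp; lia.
    exact: cell_neq_tmp.
  have F4 y : y < m + m + 2 -> mu5 y = mu' y.
    move=> ym; have N a' i' : y <> cell m a' i' by move=> E; have := cell_input m a' i'; lia.
    by rewrite F2 // Emu4 update_neq.
  split; [by rewrite F4 //; lia|by rewrite F3 //; lia|split=> //].
  + by rewrite update_neq //; apply: cell_neq_tmp; lia.
  + rewrite update_neq; last by apply: cell_neq_tmp; lia.
    by rewrite F3 //; lia.
  move=> y yd yx; rewrite update_neq; last by apply: yd.
  rewrite F2 ?Emu4 ?update_neq ?R //; last exact: yd.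
  by move=> d' h; apply: yd; lia.
split=> //.
- rewrite update_neq; last by apply: cell_neq_tmp; lia.
  rewrite Emu2 update_neq; last by apply: cell_neq_tmp; lia.
  by rewrite Emu1 update_same a0.
- rewrite update_neq; last by apply: cell_neq_tmp; lia.
  by rewrite Emu2 update_same.
move=> y yd yx; rewrite update_neq; last by apply: yd.
exact: A2.
Qed.

Definition compiles d e a b : Prop := exists C, forall inp s mu,
  0 < inp 0 -> 0 < inp 1 -> represents inp s mu ->
  computes inp (compx d e) d s (xeval inp s e) mu (C * size2 inp a b).

Lemma computes_conseq inp p d s v w mu c c' : computes inp p d s v mu c ->
  v = w -> c <= c' -> computes inp p d s w mu c'.
Proof. by move=> h <- cc; apply: (runs_conseq h cc). Qed.

Lemma compx_ok e d a b : xdeg e a b -> compiles d e a b.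
Proof.
elim: e d a b => [n|bd|ar i IH|i IH|e1 IH1 e2 IH2|e1 IH1 e2 IH2|bd x f IH|bd x f IH] d a b /=.
- move=> _; exists (ecost (tmp d) + ecost (Lit n)).+1 => inp s mu n0 m0 rs.
  have H := computes_store d rs (erefl (eval mu (Lit n))).
  by apply: (computes_conseq H) => //; rewrite leq_pmulr // size2_gt0.
- move=> _; exists (ecost (tmp d) + ecost (breg bd)).+1 => inp s mu n0 m0 rs.
  have H := computes_store d rs (erefl (eval mu (breg bd))).
  apply: (computes_conseq H); last by rewrite leq_pmulr // size2_gt0.
  by rewrite -[RHS](represents_bound bd rs); case: (bd).
- move=> /(IH d)[C HC]; pose r := Reg (cellx ar.+1 (rtmp d)).
  exists (C + (ecost (tmp d) + ecost r).+1) => inp s mu n0 m0 rs.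
  apply: (computes_conseq _ (erefl _) (c := C * size2 inp a b + (ecost (tmp d) + ecost r).+1)).
    apply: (computes_seq (HC inp s mu n0 m0 rs)) => mu' A E.
    have rs' := represents_agree A rs; apply: computes_store => //.
    have m1 := represents1 rs'.
    have -> : eval mu' r = mu' (eval mu' (cellx ar.+1 (rtmp d))) by [].
    by rewrite (eval_cellx _ _ m1) rs'.2 (eval_rtmp _ m1) E.
  by rewrite mulnDl leq_add2l leq_pmulr // size2_gt0.
- move=> /(IH d)[C HC].
  pose K := (ecost (Defs.Sub base (rtmp d)) + ((ecost (tmp d) + ecost (Reg (rtmp d))).+1 + (ecost (tmp d) + ecost (Lit 0)).+1)).+1.
  exists (C + K) => inp s mu n0 m0 rs.
  apply: (computes_conseq _ (erefl _) (c := C * size2 inp a b + K)).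
    apply: (computes_seq (HC inp s mu n0 m0 rs)) => mu' A E.
    have rs' := represents_agree A rs; have m1 := represents1 rs'.
    apply: runs_if; have -> : eval mu' (Defs.Sub base (rtmp d)) =
      (mu' 1 + mu' 1 + 2) - eval mu' (rtmp d) by [].
    rewrite m1 (eval_rtmp _ m1) E subn_eq0 -ltnNge; set j := xeval inp s i in E *.
    have -> : xeval inp s (XI i) = if j < inp 1 + inp 1 + 2 then inp j else 0 by [].
    case: ltnP => h.
      have H := computes_store d rs' (erefl (eval mu' (Reg (rtmp d)))).
      apply: (runs_conseq H); first exact: leq_addr.
      move=> mu2 o2 [-> E2 A2]; split=> //; rewrite E2.
      have -> : eval mu' (Reg (rtmp d)) = mu' (eval mu' (rtmp d)) by [].
      by rewrite (eval_rtmp _ m1) E rs'.1.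
    have H := computes_store d rs' (erefl (eval mu' (Lit 0))).
    by apply: (runs_conseq H); first exact: leq_addl.
  by rewrite mulnDl leq_add2l leq_pmulr // size2_gt0.
- move=> /andP[/(IH1 d)[C1 H1] /(IH2 d.+1)[C2 H2]].
  pose r := Add (rtmp d) (rtmp d.+1).
  exists (C1 + (C2 + (ecost (tmp d) + ecost r).+1)) => inp s mu n0 m0 rs.
  apply: (computes_conseq _ (erefl _) (c := C1 * size2 inp a b + (C2 * size2 inp a b + (ecost (tmp d) + ecost r).+1))).
    apply: (computes_seq (H1 inp s mu n0 m0 rs)) => mu' A E.
    have rs' := represents_agree A rs.
    apply: (runs_seq (H2 inp s mu' n0 m0 rs')) => mu2 o2 [-> E2 A2].
    have rs2 := represents_agree A2 rs'; have m1 := represents1 rs2.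
    have H := computes_store d rs2 (erefl (eval mu2 r)).
    apply: (runs_conseq H (leqnn _)) => mu3 o3 [-> F A3].
    split=> //; last by apply: agree_trans A3; apply: agree_leq A2.
    rewrite F; have -> : eval mu2 r = eval mu2 (rtmp d) + eval mu2 (rtmp d.+1) by [].
    by rewrite !(eval_rtmp _ m1) E2 (agree_tmp A2) // E.
  by rewrite !mulnDl !leq_add2l leq_pmulr // size2_gt0.
- move=> /andP[/(IH1 d)[C1 H1] /(IH2 d.+1)[C2 H2]].
  pose r := Defs.Sub (rtmp d) (rtmp d.+1).
  exists (C1 + (C2 + (ecost (tmp d) + ecost r).+1)) => inp s mu n0 m0 rs.
  apply: (computes_conseq _ (erefl _) (c := C1 * size2 inp a b + (C2 * size2 inp a b + (ecost (tmp d) + ecost r).+1))).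
    apply: (computes_seq (H1 inp s mu n0 m0 rs)) => mu' A E.
    have rs' := represents_agree A rs.
    apply: (runs_seq (H2 inp s mu' n0 m0 rs')) => mu2 o2 [-> E2 A2].
    have rs2 := represents_agree A2 rs'; have m1 := represents1 rs2.
    have H := computes_store d rs2 (erefl (eval mu2 r)).
    apply: (runs_conseq H (leqnn _)) => mu3 o3 [-> F A3].
    split=> //; last by apply: agree_trans A3; apply: agree_leq A2.
    rewrite F; have -> : eval mu2 r = eval mu2 (rtmp d) - eval mu2 (rtmp d.+1) by [].
    by rewrite !(eval_rtmp _ m1) E2 (agree_tmp A2) // E.
  by rewrite !mulnDl !leq_add2l leq_pmulr // size2_gt0.
- move=> /(@loop_degree bd a b (xdeg f))[a' [b' [dg hS]]].
  have [C HC] := IH d.+3 _ _ dg.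
  have [K HK] := bind_loop_ok d bd x.
  pose r := Add (rtmp d) (rtmp d.+3); pose c := (ecost (tmp d) + ecost r).+1.
  exists (K + C + c + K) => inp s mu n0 m0 rs.
  pose acc j := \sum_(0 <= i < j) xeval inp (upd s 0 x i) f.
  apply: (@computes_conseq inp _ d s (acc (bval inp bd)) _ mu _ _ _ _
    (loop_cost K C c (size2_gt0 n0 m0 a b) (hS inp))); last by [].
  apply: HK => //; first by rewrite /acc big_geq.
  move=> i mu1 iN rs1 E1 E2.
  apply: (runs_seq (HC inp _ _ n0 m0 rs1)) => mu2 o2 [-> F A].
  have rs2 := represents_agree A rs1; have m1 := represents1 rs2.
  apply: runs_store; rewrite (eval_cellx _ _ m1).
  split=> //.
    rewrite update_same; have -> : eval mu2 r = eval mu2 (rtmp d) + eval mu2 (rtmp d.+3) by [].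
    rewrite !(eval_rtmp _ m1) F (agree_tmp A) ?E1 /acc; last by lia.
    by rewrite big_nat_recr.
  by move=> y yd y0; rewrite update_neq // A.
- move=> /(@loop_degree bd a b (xdeg f))[a' [b' [dg hS]]].
  have [C HC] := IH d.+3 _ _ dg.
  have [K HK] := bind_loop_ok d bd x.
  pose r := Defs.Sub (rtmp d.+1) (rtmp d); pose r1 := Add (rtmp d.+1) (Lit 1).
  pose c := (ecost (rtmp d.+3) + (1 + (ecost r + (1 + (ecost (tmp d) + ecost r1).+1)).+1)).+1.
  exists (K + C + c + K) => inp s mu n0 m0 rs.
  pose P j := xeval inp (upd s 0 x j) f != 0.
  pose acc j := find P (iota 0 j).
  (* As long as nothing is found the accumulator equals the counter; a success leaves it there and a
     failure advances it. *)
  have accS j : acc j.+1 = if acc j < j then acc j else if P j then j else j.+1.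
    rewrite /acc -addn1 iotaD find_cat has_find size_iota /= add0n.
    by case: ltnP => // _; case: (P j); rewrite ?addn0.
  have acc_le j : acc j <= j by have := find_size P (iota 0 j); rewrite size_iota.
  apply: (@computes_conseq inp _ d s (acc (bval inp bd)) _ mu _ _ _ _
    (loop_cost K C c (size2_gt0 n0 m0 a b) (hS inp))); last by [].
  apply: HK => // i mu1 iN rs1 E1 E2.
  apply: (runs_seq (HC inp _ _ n0 m0 rs1)) => mu2 o2 [-> F A].
  have rs2 := represents_agree A rs1; have m1 := represents1 rs2.
  have F1 : mu2 (cell (inp 1) 0 d) = acc i by rewrite (agree_tmp A) //; lia.
  have F2 : mu2 (cell (inp 1) 0 d.+1) = i by rewrite (agree_tmp A) //; lia.
  have agr y : (forall d', d.+2 < d' -> y <> cell (inp 1) 0 d') -> mu2 y = mu1 y by exact: A.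
  apply: runs_if; rewrite (eval_rtmp _ m1) F -/(P i).
  case: ifPn => Pi.
    apply: (runs_conseq (runs_skip _)); [|by []|by move=> ? ? h; exact: h].
    split=> //; last by move=> y yd _; exact: agr.
    by rewrite F1 accS Pi; case: ltnP (acc_le i) => // h1 h2; apply/eqP; rewrite eqn_leq h1 h2.
  apply: (runs_conseq (c := (ecost r + (1 + (ecost (tmp d) + ecost r1).+1)).+1) _ (leq_addl _ _));
    last by move=> ? ? h; exact: h.
  apply: runs_if; have -> : eval mu2 r = eval mu2 (rtmp d.+1) - eval mu2 (rtmp d) by [].
  rewrite !(eval_rtmp _ m1) F1 F2 subn_eq0 -ltnNge; case: ltnP => h.
    apply: (runs_conseq (runs_skip _)); [|by []|by move=> ? ? h'; exact: h'].
    split=> //; first by rewrite accS h.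
    by move=> y yd _; exact: agr.
  apply: (runs_conseq (runs_store _) (leq_addl _ _)); last by move=> ? ? h'; exact: h'.
  rewrite (eval_cellx _ _ m1); split=> //.
    have -> : eval mu2 r1 = eval mu2 (rtmp d.+1) + 1 by [].
    by rewrite update_same (eval_rtmp _ m1) F2 accS ltnNge h (negPf Pi) addn1.
  by move=> y yd y0; rewrite update_neq // agr.
Qed.

Definition ccompiles d c a b : Prop := exists C, forall inp s mu,
  0 < inp 0 -> 0 < inp 1 -> represents inp s mu ->
  runs (compc d c) mu (fun mu' o => [/\ represents inp (run inp c s).1 mu',
      o = (run inp c s).2 &
      forall d', d' < d -> mu' (cell (inp 1) 0 d') = mu (cell (inp 1) 0 d')])
    (C * size2 inp a b).

Lemma compc_ok c d a b : cdeg c a b -> ccompiles d c a b.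
Proof.
elim: c d a b => [|ar i v|e|c1 IH1 c2 IH2|e c1 IH1 c2 IH2|bd x f IH] d a b.
- move=> _; exists 1 => inp s mu n0 m0 rs.
  apply: (runs_conseq (runs_skip _)); [|by rewrite mul1n size2_gt0|by move=> ? ? h; exact: h].
  by split.
- move=> /andP[/(compx_ok d)[C1 H1] /(compx_ok d.+1)[C2 H2]].
  pose r := cellx ar.+1 (rtmp d).
  exists (C1 + (C2 + (ecost r + ecost (rtmp d.+1)).+1)) => inp s mu n0 m0 rs.
  apply: (runs_conseq (c := C1 * size2 inp a b + (C2 * size2 inp a b + (ecost r + ecost (rtmp d.+1)).+1)));
    [|by rewrite !mulnDl !leq_add2l leq_pmulr // size2_gt0|by move=> ? ? h; exact: h].
  apply: (runs_seq (H1 inp s mu n0 m0 rs)) => mu1 o1 [-> E1 A1].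
  have rs1 := represents_agree A1 rs.
  apply: (runs_seq (H2 inp s mu1 n0 m0 rs1)) => mu2 o2 [-> E2 A2].
  have rs2 := represents_agree A2 rs1; have m1 := represents1 rs2.
  apply: runs_store; rewrite (eval_cellx _ _ m1) !(eval_rtmp _ m1) E2 (agree_tmp A2) // E1.
  split=> //=; first exact: represents_update.
  move=> d' dd; rewrite update_neq; last exact: cell_neq_row.
  by rewrite (agree_tmp A2) ?(agree_tmp A1) // ltnW.
- move=> /(compx_ok d)[C1 H1].
  exists (C1 + (ecost (rtmp d)).+1) => inp s mu n0 m0 rs.
  apply: (runs_conseq (c := C1 * size2 inp a b + (ecost (rtmp d)).+1));
    [|by rewrite !mulnDl !leq_add2l leq_pmulr // size2_gt0|by move=> ? ? h; exact: h].
  apply: (runs_seq (H1 inp s mu n0 m0 rs)) => mu1 o1 [-> E1 A1].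
  have rs1 := represents_agree A1 rs; have m1 := represents1 rs1.
  apply: runs_emit; rewrite (eval_rtmp _ m1) E1; split=> // d' dd.
  exact: agree_tmp A1 dd.
- move=> /andP[/(IH1 d)[C1 H1] /(IH2 d)[C2 H2]].
  exists (C1 + C2) => inp s mu n0 m0 rs; rewrite mulnDl.
  apply: (runs_seq (H1 inp s mu n0 m0 rs)) => mu1 o1 [rs1 -> A1].
  apply: (runs_conseq (H2 inp _ mu1 n0 m0 rs1) (leqnn _)) => mu2 o2 [rs2 -> A2].
  by split=> // d' dd; rewrite A2 ?A1.
- move=> /and3P[/(compx_ok d)[C0 H0] /(IH1 d)[C1 H1] /(IH2 d)[C2 H2]].
  exists (C0 + ((ecost (rtmp d)).+1 + (C1 + C2))) => inp s mu n0 m0 rs.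
  have S0 := size2_gt0 n0 m0 a b.
  apply: (runs_conseq (c := C0 * size2 inp a b + (ecost (rtmp d) + (C1 + C2) * size2 inp a b).+1));
    [| |by move=> ? ? h; exact: h]; last first.
    by rewrite !mulnDl !leq_add2l -addSn leq_add2r leq_pmulr.
  apply: (runs_seq (H0 inp s mu n0 m0 rs)) => mu1 o1 [-> E1 A1].
  have rs1 := represents_agree A1 rs; have m1 := represents1 rs1.
  apply: runs_if; rewrite (eval_rtmp _ m1) E1 /=.
  case: ifP => _.
    apply: (runs_conseq (H1 inp s mu1 n0 m0 rs1)); first by rewrite leq_mul2r leq_addr orbT.
    by move=> mu2 o2 [rs2 -> A2]; split=> // d' dd; rewrite A2 // (agree_tmp A1).
  apply: (runs_conseq (H2 inp s mu1 n0 m0 rs1)); first by rewrite leq_mul2r leq_addl orbT.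
  by move=> mu2 o2 [rs2 -> A2]; split=> // d' dd; rewrite A2 // (agree_tmp A1).
move=> /(@loop_degree bd a b (cdeg f))[a' [b' [dg hS]]].
have [C HC] := IH d.+1 _ _ dg; have [K HK] := runs_loop d bd.
pose vx := cellx 1 (Lit x); pose c := (ecost vx + ecost (rtmp d)).+1.
exists (K + C + c + K) => inp s mu n0 m0 rs; have m1 := represents1 rs.
pose g (r : state * seq nat) i :=
  let r' := run inp f (upd r.1 0 x i) in (r'.1, r.2 ++ r'.2).
pose acc j := foldl g (s, [::]) (iota 0 j).
have accS j : acc j.+1 = g (acc j) j by rewrite /acc -addn1 iotaD foldl_cat add0n.
pose I i (mu' : memory) (o : seq nat) := [/\ represents inp (acc i).1 mu', o = (acc i).2 &
  forall d', d' < d -> mu' (cell (inp 1) 0 d') = mu (cell (inp 1) 0 d')].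
apply: (runs_conseq _ (loop_cost K C c (size2_gt0 n0 m0 a b) (hS inp))); last first.
  by move=> mu' o h; exact: h.
rewrite [C * _ + c]addnC.
apply: (HK _ _ _ (inp 1) I) => //.
- move=> i mu' o [rs' _ _]; split; first exact: represents1 rs'.
  exact: represents_bound rs'.
- move=> i mu1 o iN [rs1 -> A1] Ei; have m11 := represents1 rs1.
  apply: (runs_seq (P := fun mu4 o4 => o4 = [::] /\ mu4 = update mu1 (cell (inp 1) 1 x) i)).
    by apply: runs_store; rewrite (eval_cellx _ _ m11) (eval_rtmp _ m11) Ei.
  move=> mu4 o4 [-> Emu4].
  have rs4 : represents inp (upd (acc i).1 0 x i) mu4 by rewrite Emu4; apply: represents_update.
  apply: (runs_conseq (HC inp _ mu4 n0 m0 rs4) (leqnn _)) => mu5 o5 [rs5 -> A5].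
  have E4 d' : mu4 (cell (inp 1) 0 d') = mu1 (cell (inp 1) 0 d').
    by rewrite Emu4 update_neq //; apply: cell_neq_row.
  split; first exact: represents1 rs5.
    by rewrite A5 // E4.
  have A6 : agree inp d mu5 (update mu5 (cell (inp 1) 0 d) i.+1) by apply: agree_update.
  split; rewrite ?accS //=; first exact: represents_agree A6 rs5.
  by move=> d' dd; rewrite (agree_tmp A6 dd) A5 ?E4 ?A1 // ltnW.
have A6 : agree inp d mu (update mu (cell (inp 1) 0 d) 0) by apply: agree_update.
split=> //; first exact: represents_agree A6 rs.
by move=> d' dd; rewrite (agree_tmp A6 dd).
Qed.

(** * Programs on star maps *)

(* Array 1 holds the star map and array 2 the orders; in array 3, a positive
   entry is the first round at which the vertex is in [release], and array 4
   marks the vertices whose neighbours are released next.  Entry [v] of array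
   [j.+5] is the [j]-th satellite of [v]. *)
Definition xv x := XG 0 (XL x).
Definition xpar i := XG 1 i.
Definition xord i := XG 2 i.
Definition xrank i := XG 3 i.
Definition xgood i := XG 4 i.
Definition xsat j i := XG j.+4.+1 i.

(** Being nonzero means true. Negation and equality rely on truncated subtraction; [xor] is the
    inclusive disjunction, with a value that may exceed 1. *)
Definition xnot a := XS (XL 1) a.
Definition xeq a b := xnot (XA (XS a b) (XS b a)).
Definition xand a b := xnot (XA (xnot a) (xnot b)).
Definition xor a b := XA a b.
Definition xlt a b := XS b a.
Definition xsatof w v := xand (xeq (xpar w) v) (xnot (xeq w v)).
Definition xcount v := XSum BN 20 (xsatof (xv 20) v).
(** The ends of edge number [x] are at the addresses [2 x + 2] and [2 x + 3], so [b] is 2 or 3. *)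
Definition xend (b : nat) x := XI (XA (XL b) (XA (xv x) (xv x))).
(* The variable 21 ranges over the edges. *)
Definition xnbr u (f : ex -> ex) :=
  XSum BM 21 (xor (xand (xeq (xend 2 21) u) (f (xend 3 21)))
                  (xand (xeq (xend 3 21) u) (f (xend 2 21)))).
Definition xadj u w := xnbr u (fun z => xeq z w).

Definition cfill a x c e := CFor BN x (CIf c (CSet a (xv x) e) CSkip).

Lemma set2_eq (T : finType) (a b c d : T) : [set a; b] = [set c; d] ->
  a = c /\ b = d \/ a = d /\ b = c.
Proof.
move/setP=> E; have := E a; have := E b; have := E c; have := E d.
rewrite !in_set2 !eqxx /= ?orbT => h4 h3 h2 h1.
case/esym/orP: h1 => /eqP a1; case/esym/orP: h2 => /eqP b1; subst.
- by left; split=> //; move: h4; rewrite orbb => /eqP.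
- by left.
- by right.
by right; split=> //; move: h3; rewrite orbb => /eqP.
Qed.

(** * Meaning of expressions and commands on an input graph *)

Section Input.
Variables (n : nat) (e : rel 'I_n) (E : seq ('I_n * 'I_n)).
Hypotheses (e_sym : symmetric e) (e_irr : irreflexive e) (hE : edge_listing e E).

Lemma edge_listingP u w : e u w = ((u, w) \in E) || ((w, u) \in E).
Proof.
have mE A : (A \in [seq [set uv.1; uv.2] | uv <- E]) = (A \in edge_set e).
  by rewrite (perm_mem hE) mem_enum.
apply/idP/orP => [euw|].
  have : [set u; w] \in edge_set e by apply/imsetP; exists (u, w); rewrite ?inE.
  rewrite -mE => /mapP[[a b] abE /=] H.
  by case: (set2_eq H) => -[-> ->]; [left|right].
have sub a b : (a, b) \in E -> e a b.
  move=> abE; have : [set a; b] \in edge_set e.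
    by rewrite -mE; apply/mapP; exists (a, b).
  by case/imsetP=> -[c d]; rewrite inE /= => ecd /set2_eq[][-> ->] //; rewrite e_sym.
by case=> /sub //; rewrite e_sym.
Qed.

Lemma size_edges : size E = #|edge_set e|.
Proof. by rewrite cardE -(perm_size hE) size_map. Qed.

Notation inp := (input_memory E).

Lemma input_end b i (x0 : 'I_n) : i < size E -> b < 2 ->
  inp (2 + b + (i + i)) = val (if b == 0 then (nth (x0, x0) E i).1 else (nth (x0, x0) E i).2).
Proof.
move=> iE b2; rewrite /input_memory -addnA !addSn add0n /=.
elim: E i iE => [//|uv E' IH] [|i] iE /=; first by clear IH; case: b b2 => [|[|]].
have -> : b + (i.+1 + i.+1) = (b + (i + i)).+2 by lia.
exact: IH.
Qed.

Lemma run_seq c1 c2 (s : state) : run inp (CSeq c1 c2) s =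
  ((run inp c2 (run inp c1 s).1).1, (run inp c1 s).2 ++ (run inp c2 (run inp c1 s).1).2).
Proof. by []. Qed.

Lemma run_set a i v (s : state) :
  run inp (CSet a i v) s = (upd s a (xeval inp s i) (xeval inp s v), [::]).
Proof. by []. Qed.

Definition holds s x := xeval inp s x != 0.

Lemma run_if x c1 c2 (s : state) :
  run inp (CIf x c1 c2) s = if holds s x then run inp c1 s else run inp c2 s.
Proof. by []. Qed.

Lemma xeval_not s a : xeval inp s (xnot a) = ~~ holds s a.
Proof. by rewrite /= /holds negbK; case: (xeval inp s a) => //= m; rewrite subSS sub0n. Qed.

Lemma truth_bool (b : bool) : ((b : nat) != 0) = b.
Proof. by case: b. Qed.

Lemma truth_not s a : holds s (xnot a) = ~~ holds s a.
Proof. by rewrite {1}/holds xeval_not truth_bool. Qed.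

Lemma truth_or s a b : holds s (xor a b) = holds s a || holds s b.
Proof. by rewrite /holds /= addn_eq0 negb_and. Qed.

Lemma xeval_and s a b : xeval inp s (xand a b) = holds s a && holds s b.
Proof. by rewrite xeval_not truth_or !truth_not negb_or !negbK. Qed.

Lemma truth_and s a b : holds s (xand a b) = holds s a && holds s b.
Proof. by rewrite {1}/holds xeval_and truth_bool. Qed.

Lemma truth_eq s a b : holds s (xeq a b) = (xeval inp s a == xeval inp s b).
Proof. by rewrite truth_not /holds /= addn_eq0 !subn_eq0 -eqn_leq negbK. Qed.

Lemma truth_lt s a b : holds s (xlt a b) = (xeval inp s a < xeval inp s b).
Proof. by rewrite /holds /= subn_eq0 -ltnNge. Qed.

Lemma truth_sum s x f : holds s (XSum BN x f) = [exists i : 'I_n, holds (upd s 0 x i) f].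
Proof.
rewrite /holds [xeval _ _ _]/= big_mkord sum_nat_eq0 negb_forall.
by apply: eq_existsb => i; rewrite implyTb.
Qed.

Lemma find_ord (P : nat -> bool) :
  (exists v : 'I_n, [/\ find P (iota 0 n) = v, P v & forall w, w < v -> ~~ P w]) \/
  find P (iota 0 n) = n /\ forall v : 'I_n, ~~ P v.
Proof.
case: (boolP (has P (iota 0 n))) => h; [left|right].
  have lt : find P (iota 0 n) < n by rewrite -{2}(size_iota 0 n) -has_find.
  exists (Ordinal lt); split=> //=; first by have := nth_find 0 h; rewrite nth_iota.
  by move=> w wl; have := before_find 0 wl; rewrite nth_iota ?add0n ?(ltn_trans wl) // => ->.
split; first by rewrite hasNfind // size_iota.
by move=> v; have /hasPn := h; apply; rewrite mem_iota /=.
Qed.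

Lemma xeval_fst s x f :
  (exists v : 'I_n, [/\ xeval inp s (XFst BN x f) = v, holds (upd s 0 x v) f &
     forall w, w < v -> ~~ holds (upd s 0 x w) f]) \/
  xeval inp s (XFst BN x f) = n /\ forall v : 'I_n, ~~ holds (upd s 0 x v) f.
Proof. exact: (find_ord (fun i => holds (upd s 0 x i) f)). Qed.

(** The hypotheses hold for all values of variable 21 because [xnbr] binds it: [eu] must not depend
    on it. An edge is listed in one orientation only, hence the two disjuncts. *)
Lemma truth_nbr s eu f (u : 'I_n) (F : pred 'I_n) :
  (forall i, xeval inp (upd s 0 21 i) eu = u) ->
  (forall i z (w : 'I_n), xeval inp (upd s 0 21 i) z = w -> holds (upd s 0 21 i) (f z) = F w) ->
  holds s (xnbr eu f) = [exists w, e u w && F w].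
Proof.
move=> hu hf; rewrite /holds [xeval _ _ _]/= sum_nat_seq_eq0 -has_predC.
pose G (uv : 'I_n * 'I_n) := (uv.1 == u) && F uv.2 || (uv.2 == u) && F uv.1.
have hG i : i < size E -> holds (upd s 0 21 i)
  (xor (xand (xeq (xend 2 21) eu) (f (xend 3 21))) (xand (xeq (xend 3 21) eu) (f (xend 2 21))))
   = G (nth (u, u) E i).
  move=> iE; have e2 b : b < 2 -> xeval inp (upd s 0 21 i) (xend (2 + b) 21) =
      if b == 0 then (nth (u, u) E i).1 else (nth (u, u) E i).2.
    move=> b2; rewrite -(input_end u iE b2).
    have -> : xeval inp (upd s 0 21 i) (xend (2 + b) 21) =
      if 2 + b + (i + i) < size E + size E + 2 then inp (2 + b + (i + i)) else 0 by [].
    by rewrite ifT //; lia.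
  have e20 := e2 0 isT; have e21 := e2 1 isT.
  by rewrite truth_or !truth_and !truth_eq !hu (hf _ _ _ e20) (hf _ _ _ e21) e20 e21.
rewrite (_ : index_iota 0 _ = iota 0 (size E)); last by rewrite /index_iota subn0.
have -> : has (predC (fun i => true ==> (xeval inp (upd s 0 21 i) (xor (xand (xeq (xend 2 21) eu) (f (xend 3 21))) (xand (xeq (xend 3 21) eu) (f (xend 2 21)))) == 0))) (iota 0 (size E)) = has G E.
  rewrite -[in RHS](mkseq_nth (u, u) E) has_map; apply: eq_in_has => i.
  by rewrite mem_iota /= => iE; rewrite -(hG i iE).
apply/hasP/existsP => [[[a b] abE /orP[]/andP[/= /eqP <- h]]|[w /andP[]]].
- by exists b; rewrite h edge_listingP abE.
- by exists a; rewrite h edge_listingP abE orbT.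
rewrite edge_listingP => /orP[] h Fw; [exists (u, w)|exists (w, u)] => //;
  by rewrite /G /= eqxx Fw ?orbT.
Qed.

Lemma truth_adj s eu ew (u w : 'I_n) :
  (forall i, xeval inp (upd s 0 21 i) eu = u) ->
  (forall i, xeval inp (upd s 0 21 i) ew = w) ->
  holds s (xadj eu ew) = e u w.
Proof.
move=> hu hw; rewrite (truth_nbr (F := pred1 w) hu).
  by apply/existsP/idP => [[z /andP[euz /eqP <-]]|euw] //; exists w; rewrite euw /= eqxx.
by move=> i z w' h; rewrite truth_eq h hw.
Qed.

(** The array is changed in place: at step [i] its entries from [i] on are still the old ones, so
    condition and value may read the current entry but are granted nothing about earlier ones. *)
Lemma run_fill a x c v s (C : nat -> bool) (V : nat -> nat) : a != 0 ->
  (forall i s1, i < n ->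
    (forall b j, b != a -> ~~ ((b == 0) && (j == x)) -> s1 b j = s b j) ->
    (forall j, i <= j -> s1 a j = s a j) -> s1 0 x = i ->
    holds s1 c = C i /\ (C i -> xeval inp s1 v = V i)) ->
  let r := run inp (cfill a x c v) s in
  [/\ r.2 = [::],
      forall b j, b != a -> ~~ ((b == 0) && (j == x)) -> r.1 b j = s b j &
      forall i, i < n -> r.1 a i = if C i then V i else s a i].
Proof.
move=> a0 H r; rewrite /r [run _ _ _]/= -/(xv x) /=.
set g := fun _ _ => _.
suff : forall m, m <= n -> let r := foldl g (s, [::]) (iota 0 m) in
  [/\ r.2 = [::], forall b j, b != a -> ~~ ((b == 0) && (j == x)) -> r.1 b j = s b j,
      forall i, i < m -> r.1 a i = if C i then V i else s a i &
      forall i, m <= i -> r.1 a i = s a i].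
  by move=> /(_ n (leqnn n))[h1 h2 h3 _].
elim=> [//|m IH] mn; have [h1 h2 h3 h4] := IH (ltnW mn).
rewrite -addn1 iotaD foldl_cat add0n /=; set r0 := foldl _ _ _ in h1 h2 h3 h4 *.
have U b j v' : b != a -> ~~ ((b == 0) && (j == x)) -> upd r0.1 0 x v' b j = s b j.
  move=> ba bj; rewrite -h2 // /upd; case: (eqVneq b 0) ba bj => [->|//] /= _ bj.
  by rewrite (negPf bj).
have Ua j v' : upd r0.1 0 x v' a j = r0.1 a j by rewrite /upd (negPf a0).
have [|||hc hv] := H m (upd r0.1 0 x m) mn.
- by move=> b j; apply: U.
- by move=> j mj; rewrite Ua h4.
- by rewrite /upd !eqxx.
have xE : upd r0.1 0 x m 0 x = m by rewrite /upd !eqxx.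
rewrite /g -/(holds _ _) hc; case: ifP => Cm /=; rewrite h1 /=.
  rewrite xE hv //; split=> // [b j ba bj|i|i].
  - by rewrite {1}/upd (negPf ba) U.
  - rewrite addn1 ltnS leq_eqVlt {1}/upd eqxx.
    by case: eqVneq => [-> _|_ im]; rewrite ?Cm // Ua h3.
  - by rewrite addn1 => im; rewrite {1}/upd eqxx gtn_eqF // Ua h4 // ltnW.
split=> // [b j ba bj|i|i]; first by rewrite U.
- rewrite addn1 ltnS leq_eqVlt Ua.
  by case: eqVneq => [-> _|_ im]; [rewrite Cm h4|rewrite h3].
- by rewrite addn1 => im; rewrite Ua h4 // ltnW.
Qed.

Lemma run_fill_ord a x c v (s : state) (C : pred 'I_n) (V : 'I_n -> nat) : a != 0 ->
  (forall (i : 'I_n) (s1 : state),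
    (forall b j, b != a -> ~~ ((b == 0) && (j == x)) -> s1 b j = s b j) ->
    s1 a i = s a i -> s1 0 x = i ->
    holds s1 c = C i /\ (C i -> xeval inp s1 v = V i)) ->
  let r := run inp (cfill a x c v) s in
  [/\ r.2 = [::],
      forall b j, b != a -> ~~ ((b == 0) && (j == x)) -> r.1 b j = s b j &
      forall i : 'I_n, r.1 a i = if C i then V i else s a i].
Proof.
move=> a0 H; pose C' i := if insub i is Some u then C u else false.
pose V' i := if insub i is Some u then V u else 0.
have CE (i : 'I_n) : C' i = C i by rewrite /C' valK.
have VE (i : 'I_n) : V' i = V i by rewrite /V' valK.
have [|h1 h2 h3] := @run_fill a x c v s C' V' a0.
  move=> i s1 iN h1 h2 h3; rewrite -[i]/(val (Ordinal iN)) CE VE; apply: H => //.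
  exact: h2.
by split=> // i; rewrite h3 // CE VE.
Qed.

Lemma run_for_inv b x f (s : state) (I : nat -> state -> seq nat -> Prop) :
  I 0 s [::] ->
  (forall i s1 o, i < bval inp b -> I i s1 o ->
     let r := run inp f (upd s1 0 x i) in I i.+1 r.1 (o ++ r.2)) ->
  let r := run inp (CFor b x f) s in I (bval inp b) r.1 r.2.
Proof.
move=> I0 IS r; rewrite {}/r [run _ _ _]/=; set g := fun _ _ => _.
suff : forall m, m <= bval inp b -> let r := foldl g (s, [::]) (iota 0 m) in I m r.1 r.2.
  by move=> /(_ _ (leqnn _)).
elim=> [//|m IH] mn; rewrite -addn1 iotaD foldl_cat add0n addn1 /=.
exact: IS (IH (ltnW mn)).
Qed.

Definition encodes (s : state) (p : 'I_n -> 'I_n) : Prop := forall v : 'I_n, s 1 v = p v.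

Lemma encodes_move s p (x z : 'I_n) : encodes s p -> encodes (upd s 1 x z) (move p x z).
Proof. by move=> h v; rewrite /upd /move /= -val_eqE /=; case: eqP => // _; apply: h. Qed.

Lemma xeval_satof s p ew ev (w v : 'I_n) : encodes s p ->
  xeval inp s ew = w -> xeval inp s ev = v ->
  xeval inp s (xsatof ew ev) = (w \in sats p v).
Proof.
move=> rs hw hv; rewrite xeval_and truth_not !truth_eq hw hv.
have -> : xeval inp s (xpar ew) = p w by rewrite [LHS]/= hw rs.
by rewrite in_sats.
Qed.

Lemma truth_satof s p ew ev (w v : 'I_n) : encodes s p ->
  xeval inp s ew = w -> xeval inp s ev = v -> holds s (xsatof ew ev) = (w \in sats p v).
Proof. by move=> rs hw hv; rewrite /holds (xeval_satof rs hw hv) truth_bool. Qed.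

Lemma xeval_count s p ev (v : 'I_n) : encodes s p ->
  (forall i, xeval inp (upd s 0 20 i) ev = v) -> xeval inp s (xcount ev) = ord p v.
Proof.
move=> rs hv; have -> : xeval inp s (xcount ev) =
  \sum_(0 <= i < n) xeval inp (upd s 0 20 i) (xsatof (xv 20) ev) by [].
rewrite big_mkord /ord -sum1_card [RHS]big_mkcond.
by apply: eq_bigr => w _; rewrite (xeval_satof (w := w) (v := v) (p := p)) //.
Qed.

Definition c_ord := cfill 2 1 (XL 1) (xcount (xv 1)).

Lemma run_ord s p : encodes s p -> let r := run inp c_ord s in
  [/\ r.2 = [::], encodes r.1 p, forall v : 'I_n, r.1 2 v = ord p v &
      forall b j, b != 2 -> ~~ ((b == 0) && (j == 1)) -> r.1 b j = s b j].
Proof.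
move=> rs; have [|h1 h2 h3] := @run_fill_ord 2 1 (XL 1) (xcount (xv 1)) s xpredT (ord p) isT.
  move=> i s1 f1 _ f3; split=> // _; apply: xeval_count => //.
  by move=> v; rewrite f1.
by split=> // v; rewrite h2.
Qed.

End Input.

(** * One step towards a maximum packing *)

Section StepProgram.
Variable k : nat.

(** The satellites of [u] are sought along the edges, not among all vertices: the two loops around a
    step, the rounds and the fill already amount to n^4, so only a loop over the edges is left. *)
Definition xgoodness u :=
  xor (xnot (xeq (xord u) (XL k))) (xnbr u (fun z => xand (xsatof z u) (xrank z))).

(** Marking the vertices in a separate pass avoids nesting two loops over the edges. *)
Definition c_round :=
  CSeq (cfill 4 1 (XL 1) (xnot (xnot (xgoodness (xv 1)))))
       (cfill 3 1 (xand (xnot (xrank (xv 1))) (xnbr (xv 1) xgood)) (XA (xv 2) (XL 1))).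

Definition c_ranks := CSeq (cfill 3 1 (XL 1) (XL 0)) (CFor BN 2 c_round).

Definition xcand w := xand (xand (xeq (xpar w) w) (xeq (xord w) (XL 0)))
                           (xeq (xrank w) (XA (xv 3) (XL 1))).

Definition xrel x := xand (xsatof x (xv 5)) (xand (xrank x) (xnot (xlt (xv 3) (xrank x)))).

Definition c_augment :=
  CSeq (CSet 0 (XL 6) (xpar (xv 5)))
    (CIf (xeq (xv 6) (xv 5)) (CSet 1 (xv 4) (xv 5))
      (CSeq (CSet 1 (xv 5) (xv 5)) (CSeq (CSet 1 (xv 4) (xv 5))
         (CIf (xeq (xord (xv 6)) (XL 1)) (CSet 1 (xv 6) (xv 5)) CSkip)))).

Definition c_shift :=
  CSeq (CSet 0 (XL 6) (XFst BN 6 (xrel (xv 6))))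
    (CSeq (CSet 1 (xv 6) (xv 6)) (CSet 1 (xv 4) (xv 5))).

(** Variable 3 is made minimal so that a shift preserves the remaining chain of releases. If no
    uncovered vertex is released, the searches end with their default, the number of vertices, and
    nothing is moved. *)
Definition c_move :=
  CSeq (CSet 0 (XL 3) (XFst BN 3 (XSum BN 1 (xcand (xv 1)))))
  (CSeq (CSet 0 (XL 4) (XFst BN 4 (xcand (xv 4))))
  (CIf (xlt (xv 4) (XB BN))
    (CSeq (CSet 0 (XL 5) (XFst BN 5 (xand (xadj (xv 4) (xv 5))
       (xor (xnot (xeq (xord (xv 5)) (XL k))) (XSum BN 6 (xrel (xv 6)))))))
      (CIf (xnot (xeq (xord (xv 5)) (XL k))) c_augment c_shift))
    CSkip)).

Definition c_step := CSeq c_ord (CSeq c_ranks c_move).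

(* Every step decreases the potential, which is at most n^2 + n: two double loops
   suffice. *)
Definition c_max :=
  CSeq (cfill 1 1 (XL 1) (xv 1))
  (CSeq (CFor BN 8 (CFor BN 9 c_step)) (CFor BN 8 (CFor BN 9 c_step))).

End StepProgram.

Section Step.
Variables (n : nat) (e : rel 'I_n) (E : seq ('I_n * 'I_n)).
Hypotheses (e_sym : symmetric e) (e_irr : irreflexive e) (hE : edge_listing e E).
Variable k : nat.
Hypothesis k2 : 1 < k.
Notation inp := (input_memory E).
Notation truth := (holds E).
Implicit Types (s : state) (p : 'I_n -> 'I_n) (i j r : nat).

Definition ranked p s j : Prop := forall v : 'I_n,
  s 3 v <= j /\ forall r, r <= j -> (0 < s 3 v <= r) = (v \in release e k p r).

Definition good p s (u : 'I_n) := (ord p u != k) || [exists x in sats p u, 0 < s 3 x].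

Lemma releaseE p s j (v : 'I_n) : ranked p s j ->
  (v \in release e k p j.+1) = [exists u, e v u && good p s u].
Proof.
move=> rk; apply/releaseS/existsP => [[u evu h]|[u /andP[evu /orP h]]].
  exists u; rewrite evu /=; apply/orP; case: h => [->|[x xu xr]]; [by left|right].
  apply/exists_inP; exists x => //; have [_ /(_ j (leqnn j))] := rk x.
  by rewrite xr => /andP[].
exists u => //; case: h => [->|/exists_inP[x xu x0]]; [by left|right].
exists x => //; have [h1 /(_ j (leqnn j)) <-] := rk x.
by rewrite x0 h1.
Qed.

Lemma truth_goodness s p eu (u : 'I_n) : star_map e p -> encodes s p ->
  (forall v : 'I_n, s 2 v = ord p v) ->
  xeval inp s eu = u -> (forall i, xeval inp (upd s 0 21 i) eu = u) ->
  truth s (xgoodness k eu) = good p s u.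
Proof.
move=> sm rs os hu hu'; rewrite truth_or truth_not truth_eq.
have -> : xeval inp s (xord eu) = ord p u by rewrite [LHS]/= hu os.
congr orb.
rewrite (truth_nbr e_sym hE (u := u) (F := fun w => (w \in sats p u) && (0 < s 3 w))) //; last first.
  move=> i z w hz; rewrite truth_and; congr andb; last first.
    by rewrite /holds [xeval _ _ _]/= hz lt0n.
  exact: (truth_satof (p := p)).
apply/existsP/exists_inP => [[w /and3P[_ h1 h2]]|[w h1 h2]]; exists w => //.
rewrite h1 h2 !andbT; move: h1; rewrite in_sats => /andP[/eqP <- wN].
by apply: sm.2; rewrite eq_sym.
Qed.

Lemma run_round s p j : star_map e p -> encodes s p -> (forall v : 'I_n, s 2 v = ord p v) ->
  ranked p s j -> s 0 2 = j ->
  let r := run inp (c_round k) s in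
  [/\ r.2 = [::], encodes r.1 p, forall v : 'I_n, r.1 2 v = ord p v & ranked p r.1 j.+1].
Proof.
move=> sm rs os rk sj; rewrite /c_round run_seq.
set g := cfill 4 _ _ _; set h := cfill 3 _ _ _.
have [|g1 g2 g3] := @run_fill_ord n E 4 1 (XL 1) (xnot (xnot (xgoodness k (xv 1)))) s xpredT
    (fun u => good p s u) isT.
  move=> u s1 f1 _ f3; split=> // _; rewrite xeval_not truth_not negbK.
  have f3' (a i : nat) : a != 4 -> a != 0 -> s1 a i = s a i.
    by move=> a4 a0; apply: f1; rewrite // (negPf a0).
  rewrite (truth_goodness (p := p) (u := u)) //; first last.
  - by move=> v; rewrite f3'.
  - by move=> v; rewrite f3'.
  by rewrite /good; congr (_ || _ : nat); apply: eq_existsb => x; rewrite f3'.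
rewrite -/g in g1 g2 g3; set s1 := (run _ g s).1 in g2 g3 *.
pose R (v : 'I_n) := (s 3 v == 0) && [exists u, e v u && good p s u].
have [|h1 h2 h3] := @run_fill_ord n E 3 1 (xand (xnot (xrank (xv 1))) (xnbr (xv 1) xgood))
    (XA (xv 2) (XL 1)) s1 R (fun _ => j.+1) isT.
  move=> v s2 f1 f2 f3; split; last first.
    by move=> _; rewrite /= f1 // g2 // sj addn1.
  rewrite truth_and truth_not /R; congr andb.
    by rewrite /holds /= f3 f2 g2 // negbK.
  apply: (truth_nbr e_sym hE) => // i z w hz.
  rewrite /holds [xeval _ _ _]/= hz /upd /= f1 // g3.
  by case: good.
rewrite -/h in h1 h2 h3 *; cbn [fst snd]; split.
- by rewrite g1 h1.
- by move=> v; rewrite h2 // g2.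
- by move=> v; rewrite h2 // g2.
move=> v; rewrite h3 g2 // /R -(releaseE v rk); have [r1 r2] := rk v.
case: eqVneq => [v0|v0] /=; last first.
  split; first exact: leq_trans r1 _.
  move=> r; rewrite leq_eqVlt => /orP[/eqP ->|rj]; last exact: r2.
  have vj : v \in release e k p j by rewrite -r2 // r1 lt0n v0.
  rewrite lt0n v0 /= (leq_trans r1) //.
  by rewrite (subsetP (release_sub _ _ _ (leqnSn j)) _ vj).
case: ifP => vr; last first.
  rewrite v0; split=> // r; rewrite leq_eqVlt => /orP[/eqP ->|rj]; first by rewrite vr.
  by rewrite -r2 // v0.
split=> // r; rewrite leq_eqVlt => /orP[/eqP ->|rj]; first by rewrite vr ltnSn.
by rewrite /= ltnNge -ltnS rj /= -r2 // v0.
Qed.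

Lemma run_ranks s p : star_map e p -> encodes s p -> (forall v : 'I_n, s 2 v = ord p v) ->
  let r := run inp (c_ranks k) s in
  [/\ r.2 = [::], encodes r.1 p, forall v : 'I_n, r.1 2 v = ord p v & ranked p r.1 n].
Proof.
move=> sm rs os; rewrite /c_ranks; set g := cfill 3 _ _ _.
have [|g1 g2 g3] := @run_fill_ord n E 3 1 (XL 1) (XL 0) s xpredT (fun _ => 0) isT.
  by [].
rewrite -/g in g1 g2 g3.
have := @run_for_inv n E BN 2 (c_round k) (run inp g s).1
  (fun j s o => [/\ o = [::], encodes s p, forall v : 'I_n, s 2 v = ord p v & ranked p s j]).
set r1 := run inp (CFor _ _ _) _ => H.
have -> : run inp (CSeq g (CFor BN 2 (c_round k))) s = (r1.1, (run inp g s).2 ++ r1.2) by [].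
rewrite g1 /=; apply: H.
  split=> //; first by move=> v; rewrite g2.
    by move=> v; rewrite g2.
  by move=> v; rewrite g3; split=> // r; rewrite leqn0 => /eqP ->; rewrite inE.
move=> j s1 o jn [-> h1 h2 h3].
have [] := @run_round (upd s1 0 2 j) p j sm h1 h2 h3 _; first by rewrite /upd.
by move=> e1 e2 e3 e4; cbn zeta; rewrite e1; split.
Qed.

Lemma notin_cov p (w : 'I_n) : star_map e p -> (w \notin cov p) = (p w == w) && (ord p w == 0).
Proof.
move=> sm; rewrite inE lt0n negbK; case: (eqVneq (p w) w) => [->//|N] /=.
by apply/negbTE; rewrite -lt0n; apply: ord_pgt0.
Qed.

Lemma truth_cand s p ew (w : 'I_n) r : star_map e p -> encodes s p ->
  (forall v : 'I_n, s 2 v = ord p v) -> xeval inp s ew = w -> s 0 3 = r ->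
  truth s (xcand ew) = (w \notin cov p) && (s 3 w == r.+1).
Proof.
move=> sm rs os hw hr; rewrite !truth_and !truth_eq notin_cov //.
have -> : xeval inp s (xpar ew) = p w by rewrite [LHS]/= hw rs.
have -> : xeval inp s (xord ew) = ord p w by rewrite [LHS]/= hw os.
have -> : xeval inp s (xrank ew) = s 3 w by rewrite [LHS]/= hw.
have -> : xeval inp s (XA (xv 3) (XL 1)) = r.+1 by rewrite /= hr addn1.
by rewrite hw.
Qed.

Lemma truth_rel s p ex (x u : 'I_n) r : encodes s p -> xeval inp s ex = x ->
  s 0 5 = u -> s 0 3 = r ->
  truth s (xrel ex) = (x \in sats p u) && (0 < s 3 x <= r).
Proof.
move=> rs hx hu hr; rewrite truth_and; congr andb.
  by apply: truth_satof.
have rE : xeval inp s (xrank ex) = s 3 x by rewrite [LHS]/= hx.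
rewrite truth_and truth_not truth_lt rE -leqNgt {1}/holds rE -lt0n.
by congr (_ && (_ <= _)); rewrite /= hr.
Qed.

Definition stuckb p := ~: cov p \subset ~: released e k p.

Definition progress p p' : Prop := ~~ stuckb p /\
  (#|cov p| < #|cov p'| \/ #|cov p| = #|cov p'| /\ exists r x,
    [/\ x \notin cov p', x \in release e k p' r, r <= n &
        forall w, w \notin cov p -> w \notin release e k p r]).

Lemma not_stuckb p w r : w \notin cov p -> w \in release e k p r -> ~~ stuckb p.
Proof.
move=> wc wr; apply/negP => /subsetP/(_ w); rewrite !in_setC wc => /(_ isT)/negP[].
exact: (subsetP (release_released e k p r)).
Qed.

Lemma run_augment s p (w u : 'I_n) : encodes s p -> (forall v : 'I_n, s 2 v = ord p v) ->
  s 0 4 = w -> s 0 5 = u ->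
  let r := run inp c_augment s in r.2 = [::] /\ encodes r.1 (augment p w u).
Proof.
move=> rs os hw hu; rewrite /c_augment run_seq run_set run_if truth_eq.
set s1 := upd s 0 _ _; cbn [fst snd].
have s1E a i : a != 0 -> s1 a i = s a i by move=> /negPf a0; rewrite /s1 /upd a0.
have h4 : s1 0 4 = w by []. have h5 : s1 0 5 = u by [].
have h6 : s1 0 6 = p u by rewrite -rs -hu.
have rs1 : encodes s1 p by [].
have -> : (xeval inp s1 (xv 6) == xeval inp s1 (xv 5)) = (p u == u).
  by rewrite -val_eqE /= h6 h5.
rewrite /augment; case: eqVneq => [_|N].
  by rewrite run_set /= h4 h5; split=> //; apply: encodes_move.
rewrite run_seq run_set run_seq run_set run_if truth_eq; cbn [fst snd].
have -> : upd s1 1 (xeval inp s1 (xv 5)) (xeval inp s1 (xv 5)) = upd s1 1 u u by rewrite /= h5.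
set s2 := upd s1 1 u u; have rs2 : encodes s2 (move p u u) by apply: encodes_move.
have -> : upd s2 1 (xeval inp s2 (xv 4)) (xeval inp s2 (xv 5)) = upd s2 1 w u.
  by rewrite /= /s2 /upd /= h4 h5.
set s3 := upd s2 1 w u; have rs3 : encodes s3 (move (move p u u) w u) by apply: encodes_move.
have -> : (xeval inp s3 (xord (xv 6)) == xeval inp s3 (XL 1)) = (ord p (p u) == 1).
  by rewrite /= /s3 /upd /= /s2 /upd /= h6 s1E // os.
case: ifP => _ //; rewrite run_set; split=> //.
have -> : xeval inp s3 (xv 6) = p u by rewrite /= /s3 /upd /= /s2 /upd /= h6.
have -> : xeval inp s3 (xv 5) = u by rewrite /= /s3 /upd /= /s2 /upd /= h5.
exact: encodes_move.
Qed.

Lemma run_shift s p (w u : 'I_n) r : encodes s p -> ranked p s n -> r <= n ->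
  s 0 3 = r -> s 0 4 = w -> s 0 5 = u -> (exists2 x, x \in sats p u & x \in release e k p r) ->
  let r' := run inp c_shift s in r'.2 = [::] /\
    exists x, [/\ x \in sats p u, x \in release e k p r & encodes r'.1 (shift p w u x)].
Proof.
move=> rs rk rn hr hw hu [x0 x0u x0r]; rewrite /c_shift run_seq run_set run_seq.
have rel (v : 'I_n) : truth (upd s 0 6 v) (xrel (xv 6)) = (v \in sats p u) && (v \in release e k p r).
  rewrite (truth_rel (p := p) (x := v) (u := u) (r := r)) //.
  by have [_ /(_ r rn) <-] := rk v.
have [[x [-> + _]]|[_ /(_ x0)]] := xeval_fst E s 6 (xrel (xv 6)); last first.
  by rewrite rel x0u x0r.
rewrite rel => /andP[xu xr]; cbn [fst snd]; rewrite !run_set; cbn [fst snd]; split=> //.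
exists x; split=> //; set s1 := upd s 0 _ x.
have -> : xeval inp s1 (xv 6) = x by [].
set s2 := upd s1 1 x x; have rs2 : encodes s2 (move p x x) by apply: encodes_move.
have -> : xeval inp s2 (xv 4) = w by rewrite -hw.
have -> : xeval inp s2 (xv 5) = u by rewrite -hu.
exact: encodes_move.
Qed.

Lemma run_move s p : star_map_le e k p -> encodes s p ->
  (forall v : 'I_n, s 2 v = ord p v) -> ranked p s n ->
  let r := run inp (c_move k) s in r.2 = [::] /\
    exists p', [/\ encodes r.1 p', star_map_le e k p' &
      p' = p /\ stuckb p \/ progress p p'].
Proof.
move=> smk rs os rk; have [sm _] := smk; rewrite /c_move run_seq run_set run_seq run_set run_if.
set sel := XSum BN 1 (xcand (xv 1)); cbn [fst snd].
have selE i : truth (upd s 0 3 i) sel = [exists w : 'I_n, (w \notin cov p) && (s 3 w == i.+1)].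
  rewrite truth_sum; apply: eq_existsb => w.
  exact: (truth_cand (p := p) (w := w) (r := i)).
move RE0: (xeval inp s (XFst BN 3 sel)) => R; set s1 := upd s 0 _ R.
have candE (w : 'I_n) : truth (upd s1 0 4 w) (xcand (xv 4)) = (w \notin cov p) && (s 3 w == R.+1).
  exact: (truth_cand (p := p) (w := w) (r := R)).
have lt_bound s' i : truth (upd s' 0 4 i) (xlt (xv 4) (XB BN)) = (i < n).
  by rewrite truth_lt.
have [[w [WE wc _]]|[WE none]] := xeval_fst E s1 4 (xcand (xv 4)); last first.
  rewrite WE lt_bound ltnn; split=> //; exists p; split=> //; left; split=> //.
  apply/subsetP=> w; rewrite !in_setC => wc; apply/negP=> wr.
  have [r1 r2] := rk w; have : w \in release e k p n.
    by move: wr; rewrite /released card_ord.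
  rewrite -r2 // => /andP[w0 wn].
  have := xeval_fst E s 3 sel; rewrite RE0 => -[[r [RE + _]]|[RE /(_ (Ordinal (_ : (s 3 w).-1 < n)))]].
    rewrite selE => /existsP[w']; have := none w'; rewrite candE RE.
    by move=> /negbTE->.
  move=> /(_ _) h; have lt : (s 3 w).-1 < n by rewrite prednK.
  have := h lt; rewrite selE => /existsPn/(_ w).
  by rewrite wc /= prednK // eqxx.
rewrite candE in wc; case/andP: wc => wc /eqP wR.
have [w1 w2] := rk w.
have RN : R < n by rewrite -wR.
rewrite WE lt_bound ltn_ord run_seq run_set; cbn [fst snd].
set s2 := upd s1 0 _ w.
have wr : w \in release e k p R.+1 by rewrite -w2 // wR ltnSn.
(* No uncovered vertex is released by round [R]; this is needed by [shift_release] and also makes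
   the shift lower the potential. *)
have minR v : v \notin cov p -> v \notin release e k p R.
  move=> vc; have [v1 v2] := rk v; rewrite -(v2 R (ltnW RN)); apply/negP => /andP[v0 vR].
  have := xeval_fst E s 3 sel; rewrite RE0 => -[[r [RE _ h]]|[RE _]].
    have := h (s 3 v).-1; rewrite -RE prednK // selE => /(_ vR)/existsPn/(_ v).
    by rewrite vc prednK // eqxx.
  by move: RN; rewrite RE ltnn.
set uex := xand _ _.
have uE (u : 'I_n) : truth (upd s2 0 5 u) uex =
    e w u && ((ord p u != k) || [exists x in sats p u, x \in release e k p R]).
  rewrite truth_and (truth_adj e_sym hE (u := w) (w := u)) //; congr andb.
  rewrite truth_or truth_not truth_eq.
  have -> : xeval inp (upd s2 0 5 u) (xord (xv 5)) = ord p u by rewrite -os.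
  congr orb; rewrite truth_sum; apply: eq_existsb => x.
  rewrite (truth_rel (p := p) (x := x) (u := u) (r := R)) //.
  by have [_ /(_ R (ltnW RN)) <-] := rk x.
have [[u [-> + _]]|[_ none]] := xeval_fst E s2 5 uex; last first.
  have /releaseS[u ewu h] := wr; case/negP: (none u); rewrite uE ewu andTb.
  by case: h => [->|/exists_inP ->]; rewrite ?orbT.
rewrite uE => /andP[ewu h]; rewrite run_if truth_not truth_eq.
set s3 := upd s2 0 _ u.
have os3 (v : 'I_n) : s3 2 v = ord p v by rewrite -os.
have -> : xeval inp s3 (xord (xv 5)) = ord p u by rewrite -os.
have -> : xeval inp s3 (XL k) = k by [].
have wN := minR w wc; have ns := not_stuckb wc wr.
case: (eqVneq (ord p u) k) => [uk|uk]; cbn [negb fst snd].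
  have {}h : exists2 x, x \in sats p u & x \in release e k p R.
    by move: h; rewrite uk eqxx => /exists_inP.
  have [-> [x [xu xr rs']]] := @run_shift s3 p w u R rs rk (ltnW RN) erefl erefl erefl h.
  split=> //; exists (shift p w u x).
  have [smk' _ xc' covE] := shift_ok e_sym e_irr k2 smk wc ewu uk xu.
  split=> //; right; split=> //; right; split.
    rewrite covE cardsU1 in_setD1 (negPf wc) andbF add1n.
    rewrite (cardsD1 x (cov p)) inE; have := xu; rewrite in_sats => /andP[/eqP-> _].
    by rewrite uk ltnW.
  exists R, x; split; [exact: xc'| |exact: ltnW|exact: minR].
  by apply: (subsetP (shift_release e_sym e_irr k2 smk wc ewu uk xu wN)).
have [-> rs'] := @run_augment s3 p w u rs os3 erefl erefl.
have [smk' sub] := augment_ok e_sym e_irr k2 smk wc ewu uk.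
split=> //; exists (augment p w u); split=> //; right; split=> //; left.
by apply: leq_trans (subset_leq_card sub); rewrite cardsU1 wc.
Qed.

Definition min_rank p :=
  find (fun r => [exists w : 'I_n, (w \notin cov p) && (w \in release e k p r.+1)]) (iota 0 n).

(* A shift does not change the number of uncovered vertices but brings one of
   them nearer to an augmentation. *)
Definition potential p := if stuckb p then 0 else (n - #|cov p|) * n + min_rank p.

Lemma min_rank_lt p : ~~ stuckb p -> min_rank p < n.
Proof.
case/subsetPn=> w; rewrite !in_setC negbK => wc; rewrite /released card_ord => wr.
have n0 : 0 < n := leq_ltn_trans (leq0n w) (ltn_ord w).
rewrite /min_rank -[X in _ < X](size_iota 0 n) -has_find; apply/hasP; exists n.-1.
  by rewrite mem_iota /= add0n prednK.
by apply/existsP; exists w; rewrite wc prednK.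
Qed.

(** The potential orders lexicographically: since [min_rank] is below [n], covering one more vertex
    outweighs any change of it. *)
Lemma progress_potential p p' : progress p p' -> potential p' < potential p.
Proof.
move=> [ns h]; rewrite /potential (negPf ns); have mn := min_rank_lt ns.
have n0 : 0 < n by apply: leq_ltn_trans mn.
have cn (q : 'I_n -> 'I_n) : #|cov q| <= n by rewrite -[X in _ <= X]card_ord max_card.
have ns_lt : #|cov p| < n.
  case/subsetPn: ns => w; rewrite !in_setC => wc _.
  rewrite -[X in _ < X]card_ord -cardsT; apply/proper_card; rewrite properE subsetT /=.
  by apply/subsetPn; exists w.
case: ifPn => [_|ns']; first by rewrite ltn_addr // muln_gt0 subn_gt0 ns_lt.
have mn' := min_rank_lt ns'; case: h => [lt|[<- [r [x [xc xr rn wN]]]]].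
  apply: leq_trans (leq_addr _ _); apply: (@leq_trans ((n - #|cov p'|).+1 * n)).
    by rewrite mulSn addnC ltn_add2r.
  by rewrite leq_mul2r; apply/orP; right; have := cn p'; lia.
rewrite ltn_add2l; case: r => [|r] in xr rn wN *; first by rewrite inE in xr.
have le' : min_rank p' <= r.
  rewrite leqNgt; apply/negP => lt; have := before_find 0 lt.
  rewrite nth_iota // add0n => /existsPn/(_ x); by rewrite xc xr.
apply: leq_ltn_trans le' _; rewrite ltnNge; apply/negP => le.
have lt := leq_ltn_trans le rn.
have : has (fun r => [exists w : 'I_n, (w \notin cov p) && (w \in release e k p r.+1)]) (iota 0 n).
  rewrite has_find size_iota; exact: lt.
move/(nth_find 0); rewrite -/(min_rank p) (nth_iota _ _ lt) add0n => /existsP[w /andP[wc wr]].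
case/negP: (wN w wc); exact: (subsetP (release_sub e k p (le : (min_rank p).+1 <= r.+1)) _ wr).
Qed.

Lemma run_step s p : star_map_le e k p -> encodes s p ->
  let r := run inp (c_step k) s in r.2 = [::] /\
    exists p', [/\ encodes r.1 p', star_map_le e k p' &
      p' = p /\ stuckb p \/ potential p' < potential p].
Proof.
move=> smk rs; have [sm _] := smk; rewrite /c_step run_seq run_seq.
have [o1 rs1 os1 _] := run_ord E rs.
have [o2 rs2 os2 rk2] := run_ranks sm rs1 os1.
have [o3 [p' [rs3 smk' h]]] := run_move smk rs2 os2 rk2.
cbn [fst snd]; rewrite o1 o2 o3; split=> //; exists p'; split=> //.
by case: h => [|/progress_potential]; [left|right].
Qed.

Lemma run_max s : let r := run inp (c_max k) s in r.2 = [::] /\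
    exists p, [/\ encodes r.1 p, star_map_le e k p & stuckb p].
Proof.
rewrite /c_max; set g := cfill _ _ _ _; set two := CFor BN 8 (CFor BN 9 _).
have [|o1 f1 rs1] := @run_fill_ord n E 1 1 (XL 1) (xv 1) s xpredT (fun v : 'I_n => val v) isT.
  by move=> i s1 _ _ f3; split.
rewrite -/g in o1 f1 rs1.
(* The sum [c + m] counts the steps made, [m] of them in the current inner loop. After two double
   loops it is [n * n + n * n], which leaves no room for a positive potential. *)
pose I (m c : nat) s (o : seq nat) := o = [::] /\
  exists p, [/\ encodes s p, star_map_le e k p & stuckb p \/ potential p + (c + m) <= n * n + n].
have step m c s1 o : I m c s1 o ->
    I m.+1 c (run inp (c_step k) s1).1 (o ++ (run inp (c_step k) s1).2).
  move=> [-> [p [rs smk h]]]; have [-> [p' [rs' smk' h']]] := run_step smk rs.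
  split=> //; exists p'; split=> //; case: h' => [[-> st]|lt]; first by left.
  case: h => [st|h]; first by rewrite /potential st in lt.
  by right; lia.
have inner c s1 : I 0 c s1 [::] -> let r := run inp (CFor BN 9 (c_step k)) s1 in I n c r.1 r.2.
  move=> I0; apply: (@run_for_inv n E BN 9 _ s1 (fun m => I m c)) => // i s2 o _ [o0 [p [rs h1 h2]]].
  by apply: step; split=> //; exists p.
have outer c s1 : I 0 c s1 [::] -> let r := run inp two s1 in I 0 (c + n * n) r.1 r.2.
  move=> I0; apply: (@run_for_inv n E BN 8 _ s1 (fun m => I 0 (c + m * n))).
    by rewrite mul0n addn0.
  move=> i s2 o _ [-> [p [rs h1 h2]]].
  have [o' [p' [rs' h1' h2']]] := inner (c + i * n) (upd s2 0 8 i) (conj erefl (ex_intro _ p (And3 rs h1 h2))).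
  cbn zeta; rewrite o'; split=> //; exists p'; split=> //.
  by case: h2' => [st|h]; [left|right; rewrite mulSn; lia].
have I0 : I 0 0 (run inp g s).1 [::].
  split=> //; exists id; split; first by move=> v; rewrite rs1.
    split; first by split=> // v; rewrite eqxx.
    move=> v; rewrite /ord (_ : sats _ _ = set0) ?cards0 //.
    by apply/setP=> w; rewrite in_sats inE; case: eqP.
  case: (boolP (stuckb id)) => [st|ns]; [by left|right].
  rewrite /potential (negPf ns) !addn0 leq_add //; last exact: ltnW (min_rank_lt ns).
  by rewrite leq_mul2r leq_subr orbT.
rewrite run_seq run_seq; cbn [fst snd].
have [o2 [p1 [rs2 h1 h2]]] := outer _ _ I0.
have [o3 [p2 [rs3 h3 h4]]] := outer _ (run inp two (run inp g s).1).1
   (conj erefl (ex_intro _ p1 (And3 rs2 h1 h2))).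
rewrite o1 o2 o3; split=> //; exists p2; split=> //; case: h4 => // h4.
case: (boolP (stuckb p2)) => // ns; have mn := min_rank_lt ns.
have : 0 < potential p2.
  rewrite /potential (negPf ns); case/subsetPn: (ns) => w; rewrite in_setC => wc _.
  have lt : #|cov p2| < n.
    rewrite -[X in _ < X]card_ord -cardsT; apply/proper_card; rewrite properE subsetT /=.
    by apply/subsetPn; exists w.
  by rewrite ltn_addr // muln_gt0 subn_gt0 lt (leq_ltn_trans _ mn).
by move: h4 mn; case: (n) => [//|m]; nia.
Qed.

End Step.

(** * Output and search of revisions *)

(** The double negation turns an order into 0 or 1, so that the sum counts the stars. *)
Definition c_emit :=
  CSeq (CEmit (XSum BN 1 (xnot (xnot (xcount (xv 1))))))
    (CFor BN 1 (CIf (xcount (xv 1))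
      (CSeq (CEmit (xv 1)) (CSeq (CEmit (xcount (xv 1)))
        (CFor BN 2 (CIf (xsatof (xv 2) (xv 1)) (CEmit (xv 2)) CSkip))))
      CSkip)).

Definition xfresh j :=
  foldr (fun i c => xand (xnot (xeq (xv 7) (xsat i (xv 1)))) c) (XL 1) (iota 0 j).

Definition c_sat j := cfill j.+4.+1 1 (XL 1) (XFst BN 7 (xand (xsatof (xv 7) (xv 1)) (xfresh j))).

Fixpoint c_sats j := if j is i.+1 then CSeq (c_sats i) (c_sat i) else CSkip.

Section Output.
Variables (n : nat) (e : rel 'I_n) (E : seq ('I_n * 'I_n)).
Notation inp := (input_memory E).
Notation truth := (holds E).
Implicit Types (s : state) (p : 'I_n -> 'I_n) (i j r : nat).

Definition same_but (xs : seq nat) s s' : Prop :=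
  forall a i, ~~ ((a == 0) && (i \in xs)) -> s' a i = s a i.

Lemma same_but_trans xs s s' s'' : same_but xs s s' -> same_but xs s' s'' -> same_but xs s s''.
Proof. by move=> h h' a i ai; rewrite h' // h. Qed.

Lemma same_but_upd xs s s' x i : x \in xs -> same_but xs s s' -> same_but xs s (upd s' 0 x i).
Proof.
move=> xx h a j aj; rewrite -h // /upd; case: eqP aj => //= _.
by case: eqP => // ->; rewrite xx.
Qed.

Lemma run_for_emit x xs f s (O : 'I_n -> seq nat) : x \in xs ->
  (forall s1 (v : 'I_n), same_but xs s s1 -> s1 0 x = v ->
     same_but xs s (run inp f s1).1 /\ (run inp f s1).2 = O v) ->
  same_but xs s (run inp (CFor BN x f) s).1 /\
  (run inp (CFor BN x f) s).2 = flatten [seq O v | v <- enum 'I_n].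
Proof.
move=> xx H; pose O' i := if insub i is Some v then O v else [::].
have -> : [seq O v | v <- enum 'I_n] = [seq O' i | i <- iota 0 n].
  by rewrite -val_enum_ord -map_comp; apply: eq_map => v /=; rewrite /O' valK.
apply: (@run_for_inv n E BN x f s (fun m s1 o => same_but xs s s1 /\ o = flatten [seq O' i | i <- iota 0 m])).
  by split.
move=> i s1 o iN [h ->]; have iN' : i < n by exact: iN.
have [||h1 h2] := H (upd s1 0 x i) (Ordinal iN').
- exact: same_but_upd.
- by rewrite /upd !eqxx.
split=> //; rewrite h2 -addn1 iotaD map_cat flatten_cat add0n /= cats0; congr cat.
by rewrite /O' (insubT (fun i => i < n) iN').
Qed.

Lemma flatten_if (T : Type) (a : pred T) (O : T -> seq nat) l :
  flatten [seq (if a v then O v else [::]) | v <- l] = flatten [seq O v | v <- l & a v].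
Proof. by elim: l => //= v l ->; case: (a v). Qed.

Lemma run_emit s p : star_map e p -> encodes s p ->
  same_but [:: 1; 2] s (run inp c_emit s).1 /\ packing_code (packing_of p) (run inp c_emit s).2.
Proof.
move=> sm rs; rewrite /c_emit run_seq.
set f := CFor BN 2 _; set g := CFor BN 1 _.
have run_em x s1 : run inp (CEmit x) s1 = (s1, [:: xeval inp s1 x]) by [].
have cnt s1 (v : 'I_n) : same_but [:: 1; 2] s s1 -> s1 0 1 = v ->
    xeval inp s1 (xcount (xv 1)) = ord p v.
  by move=> h hv; apply: xeval_count => // w; rewrite h.
have [|h1 h2] := @run_for_emit 1 [:: 1; 2] (CIf (xcount (xv 1))
      (CSeq (CEmit (xv 1)) (CSeq (CEmit (xcount (xv 1))) f)) CSkip) s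
   (fun v => if 0 < ord p v then val v :: ord p v :: [seq val w | w <- enum (sats p v)] else [::]) isT.
  move=> s1 v h hv; rewrite run_if /holds (cnt s1 v h hv) lt0n.
  case: eqVneq => [//|_]; rewrite run_seq run_seq !run_em (cnt s1 v h hv).
  have [|f1 f2] := @run_for_emit 2 [:: 2] (CIf (xsatof (xv 2) (xv 1)) (CEmit (xv 2)) CSkip) s1
    (fun w => if w \in sats p v then [:: val w] else [::]) isT.
    move=> s2 w h' hw; rewrite run_if (truth_satof (p := p) (w := w) (v := v)) //.
    - by case: ifP => // _; rewrite run_em /= hw.
    - by move=> u; rewrite h' // h.
    by rewrite [LHS]/= h'.
  rewrite -/f in f1 f2; cbn [fst snd]; split.
    by apply: same_but_trans h _ => a i ai; apply: f1; apply: contra ai => /andP[-> /=]; rewrite !inE => ->; rewrite orbT.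
  rewrite f2 /= hv flatten_if flatten_map1; congr (_ :: _ :: map _ _).
  by rewrite enumT; apply: eq_filter.
rewrite -/g in h1 h2; rewrite run_em; cbn [fst snd]; split=> //.
exists [seq (v, enum (sats p v)) | v <- enum 'I_n & 0 < ord p v]; split.
- by apply/allP=> l /mapP[v _ ->]; rewrite enum_uniq.
- apply: uniq_perm; rewrite ?enum_uniq //.
    rewrite -map_comp map_inj_uniq; first by rewrite filter_uniq // enum_uniq.
    by move=> u v [].
  move=> st; rewrite mem_enum -map_comp; apply/mapP/imsetP => [[v]|[v vo ->]].
    rewrite mem_filter => /andP[v0 _] ->; exists v => //; congr pair.
    by apply/setP=> w; rewrite inE mem_enum.
  exists v; first by rewrite mem_filter mem_enum andbT.
  by congr pair; apply/setP=> w; rewrite inE mem_enum.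
rewrite size_map size_filter -map_comp; congr cons.
  have -> : xeval inp s (XSum BN 1 (xnot (xnot (xcount (xv 1))))) =
    \sum_(0 <= i < n) xeval inp (upd s 0 1 i) (xnot (xnot (xcount (xv 1)))) by [].
  rewrite big_mkord -sum1_count big_enum_cond [RHS]big_mkcond.
  apply: eq_bigr => v _; rewrite xeval_not truth_not negbK /holds (cnt _ v) //; last first.
    exact: same_but_upd.
  by rewrite lt0n; case: eqP.
rewrite h2 flatten_if; congr flatten; apply: eq_map => v /=.
by rewrite -cardE.
Qed.

Definition same_low s s' : Prop := forall a i, 0 < a < 5 -> s' a i = s a i.

Lemma run_sats_prefix s p j : encodes s p -> let r := run inp (c_sats j) s in
  [/\ r.2 = [::], same_low s r.1 &
   forall (v : 'I_n) i, i <= j -> i <= ord p v -> exists l : seq 'I_n,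
     [/\ size l = i, uniq l, {subset l <= sats p v} &
         [seq r.1 m.+4.+1 v | m <- iota 0 i] = map val l]].
Proof.
move=> rs; elim: j => [|j [o1 low1 h1]].
  split=> // v i; rewrite leqn0 => /eqP -> _; exists [::]; split=> //.
rewrite [c_sats _]/= run_seq; set s1 := (run inp (c_sats j) s).1 in low1 h1 *.
have rs1 : encodes s1 p by move=> v; rewrite low1.
pose P (v w : 'I_n) := (w \in sats p v) && all (fun i => s1 i.+4.+1 v != w) (iota 0 j).
have truth_fresh s2 (v : 'I_n) (w m : nat) : (forall i, i < m -> s2 i.+4.+1 v = s1 i.+4.+1 v) ->
   s2 0 1 = v -> s2 0 7 = w ->
   truth s2 (xfresh m) = all (fun i => s1 i.+4.+1 v != w) (iota 0 m).
  rewrite /xfresh => hs h1' h7.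
  have : {subset iota 0 m <= gtn m} by move=> i; rewrite mem_iota.
  elim: (iota 0 m) => [//|i l IH] sub; cbn [foldr all].
  rewrite truth_and truth_not truth_eq IH; last by move=> i' h; apply: sub; rewrite inE h orbT.
  by rewrite /= h7 h1' hs ?(eq_sym w) //; apply: (sub i); rewrite mem_head.
pose V (v : 'I_n) := xeval inp (upd s1 0 1 v) (XFst BN 7 (xand (xsatof (xv 7) (xv 1)) (xfresh j))).
have cond s2 (v w : 'I_n) : encodes s2 p ->
    (forall i, i < j -> s2 i.+4.+1 v = s1 i.+4.+1 v) -> s2 0 1 = v ->
    truth (upd s2 0 7 w) (xand (xsatof (xv 7) (xv 1)) (xfresh j)) = P v w.
  move=> r2 low2 h2; rewrite truth_and (truth_satof (p := p) (w := w) (v := v)) //.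
  by rewrite (truth_fresh _ v w).
have [|o2 f2 v2] := @run_fill_ord n E j.+4.+1 1 (XL 1) (XFst BN 7 (xand (xsatof (xv 7) (xv 1)) (xfresh j)))
  s1 xpredT V isT.
  move=> v s2 f _ h2; split=> // _; rewrite /V.
  have r2 : encodes s2 p by move=> u; rewrite f // rs1.
  have r1 : encodes (upd s1 0 1 v) p by move=> u; rewrite /upd /= rs1.
  have c2 w := cond s2 v w r2 _ h2; have c1 w := cond (upd s1 0 1 v) v w r1 (fun _ _ => erefl) erefl.
  have {}c2 (w : 'I_n) : truth (upd s2 0 7 w) (xand (xsatof (xv 7) (xv 1)) (xfresh j)) = P v w.
    by apply: c2 => i ij; apply: f => //; rewrite !eqSS neq_ltn ij.
  rewrite ![xeval _ _ (XFst _ _ _)]/=; apply: eq_in_find => i.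
  rewrite mem_iota add0n /= => iN; have := c2 (Ordinal iN); have := c1 (Ordinal iN).
  by rewrite /holds => /= -> ->.
rewrite -/(c_sat j) in o2 f2 v2; cbn [fst snd]; rewrite o1 o2; split=> //.
  by move=> a i /[dup] a5 /low1 <-; rewrite f2 //; move: a5; case: a => [|[|[|[|[|]]]]].
have f2' (v : 'I_n) m : m < j -> (run inp (c_sat j) s1).1 m.+4.+1 v = s1 m.+4.+1 v.
  by move=> mj; apply: f2 => //; rewrite !eqSS neq_ltn mj.
move=> v i; rewrite leq_eqVlt => /orP[/eqP -> jv|ij iv]; last first.
  have [l [l1 l2 l3 l4]] := h1 v i ij iv; exists l; split=> //; rewrite -l4.
  by apply/eq_in_map => m; rewrite mem_iota add0n => mi; apply: f2'; apply: leq_trans mi _.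
have [l [l1 l2 l3 l4]] := h1 v j (leqnn j) (ltnW jv).
have all_l (w : 'I_n) : all (fun i => s1 i.+4.+1 v != w) (iota 0 j) = (w \notin l).
  rewrite -[LHS](all_map (fun i => s1 i.+4.+1 v) (fun u => u != w)) l4 all_map.
  rewrite -has_pred1 -all_predC; apply: eq_all => u /=; rewrite -val_eqE /=; exact: erefl.
have r1 : encodes (upd s1 0 1 v) p by move=> u; rewrite /upd /= rs1.
have c1 w := cond (upd s1 0 1 v) v w r1 (fun _ _ => erefl) erefl.
(* The list [l] has [j < ord p v] elements, so a fresh satellite exists and the search does not end
   with its default value. *)
have [w [Vw]] : exists w : 'I_n, V v = w /\ P v w.
  case: (xeval_fst E (upd s1 0 1 v) 7 (xand (xsatof (xv 7) (xv 1)) (xfresh j))) => [[w [w1 w2 _]]|[_ none]].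
    by exists w; rewrite -c1.
  suff [w wP] : exists w, w \in sats p v :\: [set x in l].
    have := none w; rewrite c1 /P all_l; move: wP; rewrite in_setD in_set => /andP[-> ->]; done.
  apply/set0Pn; rewrite -card_gt0 cardsD subn_gt0; apply: leq_ltn_trans (subset_leq_card (subsetIr _ _)) _.
  by rewrite cardsE (card_uniqP l2) l1.
rewrite /P all_l => /andP[wv wl]; exists (rcons l w); split.
- by rewrite size_rcons l1.
- by rewrite rcons_uniq wl.
- by move=> u; rewrite mem_rcons inE => /orP[/eqP ->|/l3].
rewrite -addn1 iotaD map_cat add0n map_rcons -cats1; congr cat.
  by rewrite -l4; apply/eq_in_map => m; rewrite mem_iota add0n => mi; apply: f2'.
by rewrite [LHS]/= v2 // Vw.
Qed.

Lemma run_sats k s p : encodes s p -> let r := run inp (c_sats k) s in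
  [/\ r.2 = [::], same_low s r.1 &
   forall v : 'I_n, ord p v <= k -> exists l : seq 'I_n,
     [/\ uniq l, l =i sats p v & [seq r.1 m.+4.+1 v | m <- iota 0 (ord p v)] = map val l]].
Proof.
move=> rs r; have [h1 h2 h3] := run_sats_prefix k rs; split=> // v vk.
have [l [l1 l2 l3 l4]] := h3 v (ord p v) vk (leqnn _); exists l; split=> //.
have lE : l =i enum (sats p v).
  have [||//] := uniq_min_size l2 (s2 := enum (sats p v)).
    by move=> x /l3; rewrite mem_enum.
  by rewrite -cardE l1.
by move=> x; rewrite lE mem_enum.
Qed.

End Output.

(* A candidate revision [(os, g)]: the stars of orders [os], their vertices
   being listed one star after the other, are replaced by the star map which
   sends the [i]-th vertex to the [nth 0 g i]-th one. *)
Definition slots (os : seq nat) : nat := sumn [seq o.+1 | o <- os].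

(** The fixed points of [g] are the new centers; each occurs among its own preimages, hence the
    predecessor. *)
Definition new_orders (g : seq nat) : seq nat :=
  [seq (count_mem i g).-1 | i <- iota 0 (size g) & nth 0 g i == i].

Definition idempotent_seq (g : seq nat) : bool :=
  all (fun i => (nth 0 g i < size g) && (nth 0 g (nth 0 g i) == nth 0 g i)) (iota 0 (size g)).

Definition candidate k t (cd : seq nat * seq nat) : bool :=
  [&& size cd.2 == slots cd.1, idempotent_seq cd.2,
      all (fun o => 0 < o <= k) cd.1, all (fun o => 0 < o <= k) (new_orders cd.2) &
      revise_shape t cd.1 (new_orders cd.2)].

Fixpoint words b m : seq (seq nat) :=
  if m is m'.+1 then [seq x :: w | x <- iota 0 b, w <- words b m'] else [:: [::]].

(** A finite list depending on [k] and [t] only; the program contains one test for each element,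
    which affects its cost by a constant factor. *)
Definition candidates k t : seq (seq nat * seq nat) :=
  [seq cd <- [seq (os, g) | os <- flatten [seq words k.+1 r | r <- iota 0 4],
                            g <- words (slots os) (slots os)] | candidate k t cd].

Lemma mem_words b m w : size w = m -> all (gtn b) w -> w \in words b m.
Proof.
elim: m w => [|m IH] [|x w] //= [sw] /andP[xb wb].
apply/allpairsP; exists (x, w); split=> //=; last exact: IH.
by rewrite mem_iota.
Qed.

Lemma revise_shape_size t os ns : revise_shape t os ns -> size os < 4.
Proof.
case/or3P=> [/and3P[_ /perm_size -> _]|/and3P[/eqP -> _ _]|/and3P[/hasP[i _ /perm_size ->] _ _]];
  by [].
Qed.

Lemma mem_candidates k t cd : (cd \in candidates k t) = candidate k t cd.
Proof.
rewrite mem_filter andb_idr //; case: cd => os g /and5P[/eqP]; cbn [fst snd] => sg id_g /allP osk _ /revise_shape_size s4.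
apply/flatten_mapP; exists os.
  apply/flatten_mapP; exists (size os); first by rewrite mem_iota.
  by apply: mem_words => //; apply/allP=> o /osk /andP[_]; rewrite /= ltnS.
apply: map_f; apply: mem_words => //; apply/(all_nthP 0) => i ig /=; rewrite -sg.
by have /allP/(_ i) := id_g; rewrite mem_iota => /(_ ig)/andP[].
Qed.

Lemma revise_shape_perm t os ns ns' : perm_eq ns ns' ->
  revise_shape t os ns = revise_shape t os ns'.
Proof. by move=> h; rewrite /revise_shape (perm_size h) (permP h) (permPl h). Qed.

(** * Revisions as rearrangements of a list of vertices *)

Section Rearrange.
Variables (T : finType) (e : rel T) (p : T -> T) (F L : seq T) (x0 : T).
Hypotheses (sm : star_map e p) (uL : uniq L) (LF : forall v, (v \in L) = (p v \in F)).

Definition rearrange (g : seq nat) v : T :=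
  if v \in L then nth v L (nth 0 g (index v L)) else p v.

Definition linked (g : seq nat) : bool :=
  all (fun i => (nth 0 g i == i) || e (nth x0 L i) (nth x0 L (nth 0 g i))) (iota 0 (size g)).

Lemma rearrange_nth g i : size g = size L -> i < size L -> nth 0 g i < size L ->
  rearrange g (nth x0 L i) = nth x0 L (nth 0 g i).
Proof.
move=> sg iL gL; rewrite /rearrange mem_nth // index_uniq //.
exact: set_nth_default.
Qed.

Hypothesis e_sym : symmetric e.

Lemma config_rearrange g : size g = size L -> idempotent_seq g -> linked g ->
  config e p F (rearrange g)
    [seq (nth x0 L i, (count_mem i g).-1) | i <- iota 0 (size g) & nth 0 g i == i].
Proof.
move=> sg id_g lk; set l := map _ _.
have gP i : i < size L -> nth 0 g i < size L /\ nth 0 g (nth 0 g i) = nth 0 g i.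
  move=> iL; have /allP/(_ i) := id_g; rewrite mem_iota sg => /(_ iL)/andP[? /eqP]; by split.
have LP v : v \in L -> exists2 i, i < size L & v = nth x0 L i.
  by move=> vL; exists (index v L); rewrite ?index_mem ?nth_index.
have rN i : i < size L -> rearrange g (nth x0 L i) = nth x0 L (nth 0 g i).
  by move=> iL; apply: rearrange_nth => //; have [] := gP i iL.
have lE : unzip1 l = [seq nth x0 L i | i <- iota 0 (size g) & nth 0 g i == i].
  by rewrite /unzip1 -map_comp.
have rL v : v \in L -> rearrange g v \in unzip1 l.
  case/LP=> i iL ->; rewrite rN // lE; apply: map_f.
  by have [h1 h2] := gP i iL; rewrite mem_filter h2 eqxx mem_iota sg.
have lL v : v \in unzip1 l -> v \in L.
  rewrite lE => /mapP[i]; rewrite mem_filter mem_iota sg => /andP[_ iL] ->.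
  exact: mem_nth.
have ro v : v \notin L -> rearrange g v = p v by move=> h; rewrite /rearrange (negPf h).
have pL v : (p v \in L) = (v \in L) by rewrite !LF sm.1.
have fixl v : v \in unzip1 l -> rearrange g v = v.
  rewrite lE => /mapP[i]; rewrite mem_filter mem_iota sg => /andP[/eqP gi iL] ->.
  by rewrite rN // gi.
split.
- split=> v; case: (boolP (v \in L)) => vL.
  + exact/fixl/rL.
  + by rewrite (ro v) // ro ?pL // sm.1.
  + case/LP: vL => i iL ->; rewrite rN //.
    have /allP/(_ i) := lk; rewrite mem_iota sg => /(_ iL)/orP[/eqP->|]; first by rewrite eqxx.
    by rewrite e_sym.
  + by rewrite ro //; apply: sm.2.
- by move=> v; rewrite -LF; apply: ro.
- move=> v; rewrite -LF; case: (boolP (v \in L)) => vL; first by rewrite rL.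
  by apply/esym/negbTE; rewrite ro //; apply: contra vL => /lL; rewrite pL.
- rewrite lE map_inj_in_uniq ?filter_uniq ?iota_uniq // => i j.
  rewrite !mem_filter !mem_iota sg => /andP[_ iL] /andP[_ jL] /eqP.
  by rewrite nth_uniq // => /eqP.
move=> a al; have a1 : a.1 \in unzip1 l by apply: map_f.
split; first exact: fixl.
case/mapP: al a1 => i; rewrite mem_filter mem_iota sg => /andP[/eqP gi iL] -> /= _.
have -> : ord (rearrange g) (nth x0 L i) = #|[set w | rearrange g w == nth x0 L i]|.-1.
  rewrite (cardsD1 (nth x0 L i)) inE rN // gi eqxx add1n /=.
  by apply: eq_card => w; rewrite !inE andbC.
congr predn; have gE : g = [seq nth 0 g (index w L) | w <- L].
  apply: (@eq_from_nth _ 0); rewrite ?size_map // => j; rewrite sg => jL.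
  by rewrite (nth_map x0) // index_uniq.
rewrite [in RHS]gE count_map -size_filter -(card_uniqP (filter_uniq _ uL)).
apply: eq_card => w; rewrite inE mem_filter /=.
case: (boolP (w \in L)) => wL; rewrite ?andbT ?andbF.
  case/LP: wL => j jL ->; have [gj _] := gP j jL.
  by rewrite rN // nth_uniq // index_uniq.
apply/negbTE; rewrite ro //; apply: contra wL => /eqP E.
by rewrite -pL E mem_nth.
Qed.

(** Completeness of the table: every rearrangement of the listed stars is read off as a word [g],
    with the same orders up to permutation. *)
Lemma rearrange_config p' F' : config e p F p' [seq (c, ord p' c) | c <- F'] ->
  let g := [seq index (p' v) L | v <- L] in
  [/\ idempotent_seq g, linked g, rearrange g =1 p' &
      perm_eq (new_orders g) [seq ord p' c | c <- F']].
Proof.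
move=> [sm' h1 h2 h3 h4] g; have sg : size g = size L by rewrite size_map.
have F'E : unzip1 [seq (c, ord p' c) | c <- F'] = F' by rewrite /unzip1 -map_comp map_id_in.
rewrite F'E in h2 h3.
have pc c : c \in F' -> p' c = c by move=> cF; have [] := h4 (c, ord p' c) (map_f _ cF).
have pL v : (p' v \in L) = (v \in L).
  rewrite !LF !h2; apply/idP/idP => [|vF]; first by rewrite sm'.1.
  by rewrite sm'.1.
have gP i : i < size L -> nth 0 g i = index (p' (nth x0 L i)) L.
  by move=> iL; rewrite (nth_map x0).
have gL i : i < size L -> nth 0 g i < size L.
  by move=> iL; rewrite gP // index_mem pL mem_nth.
have Lg i : i < size L -> nth x0 L (nth 0 g i) = p' (nth x0 L i).
  by move=> iL; rewrite gP // nth_index // pL mem_nth.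
have id_g : idempotent_seq g.
  apply/allP=> i; rewrite mem_iota sg => iL; rewrite gL //.
  by rewrite (gP (nth 0 g i)) ?gL // Lg // sm'.1 -gP ?eqxx.
have lk : linked g.
  apply/allP=> i; rewrite mem_iota sg => iL; rewrite Lg // e_sym gP //.
  case: (eqVneq (p' (nth x0 L i)) (nth x0 L i)) => [->|/sm'.2 ->]; last by rewrite orbT.
  by rewrite index_uniq ?eqxx.
have rE : rearrange g =1 p'.
  move=> v; rewrite /rearrange; case: ifPn => vL; last by rewrite h1 // -LF.
  by rewrite (nth_map v) ?index_mem // !nth_index ?pL.
split=> //; have [_ _ r2 r3 r4] := config_rearrange sg id_g lk.
set l := map _ _ in r2 r3 r4.
have -> : new_orders g = [seq ord p' c | c <- unzip1 l].
  rewrite -map_comp /new_orders /l -map_comp; apply/eq_in_map => i ig /=.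
  have /r4[_ /= <-] : (nth x0 L i, (count_mem i g).-1) \in l by apply: map_f.
  exact: ord_eq.
apply/perm_map/uniq_perm => // c; apply/idP/idP => cl.
  have: p' c = c by case/mapP: cl => a /r4[+ _] ->; rewrite rE.
  by move=> E; rewrite -E -h2 r2 rE E.
by rewrite -(pc _ cl) -rE -r2 h2 pc.
Qed.

End Rearrange.

Definition xall (xs : seq ex) := foldr xand (XL 1) xs.

Fixpoint xuniq (xs : seq ex) :=
  if xs is x :: xs' then xand (xall [seq xnot (xeq x y) | y <- xs']) (xuniq xs') else XL 1.

Fixpoint xeqs (xs : seq ex) (os : seq nat) :=
  match xs, os with
  | [::], [::] => XL 1
  | x :: xs', o :: os' => xand (xeq x (XL o)) (xeqs xs' os')
  | _, _ => XL 0
  end.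

(** Variables from [c] on hold the centers, and satellites come from the satellite arrays; the
    values of these expressions form [star_list]. *)
Fixpoint xslots c (os : seq nat) : seq ex :=
  if os is o :: os' then
    xv c :: [seq xsat j (xv c) | j <- iota 0 o] ++ xslots c.+1 os'
  else [::].

Definition xcenters (os : seq nat) := [seq xv i | i <- iota 1 (size os)].

Definition xlinks xs (g : seq nat) :=
  xall [seq (if nth 0 g i == i then XL 1
             else xadj (nth (XL 0) xs i) (nth (XL 0) xs (nth 0 g i))) | i <- iota 0 (size g)].

Definition xcond (cd : seq nat * seq nat) :=
  xand (xeqs [seq xord x | x <- xcenters cd.1] cd.1)
       (xand (xuniq (xcenters cd.1)) (xlinks (xslots 1 cd.1) cd.2)).

Definition c_stores (I : seq nat) (f h : nat -> ex) :=
  foldr CSeq CSkip [seq CSet 1 (f i) (h i) | i <- I].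

Definition c_apply (cd : seq nat * seq nat) := let xs := xslots 1 cd.1 in
  c_stores (iota 0 (size cd.2)) (nth (XL 0) xs) (fun i => nth (XL 0) xs (nth 0 cd.2 i)).

Definition xany cds := foldr xor (XL 0) [seq xcond cd | cd <- cds].
Definition c_choose cds := foldr (fun cd c => CIf (xcond cd) (c_apply cd) c) CSkip cds.

Definition c_first x f := CSet 0 (XL x) (XFst BN x f).

(** The variables are fixed one by one, each at the first value for which the search over the
    remaining ones succeeds; no search is nested deeper than three loops over the vertices. *)
Definition c_find any :=
  CSeq (c_first 1 (XSum BN 2 (XSum BN 3 any)))
    (CSeq (c_first 2 (XSum BN 3 any)) (c_first 3 any)).

Definition c_search k t := let cds := candidates k t in let any := xany cds in
  CSeq c_ord (CSeq (c_sats k)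
    (CIf (XSum BN 1 (XSum BN 2 (XSum BN 3 any)))
      (CSeq (c_find any) (CSeq (c_choose cds) c_emit)) CSkip)).

(** * Correctness and completeness of the search *)

Section Search.
Variables (k t n : nat) (e : rel 'I_n) (E : seq ('I_n * 'I_n)).
Hypotheses (e_sym : symmetric e) (e_irr : irreflexive e) (hE : edge_listing e E).
Hypothesis t2 : 1 < t.
Notation inp := (input_memory E).
Notation truth := (holds E).
Implicit Types (s : state) (p : 'I_n -> 'I_n) (F : seq 'I_n) (g os : seq nat).

Lemma truth_all s xs : truth s (xall xs) = all (truth s) xs.
Proof. by elim: xs => [//|x xs IH]; rewrite truth_and IH. Qed.

Lemma truth_uniq s xs : truth s (xuniq xs) = uniq [seq xeval inp s x | x <- xs].
Proof.
elim: xs => [//|x xs IH]; rewrite truth_and IH truth_all; cbn [map uniq]; congr andb.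
elim: xs {IH} => [//|y xs IH]; cbn [map all]; rewrite inE negb_or -IH; congr andb.
by rewrite truth_not truth_eq.
Qed.

Lemma truth_eqs s xs os : truth s (xeqs xs os) = ([seq xeval inp s x | x <- xs] == os).
Proof.
elim: xs os => [|x xs IH] [|o os] //; rewrite [xeqs _ _]/= truth_and truth_eq IH.
by cbn [map]; rewrite eqseq_cons.
Qed.

Definition lists s p (sl : 'I_n -> seq 'I_n) : Prop := forall v,
  [/\ uniq (sl v), sl v =i sats p v & [seq s m.+4.+1 v | m <- iota 0 (ord p v)] = map val (sl v)].

Definition star_list (sl : 'I_n -> seq 'I_n) F := flatten [seq c :: sl c | c <- F].

Lemma lists_upd s p sl i v : lists s p sl -> lists (upd s 0 i v) p sl.
Proof. by move=> h w; have [h1 h2 h3] := h w. Qed.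

Lemma xeval_slots s p sl F c : lists s p sl ->
  [seq s 0 i | i <- iota c (size F)] = map val F ->
  [seq xeval inp s x | x <- xslots c [seq ord p v | v <- F]] = map val (star_list sl F).
Proof.
move=> hs; elim: F c => [//|v F IH] c [hv /IH E1]; cbn [xslots map].
rewrite map_cat E1 /star_list; cbn [map flatten foldr].
have -> : xeval inp s (xv c) = v by [].
rewrite map_cat -map_comp; cbn [map]; congr (_ :: _ ++ _).
have [_ _ <-] := hs v; apply: eq_map => m.
by rewrite -hv.
Qed.

Lemma size_star_list s p sl F : lists s p sl ->
  size (star_list sl F) = slots [seq ord p c | c <- F].
Proof.
move=> hs; rewrite /star_list size_flatten /slots /shape -!map_comp; congr sumn.
apply: eq_map => c /=; have [_ _ /(congr1 size)] := hs c.
by rewrite !size_map size_iota => <-.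
Qed.

Lemma mem_star_list s p sl F : lists s p sl -> star_map e p ->
  {in F, forall c, 0 < ord p c} -> forall v, (v \in star_list sl F) = (p v \in F).
Proof.
move=> hs sm F0 v; apply/flatten_mapP/idP => [[c cF]|pF].
  have [_ slE _] := hs c; rewrite inE slE => /orP[/eqP ->|].
    by rewrite (ord_gt0_center sm (F0 _ cF)).
  by rewrite in_sats => /andP[/eqP -> _].
exists (p v) => //; have [_ slE _] := hs (p v).
by rewrite inE slE in_sats eqxx /= orbN.
Qed.

Lemma uniq_star_list s p sl F : lists s p sl -> star_map e p -> uniq F ->
  {in F, forall c, 0 < ord p c} -> uniq (star_list sl F).
Proof.
move=> hs sm; elim: F => [//|c F IH]; rewrite cons_uniq => /andP[cF uF] F0.
have F0' : {in F, forall c, 0 < ord p c} by move=> d dF; apply: F0; rewrite inE dF orbT.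
have [usl slE _] := hs c.
have pc : p c = c by apply: (ord_gt0_center sm); apply: F0; apply: mem_head.
have -> : star_list sl (c :: F) = (c :: sl c) ++ star_list sl F by [].
rewrite cat_uniq IH // andbT; apply/andP; split.
  by rewrite /= usl slE in_sats eqxx andbF.
apply/hasPn => v; rewrite (mem_star_list hs sm F0') => vF.
apply: contraNN cF; rewrite inE slE => /orP[/eqP E1|]; first by rewrite -pc -E1.
by rewrite in_sats => /andP[/eqP <-].
Qed.

Lemma truth_cond s p sl F g x0 : lists s p sl ->
  (forall v : 'I_n, s 2 v = ord p v) -> size F < 4 ->
  [seq s 0 i | i <- iota 1 (size F)] = map val F -> idempotent_seq g ->
  forall os, size g = slots os -> size F = size os ->
  truth s (xcond (os, g)) =
  [&& [seq ord p c | c <- F] == os, uniq F & linked e (star_list sl F) x0 g].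
Proof.
move=> hs ho F4 hF id_g os sg sF; rewrite !truth_and truth_eqs truth_uniq.
cbn [fst snd]; rewrite /xcenters -!map_comp -sF.
have -> : [seq (xeval inp s \o (xord \o xv)) i | i <- iota 1 (size F)] = [seq ord p c | c <- F].
  transitivity [seq s 2 j | j <- [seq s 0 i | i <- iota 1 (size F)]]; first by rewrite -map_comp.
  by rewrite hF -map_comp; apply: eq_map => v; apply: ho.
have -> : [seq (xeval inp s \o xv) i | i <- iota 1 (size F)] = map val F by rewrite -hF.
rewrite (map_inj_uniq val_inj); case: eqVneq => [Eos|//]; congr andb; congr andb.
rewrite truth_all all_map /linked; apply: eq_in_all => i; rewrite mem_iota => ig.
have [gi _] : nth 0 g i < size g /\ true.
  by have /allP/(_ i) := id_g; rewrite mem_iota => /(_ ig)/andP[].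
rewrite /preim /=; case: eqP => [//|_]; cbn [orb].
have slot m j : m < size g ->
    xeval inp (upd s 0 21 j) (nth (XL 0) (xslots 1 os) m) = nth x0 (star_list sl F) m.
  move=> mg; have hF' : [seq upd s 0 21 j 0 i | i <- iota 1 (size F)] = map val F.
    rewrite -hF; apply/eq_in_map => l; rewrite mem_iota /upd /= => /andP[_ lF].
    by case: eqP lF F4 => // ->; lia.
  have := xeval_slots (lists_upd 21 j hs) hF'; rewrite Eos => H.
  have sz : size (xslots 1 os) = size g.
    by rewrite -(size_map (xeval inp (upd s 0 21 j))) H size_map (size_star_list _ hs) Eos.
  rewrite -(nth_map _ 0) ?sz // H (nth_map x0) //.
  by rewrite (size_star_list _ hs) Eos -sg.
by rewrite (truth_adj e_sym hE (u := nth x0 (star_list sl F) i)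
  (w := nth x0 (star_list sl F) (nth 0 g i))) // => j; apply: slot.
Qed.

(** The stores write array 1, whereas addresses and values are computed from other arrays; executed
    one after the other, they act as if simultaneous. *)
Lemma run_stores I (f h : nat -> ex) (a b : nat -> nat) s :
  (forall s' i, (forall d j, d != 1 -> s' d j = s d j) -> i \in I ->
     xeval inp s' (f i) = a i /\ xeval inp s' (h i) = b i) ->
  uniq (map a I) ->
  let r := run inp (c_stores I f h) s in
  [/\ r.2 = [::], forall d j, d != 1 -> r.1 d j = s d j,
      forall i, i \in I -> r.1 1 (a i) = b i &
      forall j, j \notin map a I -> r.1 1 j = s 1 j].
Proof.
elim: I s => [|i I IH] s H; first by split.
cbn [map uniq] => /andP[ai uI].
rewrite /c_stores; cbn [map foldr]; rewrite -/(c_stores I f h) run_seq run_set.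
have [-> ->] := H s i (fun _ _ _ => erefl) (mem_head _ _); cbn [fst snd].
set s1 := upd _ _ _ _.
have f1 d j : d != 1 -> s1 d j = s d j by rewrite /s1 /upd => /negPf ->.
have [|//|h1 h2 h3 h4] := IH s1.
  move=> s' i' hs' i'I; apply: H; last by rewrite inE i'I orbT.
  by move=> d j d1; rewrite hs' // f1.
cbn zeta; rewrite h1; split=> //.
- by move=> d j d1; rewrite h2 // f1.
- move=> i'; rewrite inE => /orP[/eqP ->|/h3//]; rewrite h4 //.
  by rewrite /s1 /upd !eqxx.
move=> j; rewrite inE negb_or => /andP[/negPf ja /h4 ->].
by rewrite /s1 /upd ja.
Qed.

Lemma run_apply s p sl F g (x0 : 'I_n) : lists s p sl -> encodes s p ->
  [seq s 0 i | i <- iota 1 (size F)] = map val F -> idempotent_seq g ->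
  uniq (star_list sl F) ->
  let os := [seq ord p c | c <- F] in size g = slots os ->
  let r := run inp (c_apply (os, g)) s in
  r.2 = [::] /\ encodes r.1 (rearrange p (star_list sl F) g).
Proof.
move=> hs rs hF id_g uL os sg; set L := star_list sl F in uL *.
have sL : size L = size g by rewrite /L (size_star_list _ hs).
have gP i : i < size g -> nth 0 g i < size g.
  by move=> ig; have /allP/(_ i) := id_g; rewrite mem_iota => /(_ ig)/andP[].
have aE : [seq val (nth x0 L i) | i <- iota 0 (size g)] = map val L.
  by rewrite -sL map_comp map_nth_iota0 // take_size.
have [||h1 h2 h3 h4] := @run_stores (iota 0 (size g)) (nth (XL 0) (xslots 1 os))
  (fun i => nth (XL 0) (xslots 1 os) (nth 0 g i)) (fun i => nth x0 L i)
  (fun i => nth x0 L (nth 0 g i)) s; last 1 first.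
- split=> // v; rewrite /rearrange; case: ifPn => vL.
    have ig : index v L < size g by rewrite -sL index_mem.
    have := h3 (index v L); rewrite mem_iota ig nth_index // => -> //.
    by congr (val _); apply: set_nth_default; rewrite sL gP.
  by rewrite /c_apply [LHS]h4 ?rs // aE mem_map //; apply: val_inj.
- move=> s' i hs'; rewrite mem_iota => ig.
  have hl : lists s' p sl.
    move=> v; have [q1 q2 q3] := hs v; split=> //; rewrite -q3.
    by apply: eq_map => m; rewrite hs'.
  have hF' : [seq s' 0 i | i <- iota 1 (size F)] = map val F.
    by rewrite -hF; apply: eq_map => m; rewrite hs'.
  have H := xeval_slots hl hF'; rewrite -/os -/L in H.
  have sz : size (xslots 1 os) = size g by rewrite -(size_map (xeval inp s')) H size_map.
  have slot m : m < size g -> xeval inp s' (nth (XL 0) (xslots 1 os) m) = nth x0 L m.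
    by move=> mg; rewrite -(nth_map _ 0) ?sz // H (nth_map x0) ?sL.
  by rewrite !slot // gP.
by rewrite aE map_inj_uniq //; apply: val_inj.
Qed.

Lemma run_choose s cds : truth s (xany cds) ->
  exists cd, [/\ cd \in cds, truth s (xcond cd) &
    run inp (c_choose cds) s = run inp (c_apply cd) s].
Proof.
elim: cds => [//|cd cds IH]; rewrite /xany /c_choose; cbn [map foldr].
rewrite -/(xany cds) -/(c_choose cds) truth_or run_if.
case: (boolP (truth s (xcond cd))) => [h _|_ /IH[cd' [h1 h2 h3]]].
  by exists cd; rewrite mem_head.
by exists cd'; rewrite inE h1 orbT.
Qed.

Lemma truth_any s cds cd : cd \in cds -> truth s (xcond cd) -> truth s (xany cds).
Proof.
elim: cds => [//|cd' cds IH]; rewrite /xany; cbn [map foldr].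
rewrite -/(xany cds) truth_or inE => /orP[/eqP <- -> //|h /(IH h) ->].
by rewrite orbT.
Qed.

Lemma run_first s x f : truth s (XSum BN x f) -> exists v : 'I_n,
  run inp (c_first x f) s = (upd s 0 x v, [::]) /\ truth (upd s 0 x v) f.
Proof.
rewrite truth_sum => /existsP[w wf]; rewrite /c_first run_set.
have [[v [-> h _]]|[_ /(_ w)]] := xeval_fst E s x f; last by rewrite wf.
by exists v.
Qed.

Lemma run_find s any : truth s (XSum BN 1 (XSum BN 2 (XSum BN 3 any))) ->
  exists a b c : 'I_n, let s' := upd (upd (upd s 0 1 a) 0 2 b) 0 3 c in
  run inp (c_find any) s = (s', [::]) /\ truth s' any.
Proof.
move=> /run_first[a [ra /run_first[b [rb /run_first[c [rc h]]]]]].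
by exists a, b, c; rewrite /c_find run_seq ra run_seq rb rc.
Qed.

Lemma lists_exist s p : encodes s p -> (forall v, ord p v <= k) ->
  let r := run inp (c_sats k) s in
  [/\ r.2 = [::], same_low s r.1 & exists sl, lists r.1 p sl].
Proof.
move=> rs pk r; have [h1 h2 h3] := run_sats E k rs; split=> //.
have [sl hs] := fin_all_exists (fun v => h3 v (pk v)).
by exists sl.
Qed.

Lemma run_search s p : star_map_le e k p -> encodes s p ->
  let r := run inp (c_search k t) s in
  (exists p', [/\ encodes r.1 p', star_map_le e k p', revise e k t (packing_of p) (packing_of p'),
     num_other t (packing_of p) < num_other t (packing_of p') & packing_code (packing_of p') r.2])
  \/ [/\ encodes r.1 p, r.2 = [::] & forall Q', ~ revise e k t (packing_of p) Q'].
Proof.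
move=> [sm pk] rs; rewrite /c_search run_seq.
have [o1 rs1 ho1 _] := run_ord E rs; rewrite o1.
set s1 := (run inp c_ord s).1 in rs1 ho1 *; rewrite run_seq.
have [o2 low [sl hs]] := lists_exist rs1 pk; rewrite o2.
set s2 := (run inp (c_sats k) s1).1 in low hs *.
have rs2 : encodes s2 p by move=> v; rewrite low.
have ho2 (v : 'I_n) : s2 2 v = ord p v by rewrite low.
rewrite run_if; set any := xany _; cbn [fst snd cat].
case: ifP => [|/negbT none].
  move=> /run_find[a [b [c [rf tr]]]]; left; rewrite run_seq rf; cbn [fst snd].
  set s3 := upd _ 0 3 c in tr *.
  have [cd [cdin cdt rc]] := run_choose tr.
  move: cdin cdt rc; rewrite mem_candidates; case: cd => os g /and5P[/eqP]; cbn [fst snd].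
  move=> sg id_g osk nsk sh cdt; rewrite run_seq => ->.
  have os4 := revise_shape_size sh.
  (* A revision of fewer than three stars ignores the last variables, whatever values the search has
     given them. *)
  pose F := take (size os) [:: a; b; c].
  have sF : size F = size os by rewrite size_takel.
  have hF : [seq s3 0 i | i <- iota 1 (size F)] = map val F.
    by rewrite sF /F; move: os4; case: (size os) => [|[|[|[|]]]].
  have hs3 : lists s3 p sl by do 3!apply: lists_upd.
  have ho3 (v : 'I_n) : s3 2 v = ord p v by exact: (ho2 v).
  have rs3 : encodes s3 p by exact: rs2.
  have F4 : size F < 4 by rewrite sF.
  move: cdt; rewrite (truth_cond a hs3 ho3 F4 hF id_g sg sF) => /and3P[/eqP osE uF lk].
  have F0 : {in F, forall c, 0 < ord p c}.
    by move=> v vF; have /allP/(_ (ord p v)) := osk; rewrite -osE map_f // => /(_ isT)/andP[].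
  have LF := mem_star_list hs3 sm F0; have uL := uniq_star_list hs3 sm uF F0.
  have sL := size_star_list F hs3; rewrite osE -sg in sL.
  have cf := config_rearrange sm uL LF e_sym (esym sL) id_g lk.
  have [o4 rs4] := run_apply a hs3 rs3 hF id_g uL (etrans sg (congr1 slots (esym osE))).
  rewrite osE in o4 rs4; set s4 := (run inp (c_apply (os, g)) s3).1 in rs4 *; rewrite o4.
  set p' := rearrange p (star_list sl F) g in cf rs4.
  have l2 : unzip2 [seq (nth a (star_list sl F) i, (count_mem i g).-1) | i <- iota 0 (size g) & nth 0 g i == i]
    = new_orders g by rewrite /unzip2 -map_comp.
  have [|| smk' rv lt] := revise_sound (k := k) t2 (conj sm pk) uF F0 cf.
  - by rewrite l2; apply/allP.
  - by rewrite l2 osE.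
  have [f5 pc] := run_emit E smk'.1 rs4.
  exists p'; split=> //.
  by move=> v; rewrite f5.
right; split=> // Q' rv.
have [F [p' [F' [uF F0 [cf F'k] sh _]]]] := revise_complete (conj sm pk) rv.
have LF := mem_star_list hs sm F0; have uL := uniq_star_list hs sm uF F0.
have sF := revise_shape_size sh; rewrite size_map in sF.
have sL := size_star_list F hs.
have [x0 _] : exists x0, x0 \in F.
  case: (F) sh => [|x0 F1 _]; last by exists x0; rewrite mem_head.
  move=> /or3P[/and3P[_ /perm_size]|/and3P[]|/and3P[/hasP[i _ /perm_size]]] //.
have [id_g lk rE pn] := rearrange_config x0 sm uL LF e_sym cf.
set g := map _ _ in id_g lk rE pn.
have sg : size g = slots [seq ord p c | c <- F] by rewrite size_map.
(* With fewer than three stars the surplus variables take the default [x0]; the condition does not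
   read them. *)
pose s3 := upd (upd (upd s2 0 1 (nth x0 F 0)) 0 2 (nth x0 F 1)) 0 3 (nth x0 F 2).
have hs3 : lists s3 p sl by do 3!apply: lists_upd.
have hF : [seq s3 0 i | i <- iota 1 (size F)] = map val F.
  by rewrite /s3; move: sF; case: (F) => [|? [|? [|? []]]].
have nsE : perm_eq [seq ord p' c | c <- F'] (new_orders g) by rewrite perm_sym.
have cdk : candidate k t ([seq ord p c | c <- F], g).
  rewrite /candidate; cbn [fst snd]; rewrite sg eqxx id_g.
  rewrite -(revise_shape_perm _ _ nsE) sh -(perm_all _ nsE); apply/and5P; split=> //.
    by apply/allP=> o /mapP[c /F0 c0 ->]; rewrite c0 pk.
  by apply/allP=> o /mapP[c /F'k ck ->].
have tr : truth s3 any.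
  apply: (@truth_any s3 _ ([seq ord p c | c <- F], g)); first by rewrite mem_candidates.
  by rewrite (truth_cond x0 hs3 ho2 sF hF id_g sg) ?size_map // eqxx uF.
case/negP: none; rewrite truth_sum; apply/existsP.
exists (nth x0 F 0); rewrite truth_sum; apply/existsP; exists (nth x0 F 1).
by rewrite truth_sum; apply/existsP; exists (nth x0 F 2).
Qed.

End Search.

(** * The complete program *)

(** Array 5 holds the first satellite of each star, the one removed from a t-star. Only the entry
    about to be changed is read from array 1, so the update in place is harmless. *)
Definition c_trim k t :=
  CSeq c_ord (CSeq (c_sats k)
    (cfill 1 1 (xand (xeq (xord (xpar (xv 1))) (XL t)) (xeq (xsat 0 (xpar (xv 1))) (xv 1)))
       (xv 1))).

Definition c_main k t :=
  CSeq (c_max k) (CSeq c_emit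
    (CSeq (CFor BN 8 (c_search k t)) (CSeq (c_trim k t) c_emit))).

(** For an edgeless graph the time bound is constant, which excludes even one loop over the
    vertices. The two zeros are the empty working packing and the empty output. *)
Definition local_search_prog k t :=
  If (Reg (Lit 1)) (compc 0 (c_main k t)) (Seq (Emit (Lit 0)) (Emit (Lit 0))).

Lemma xdeg_slots a b c os : all (fun x => xdeg x a b) (xslots c os).
Proof.
elim: os c => [//|o os IH] c; cbn [xslots all]; rewrite all_cat IH andbT.
by rewrite all_map; apply/allP.
Qed.

Lemma xdeg_slot a b c os i : xdeg (nth (XL 0) (xslots c os) i) a b.
Proof.
case: (ltnP i (size (xslots c os))) => h; last by rewrite nth_default.
exact: (all_nthP (XL 0) (xdeg_slots a b c os)).
Qed.

Section Degrees.
Variables (a b : nat).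
Hypothesis b0 : 0 < b.

Lemma xdeg_all xs : all (fun x => xdeg x a b) xs -> xdeg (xall xs) a b.
Proof. by elim: xs => [//|x xs IH] /andP[xd /IH xsd]; rewrite /= xd. Qed.

Lemma xdeg_eqs xs os : all (fun x => xdeg x a b) xs -> xdeg (xeqs xs os) a b.
Proof. by elim: xs os => [|x xs IH] [|o os] //= /andP[-> /IH ->]. Qed.

Lemma xdeg_cond cd : xdeg (xcond cd) a b.
Proof.
case: cd => os g; rewrite /xcond; cbn [fst snd].
suff : [&& xdeg (xeqs [seq xord x | x <- xcenters os] os) a b,
  xdeg (xuniq (xcenters os)) a b & xdeg (xlinks (xslots 1 os) g) a b].
  by case/and3P=> h1 h2 h3; rewrite /= h1 h2 h3.
apply/and3P; split.
- by apply: xdeg_eqs; rewrite /xcenters !all_map; apply/allP.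
- rewrite /xcenters; elim: (iota _ _) => [//|i l IH]; cbn [map xuniq].
  have h : xdeg (xall [seq xnot (xeq (xv i) y) | y <- [seq xv i | i <- l]]) a b.
    by apply: xdeg_all; rewrite !all_map; apply/allP.
  by rewrite /= IH h.
apply: xdeg_all; rewrite all_map; apply/allP => i _ /=.
by case: eqP => _ //=; rewrite !xdeg_slot b0.
Qed.

Lemma xdeg_any cds : xdeg (xany cds) a b.
Proof.
by elim: cds => [//|cd cds IH]; rewrite /xany; cbn [map foldr]; rewrite /xor; cbn [xdeg]; rewrite xdeg_cond.
Qed.

Lemma cdeg_choose cds : cdeg (c_choose cds) a b.
Proof.
elim: cds => [//|cd cds IH]; rewrite /c_choose; cbn [foldr cdeg]; rewrite xdeg_cond.
rewrite -/(c_choose cds) IH andbT /= /c_apply /c_stores.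
elim: (iota _ _) => [//|i l IHl]; cbn [map foldr cdeg].
by rewrite IHl !xdeg_slot.
Qed.

End Degrees.

Lemma cdeg_sats k a b : cdeg (c_sats k) a.+2 b.
Proof.
elim: k => [//|k IH]; rewrite [c_sats _]/=; cbn [cdeg]; rewrite IH /= andbT.
by rewrite /xfresh; elim: (iota 0 k) => //= i l ->.
Qed.

(** Both phases exhaust the budget: of order n^2 steps of cost n^2 m for the maximum packing, and n
    searches of cost n^3 m for the revisions. *)
Lemma cdeg_main k t : cdeg (c_main k t) 4 1.
Proof.
have hs : cdeg (c_search k t) 3 1.
  rewrite /c_search /c_find /c_first; cbn [cdeg xdeg]; rewrite cdeg_sats !xdeg_any // cdeg_choose //.
by rewrite /c_main; cbn [cdeg]; rewrite hs /c_trim; cbn [cdeg]; rewrite cdeg_sats.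
Qed.

Lemma packings_code_rcons n (Qs : seq {set star 'I_n}) P w1 w2 :
  packings_code Qs w1 -> packing_code P w2 -> packings_code (rcons Qs P) (w1 ++ w2).
Proof.
elim: Qs w1 => [|Q Qs IH] w1 /=; first by move=> -> hP; exists w2, [::]; rewrite cats0.
by move=> [u [v [hu /IH hv ->]]] /hv h; exists u, (v ++ w2); rewrite catA.
Qed.

Section Main.
Variables (k t n : nat) (e : rel 'I_n) (E : seq ('I_n * 'I_n)).
Hypotheses (e_sym : symmetric e) (e_irr : irreflexive e) (hE : edge_listing e E).
Hypotheses (t2 : 1 < t) (tk : t < k).
Notation inp := (input_memory E).
Notation truth := (holds E).
Implicit Types (s : state) (p : 'I_n -> 'I_n).

Lemma run_trim s p : star_map_le e k p -> encodes s p ->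
  let r := run inp (c_trim k t) s in
  r.2 = [::] /\ exists f, (forall c, ord p c = t -> f c \in sats p c) /\
    encodes r.1 (trim_map t p f).
Proof.
move=> [sm pk] rs; rewrite /c_trim run_seq.
have [o1 rs1 ho1 _] := run_ord E rs; rewrite o1.
set s1 := (run inp c_ord s).1 in rs1 ho1 *; rewrite run_seq.
have [o2 low [sl hs]] := lists_exist E rs1 pk; rewrite o2.
set s2 := (run inp (c_sats k) s1).1 in low hs *.
have rs2 : encodes s2 p by move=> v; rewrite low.
have ho2 (v : 'I_n) : s2 2 v = ord p v by rewrite low.
pose f c := head c (sl c).
have fP c : ord p c = t -> f c \in sl c /\ s2 5 c = f c.
  move=> ct; have [_ _] := hs c; rewrite ct -(prednK (ltnW t2)) /f.
  by case: (sl c) => [//|x l] [-> _]; rewrite /= mem_head.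
have [|o3 f3 v3] := @run_fill_ord n E 1 1
  (xand (xeq (xord (xpar (xv 1))) (XL t)) (xeq (xsat 0 (xpar (xv 1))) (xv 1))) (xv 1) s2
  (fun v => (ord p (p v) == t) && (f (p v) == v)) (fun v : 'I_n => val v) isT.
  move=> v s3 f3 h3 hv; split=> [|_]; last exact: hv.
  rewrite truth_and !truth_eq.
  have -> : xeval inp s3 (xord (xpar (xv 1))) = ord p (p v).
    by rewrite /= hv h3 // rs2 f3.
  have -> : xeval inp s3 (xsat 0 (xpar (xv 1))) = s2 5 (p v).
    by rewrite /= hv h3 // rs2 f3.
  have -> : xeval inp s3 (xv 1) = v by [].
  by case: eqP => //= /fP[_ ->].
rewrite o3; split=> //; exists f; split.
  by move=> c /fP[+ _]; have [_ -> _] := hs c.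
by move=> v; apply: (etrans (v3 v)); rewrite rs2 /trim_map; case: ifP.
Qed.

(** A center has a satellite, so not all vertices are centers. Strictness matters: [n] successful
    rounds would raise the number of these stars to at least [n], so some search among the [n]
    fails. *)
Lemma num_other_lt p : 0 < n -> star_map e p -> num_other t (packing_of p) < n.
Proof.
move=> n0 sm; rewrite num_other_packing_of ltn_neqAle.
rewrite [X in _ <= X](_ : n = #|'I_n|) ?max_card ?andbT; last by rewrite card_ord.
rewrite -[X in _ != X]card_ord -cardsT; apply/eqP => h.
have /setP full : [set v | (0 < ord p v) && (ord p v != t)] = setT.
  by apply/eqP; rewrite eqEcard subsetT h leqnn.
have := full (Ordinal n0); rewrite !inE => /andP[/card_gt0P[w]].
rewrite in_sats => /andP[/eqP pw wN] _; have := full w; rewrite !inE => /andP[w0 _].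
by rewrite -pw (ord_gt0_center sm w0) eqxx in wN.
Qed.

Definition stuck p := forall Q', ~ revise e k t (packing_of p) Q'.

Lemma run_loop s p : 0 < n -> star_map_le e k p -> encodes s p ->
  let r := run inp (CFor BN 8 (c_search k t)) s in
  exists p' Qs, [/\ star_map_le e k p', encodes r.1 p', packings_code Qs r.2 &
    revise_loop e k t (packing_of p) (packing_of p :: Qs) (packing_of p')].
Proof.
move=> n0 smk0 rs0.
(* The run so far is described by what it adds in front of any continuation, because [revise_loop]
   grows at its head whereas the program appends. *)
pose I m s (o : seq nat) := exists p' Qs,
  [/\ star_map_le e k p', encodes s p', packings_code Qs o,
      forall Qs' R, revise_loop e k t (packing_of p') (packing_of p' :: Qs') R ->
        revise_loop e k t (packing_of p) (packing_of p :: Qs ++ Qs') R &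
      stuck p' \/ m <= num_other t (packing_of p')].
have [||p' [Qs [smk rs code loop h]]] := @run_for_inv n E BN 8 (c_search k t) s I.
- by exists p, [::]; split=> //; right.
- move=> i s1 o _ [p1 [Qs [smk rs code loop h]]] r.
  have rs1 : encodes (upd s1 0 8 i) p1 by [].
  have [[p2 [rs2 smk2 rv lt code2]]|[rs2 o2 st]] := run_search e_sym hE t2 smk rs1.
    exists p2, (rcons Qs (packing_of p2)); split=> //.
    + exact: packings_code_rcons.
    + by move=> Qs' R h'; rewrite cat_rcons; apply: loop; apply: revise_loop_step rv h'.
    by case: h => [/(_ _ rv)//|h]; right; apply: leq_ltn_trans h lt.
  exists p1, Qs; split=> //; last by left.
  by rewrite /r o2 cats0.
exists p', Qs; split=> //; rewrite -[Qs]cats0; apply: loop; apply: revise_loop_exit.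
case: h => // h; have := num_other_lt n0 smk.1.
by rewrite ltnNge (leq_trans _ h).
Qed.

Lemma run_main s : 0 < n -> exists Qs P,
  local_search e k t Qs P /\ packings_code (rcons Qs P) (run inp (c_main k t) s).2.
Proof.
move=> n0; have k2 : 1 < k := ltn_trans t2 tk.
rewrite /c_main run_seq.
have [o1 [p [rs smk st]]] := run_max e_sym e_irr hE k2 s; rewrite o1.
set s1 := (run inp (c_max k) s).1 in rs *; rewrite run_seq.
have [f2 code0] := run_emit E smk.1 rs.
set r2 := run inp c_emit s1 in f2 code0 *; rewrite run_seq.
have rs2 : encodes r2.1 p by move=> v; rewrite f2.
have [p' [Qs [smk' rs3 code loop]]] := run_loop n0 smk rs2.
set r3 := run inp (CFor BN 8 (c_search k t)) r2.1 in rs3 code *; rewrite run_seq.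
have [o4 [f [fP rs4]]] := run_trim smk' rs3; rewrite o4.
set s4 := (run inp (c_trim k t) r3.1).1 in rs4 *.
have [smk4 _ _] := trim_mapP t2 tk smk' fP.
have [_ code4] := run_emit E smk4.1 rs4.
exists (packing_of p :: Qs), (packing_of (trim_map t p' f)); split.
  exists (packing_of p), (packing_of p'); split=> //; first exact: (stuck_max e_sym k2).
  exists (fun st : star 'I_n => f st.1); split; last exact: (packing_of_trim_map t2 tk smk' fP).
  move=> st'; rewrite mem_packing_of => /andP[_ /eqP ->] ct; exact: fP.
cbn [fst snd cat]; rewrite catA; apply: packings_code_rcons code4.
by exists r2.2, r3.2.
Qed.

End Main.

Lemma runs_local_search k t : 1 < t -> t < k ->
  runs_local_search_in_time k t (local_search_prog k t).
Proof.
move=> t2 tk; have [C HC] := compc_ok 0 (cdeg_main k t).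
(* The edgeless run costs 7 steps; the same allowance pays for the initial test, of cost 3, in the
   other case. *)
exists (C + 7) => n e E e_sym e_irr hE.
have sE : size E = #|edge_set e| := size_edges hE.
have [m0|m0] := posnP (size E); last first.
  have n0 : 0 < n by case: (E) m0 => // -[[]]; case: (n) => [[]|].
  have rep : represents (input_memory E) (fun _ _ => 0) (input_memory E).
    split=> // a i; apply: nth_default.
    apply: leq_trans (cell_input _ _ _); rewrite [X in X <= _]/= addn2 !ltnS.
    rewrite size_flatten /shape -map_comp [X in _ <= X](_ : _ = size E + size E) //.
    by elim: (E) => //= uv E' IH; rewrite add2n addSn addnS !ltnS.
  have [mu [out [c [ex cC [_ out_ _]]]]] := HC (input_memory E) _ _ n0 m0 rep.
  have [Qs [P [ls code]]] := run_main e_sym e_irr hE t2 tk (fun _ _ => 0) n0.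
  exists mu, out, (ecost (Reg (Lit 1)) + c).+1, Qs, P; split=> //; last by rewrite out_.
    by apply: exec_if; rewrite /= -lt0n m0.
  move: cC; rewrite /size2 /= expn1 -sE; move: (n ^ 4 * size E) => X; nia.
have e0 u v : e u v = false by rewrite (edge_listingP e_sym hE); case: (E) m0.
have no_star Q : star_packing e k Q -> Q = set0.
  move=> /andP[/forallP h _]; apply/setP=> s; rewrite inE; apply/negbTE/negP=> sQ.
  have := h s; rewrite sQ => /andP[/and4P[/card_gt0P[v vs] _ _ /forallP/(_ v)]].
  by rewrite vs e0.
have pk0 : star_packing e k (set0 : {set star 'I_n}).
  by apply/andP; split; apply/forallP=> s; rewrite inE.
exists (input_memory E), ([:: 0] ++ [:: 0]), (ecost (Reg (Lit 1)) + (2 + 2)).+1, [:: set0], set0; split.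
- apply: exec_if; have -> : eval (input_memory E) (Reg (Lit 1)) = 0 by [].
  by apply: exec_seq; apply: exec_emit.
- by rewrite /=; lia.
- exists set0, set0; split.
  + by split=> // Q /no_star ->.
  + apply: revise_loop_exit => Q' [old [new [oldQ _ sh _ _]]].
    have old0 : orders old = [::] by move: oldQ; rewrite subset0 => /eqP ->; rewrite /orders enum_set0.
    by case: sh => [[_]|[i []]|[i [_]]]; rewrite old0 => /perm_size.
  exists (fun st => st.1); split; first by move=> st; rewrite inE.
  by rewrite imset0.
have c0 : packing_code (set0 : {set star 'I_n}) [:: 0] by exists [::]; rewrite enum_set0.
by exists [:: 0], [:: 0]; split=> //; exists [:: 0], [::].
Qed.

Theorem theorem3 (k t : nat) (ht : 2 <= t) (hk : t < k) :
  (exists p : prog, runs_local_search_in_time k t p) /\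
  (forall (T : finType) (e : rel T), symmetric e -> irreflexive e ->
   forall (Qs : seq {set star T}) (P : {set star T}),
     local_search e k t Qs P ->
     star_packing_no e k t P /\
     ((opt e k t)%:R <=
        (1 + 1 / (t%:R + 1 + 1 / k%:R)) * #|covered P|%:R :> rat)%R).
Proof.
split; first by exists (local_search_prog k t); apply: runs_local_search.
by move=> T e e_sym e_irr Qs P; apply: approximation.
Qed.
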